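(* Suppose that $\beta\ge\alpha\ge1$ (both real). (1) The probability measure $\mathsf M$ is the unique fixed point of $\mathsf T$ in $\mathscr P_\alpha$. (2) If $\alpha=\beta$, then for all $\mu\in\mathscr P_\alpha$, $\mathrm d_{W,2}(\mathsf T^n\mu,\mathsf M)^2=O(1/n)$ as $n\to\infty$. (3) If $\beta>\alpha$, then for all $\mu\in\bigcup_{\alpha\le\gamma<\beta}\mathscr P_\gamma$, $\mathrm d_{W,2}(\mathsf T^n\mu,\mathsf M)^2=O\big((\alpha/\beta)^n\big)$ as $n\to\infty$. (4) The fixed point $\mathsf M$ is a solution of the equation (equality in law) $W=\sum_{j\ge1}a_jW(j)\widetilde W(j)$, where $W$ is distributed according to $\mathsf M$ and the $W(j),\widetilde W(j)$, $j\ge1$, are independent copies of $W$, also independent of $a$.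
   Context: Let $a=(a_j)_{j\ge 1}$ be a sequence of non-negative random variables with $\mathbb E\sum_{j\ge1}a_j=1$ and $\mathbb E\big(\sum_{j\ge1}a_j\big)^2<\infty$; it is excluded that almost surely $a_j\in\{0,1\}$ for all $j\ge1$. Set $b=\frac{\mathbb E(\sum a_j)^2}{\mathbb E\sum a_j^2}$ and $q=\frac1{\mathbb E(\sum a_j)^2}$, and suppose $b>2$. Let $\varphi(x)=\frac{b-1}{bq-x}$; its fixed points are the roots of $x^2-bqx+b-1$, denoted $\alpha\le\beta$ when they are real. Words: $\mathbb N_+$ is the set of positive integers, $\mathscr T_n=\mathbb N_+^n$, $\mathscr T=\bigcup_{n\ge0}\mathscr T_n$, $\epsilon$ is the empty word (on any alphabet), juxtaposition is concatenation, $w|_k$ is the prefix of length $k$ of $w$. The map $\mathsf T$: let $\mu$ be the law of a complex random variable $W$ with $\mathbb EW=1$ and $\mathbb E|W|^2<bq$. Let $(W(w))_{w\in\mathscr T}$ and $(a(w))_{w\in\mathscr T}$ be two independent families of independent copies of $W$ and of $a$ respectively. Then $Y_n=\sum_{w=j_1\cdots j_n\in\mathscr T_n}\prod_{k=0}^{n-1}a_{j_{k+1}}(w|_k)\,W(w|_{k+1})$ is a martingale bounded in $L^2$; $\mathsf T\mu$ is the law of its limit $Y$. For $\gamma\ge1$, $\mathscr P_\gamma$ is the set of Borel probability measures $\mu$ on $\mathbb C$ with $\int z\,\mu(\mathrm dz)=1$ and $1\le\int|z|^2\mu(\mathrm dz)\le\gamma$. For $\gamma=\alpha$, or $\gamma\in[\alpha,\beta)$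 when $\alpha<\beta$, $\mathscr P_\gamma$ is stable under $\mathsf T$, so $\mathsf T^n\mu$ is defined for all $n$. The distance $\mathrm d_{W,2}$ is the $2$-Wasserstein distance: $\mathrm d_{W,2}(\mu,\mu')^2=\inf_\rho\int_{\mathbb C^2}|x-y|^2\,\mathrm d\rho(x,y)$, the infimum being over couplings $\rho$ of $\mu$ and $\mu'$. The measure $\mathsf M$: let $\{a(w,m)\}$, indexed by $(w,m)\in\bigcup_{n\ge0}\mathscr T_n\times\{0,1\}^n$, be independent copies of $a$. Put $Z_1(w,m)=\sum_{j\ge1}a_j(w,m)$ and, for $n\ge2$, $Z_n(w,m)=\sum_{j\ge1}a_j(w,m)\,Z_{n-1}(wj,m0)\,Z_{n-1}(wj,m1)$. When $\alpha\ge1$, $Z_n=Z_n(\epsilon,\epsilon)$ is a non-negative martingale bounded in $L^2$; $\mathsf M$ is the law of its limit. *)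

(* Defs.v *)
From HB Require Import structures.
From mathcomp Require Import all_boot all_order all_algebra finmap complex.
From mathcomp Require Import all_classical all_reals all_analysis.
From mathcomp Require Import giry summability.

Set Implicit Arguments.
Unset Strict Implicit.
Unset Printing Implicit Defensive.

Import Order.TTheory GRing.Theory Num.Theory.
Import numFieldNormedType.Exports.

Local Open Scope classical_set_scope.
Local Open Scope ring_scope.
Local Open Scope complex_scope.

(* The Borel sigma-algebra on the complex numbers; the carrier is convertible to
   [R[i]], which has no measurable structure of its own. *)
Definition borelC (R : realType) := g_sigma_algebraType (@open R[i]^o).

(* Real sequences with the product sigma-algebra, generated by the
   coordinates. *)
Definition seqR (R : realType) := g_sigma_algebraType
  (\bigcup_(j in [set: nat])
     preimage_set_system [set: nat -> R] (fun x => x j) (@measurable _ R)).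

Section probability.
Context (R : realType).

(* Equality of functions [set T -> \bar R] would be too strong: a [probability]
   is unconstrained outside the measurable sets; hence [has_law], and [≡μ] of
   the Giry monad library, compare measurable sets only. *)
Definition has_law d d' (Omega : measurableType d) (T : measurableType d')
    (P : probability Omega R) (X : Omega -> T) (mu : set T -> \bar R) :=
  forall B : set T, measurable B -> P (X @^-1` B) = mu B.

Definition generated_sigma d d' (Omega : measurableType d)
    (T : measurableType d') (X : Omega -> T) : set_system Omega :=
  preimage_set_system setT X measurable.

Definition mutually_independent d (Omega : measurableType d)
    (P : probability Omega R) (I : choiceType) (D : set I)
    (F : I -> set_system Omega) :=
  forall (J : {fset I}) (E : I -> set Omega),
    [set` J] `<=` D -> (forall i, i \in J -> F i (E i)) ->
    P (\bigcap_(i in [set` J]) E i) = (\prod_(i <- J) P (E i))%E.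

Section weights.
Context d (Omega : measurableType d) (P : probability Omega R).

(* The entries of a sequence are numbered from 0: [a j] stands for the
   (j+1)-st one, and words on the positive integers become words on [nat]. *)
Definition path_of (a : nat -> {RV P >-> R}) : Omega -> seqR R :=
  fun w j => a j w.

Definition total_weight (a : nat -> {RV P >-> R}) (w : Omega) : \bar R :=
  (\sum_(0 <= j <oo) (a j w)%:E)%E.

Definition param_b (a : nat -> {RV P >-> R}) : R :=
  fine (\int[P]_w (total_weight a w ^+ 2))%E /
  fine (\int[P]_w \sum_(0 <= j <oo) (a j w ^+ 2)%:E)%E.

Definition param_q (a : nat -> {RV P >-> R}) : R :=
  (fine (\int[P]_w (total_weight a w ^+ 2))%E)^-1.

End weights.

Definition copy_of d (Omega : measurableType d) (P : probability Omega R)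
    d0 (Omega0 : measurableType d0) (P0 : probability Omega0 R)
    (A : nat -> {RV P >-> R}) (a : nat -> {RV P0 >-> R}) :=
  has_law P (path_of A) (pushforward P0 (path_of a)).

Definition calP (gamma : R) : set (probability (borelC R) R) :=
  [set mu : probability (borelC R) R |
           [/\ (\int[mu]_z (complex.Re (z : R[i]))%:E = 1)%E,
                (\int[mu]_z (complex.Im (z : R[i]))%:E = 0)%E,
                (1 <= \int[mu]_z (ComplexField.Normc.normc (z : R[i]) ^+ 2)%:E)%E &
                (\int[mu]_z (ComplexField.Normc.normc (z : R[i]) ^+ 2)%:E
                   <= gamma%:E)%E ] ].

Definition coupling (mu nu : probability (borelC R) R) :
    set (probability (borelC R * borelC R)%type R) :=
  [set rho | has_law rho fst mu /\ has_law rho snd nu].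

Definition dW2 (mu nu : probability (borelC R) R) : \bar R :=
  sqrte (ereal_inf [set (\int[rho]_p
    (ComplexField.Normc.normc ((p.1 : R[i]) - p.2) ^+ 2)%:E)%E
    | rho in coupling mu nu]).

(* Infinite sums of complex numbers over a countable index set are unconditional:
   [partial_sum x @ totally --> s] is convergence along the directed family of
   finite subsets of the index set, and [summability.sum x] is the limit. *)
Definition sumC (I : choiceType) (x : I -> R[i]) : R[i] :=
  summability.sum (x : I -> R[i]^o).

Definition dirac0 : probability (borelC R) R :=
  @dirac _ (borelC R) (0 : R[i]) R.

Section maps.
Context d0 (Omega0 : measurableType d0) (P0 : probability Omega0 R)
  (a : nat -> {RV P0 >-> R}).

Definition Y_ d (Omega : measurableType d) (P : probability Omega R)
    (A : seq nat -> nat -> {RV P >-> R}) (W : seq nat -> {RV P >-> borelC R})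
    (n : nat) (w : Omega) : R[i] :=
  sumC (fun u : n.-tuple nat =>
    \prod_(k < n) ((A (take k u) (tnth u k) w)%:C * (W (take k.+1 u) w : R[i]))).

Definition is_T (mu nu : probability (borelC R) R) : Prop :=
  exists (d : measure_display) (Omega : measurableType d)
    (P : probability Omega R)
    (A : seq nat -> nat -> {RV P >-> R}) (W : seq nat -> {RV P >-> borelC R})
    (Y : {RV P >-> borelC R}),
  [/\ (forall u, copy_of (A u) a) /\ (forall u, has_law P (W u) mu),
      mutually_independent P setT (fun i : seq nat + seq nat =>
        match i with
        | inl u => generated_sigma (path_of (A u))
        | inr u => generated_sigma (W u)
        end),
      {ae P, forall w,
        (fun n => Y_ A W n w : R[i]^o) @ \oo --> (Y w : R[i]^o)} &
      has_law P Y nu].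

(* The law of the limit does not depend on the families, nor on the probability
   space carrying them, so [T mu] is chosen among the [nu] satisfying [is_T mu nu], which
   are all equal up to [≡μ]. The default value, used when there is none, has
   mean 0 and thus belongs to no [calP gamma]. *)
Definition T (mu : probability (borelC R) R) : probability (borelC R) R :=
  xget dirac0 [set nu | is_T mu nu].

(* [Z_ A 0 u m w = 1] makes [Z_ A 1 u m w] the sum of the [A u m j w]. *)
Fixpoint Z_ d (Omega : measurableType d) (P : probability Omega R)
    (A : seq nat -> seq bool -> nat -> {RV P >-> R})
    (n : nat) (u : seq nat) (m : seq bool) (w : Omega) : \bar R :=
  if n is n'.+1 then
    (\sum_(0 <= j <oo) (A u m j w)%:E *
       Z_ A n' (rcons u j) (rcons m false) w *
       Z_ A n' (rcons u j) (rcons m true) w)%E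
  else 1%E.

Definition is_M (nu : probability (borelC R) R) : Prop :=
  exists (d : measure_display) (Omega : measurableType d)
    (P : probability Omega R)
    (A : seq nat -> seq bool -> nat -> {RV P >-> R}) (Z : {RV P >-> R}),
  [/\ (forall u m, size u = size m -> copy_of (A u m) a),
      mutually_independent P [set i : seq nat * seq bool | size i.1 = size i.2]
        (fun i => generated_sigma (path_of (A i.1 i.2))),
      {ae P, forall w, Z_ A n [::] [::] w @[n --> \oo] --> (Z w)%:E} &
      has_law P (fun w => (Z w)%:C : borelC R) nu].

Definition M : probability (borelC R) R :=
  xget dirac0 is_M.

(* [nu] is the law of the sum of the [a_j W(j) W'(j)], for independent
   [W(j)], [W'(j)] with law [mu], independent of [a]. *)
Definition is_quadratic_image (mu nu : probability (borelC R) R) : Prop :=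
  exists (d : measure_display) (Omega : measurableType d)
    (P : probability Omega R)
    (A : nat -> {RV P >-> R}) (W W' : nat -> {RV P >-> borelC R})
    (S : {RV P >-> borelC R}),
  [/\ [/\ copy_of A a, forall j, has_law P (W j) mu &
          forall j, has_law P (W' j) mu],
      mutually_independent P setT (fun i : option (nat + nat) =>
        match i with
        | None => generated_sigma (path_of A)
        | Some (inl j) => generated_sigma (W j)
        | Some (inr j) => generated_sigma (W' j)
        end),
      {ae P, forall w,
        partial_sum (fun j => (A j w)%:C * (W j w : R[i]) * (W' j w : R[i])
                       : R[i]^o) @ totally --> (S w : R[i]^o)} &
      has_law P S nu].

(* Equality in law of [W] and the sum. The first clause provides variables for
   which it holds; the second says that it holds for all of them. *)
Definition solves_quadratic_equation (mu : probability (borelC R) R) : Prop :=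
  is_quadratic_image mu mu /\
  forall nu, is_quadratic_image mu nu -> nu ≡μ mu.

End maps.
End probability.

(* Main.v *)
Require Import Defs.
From HB Require Import structures.
From mathcomp Require Import finmap.
From mathcomp Require Import all_boot all_order all_algebra complex.
From mathcomp Require Import all_classical all_reals all_analysis.
From mathcomp Require Import measurable_realfun giry summability.
From mathcomp Require Import ring lra zify.

(** Write c = 1 / (alpha + beta) and phi(x) = alpha beta / (alpha + beta - x).
    By the relations between roots and coefficients, the weights satisfy
    E S = 1, E S^2 = (alpha beta + 1) c for their sum S, and the sum of their
    squares has expectation c. Everything rests on one computation of second
    moments ([ip_wsum], [ip_bb]): if the D_j are independent copies of a
    variable of mean 1, and if D'_j are further copies such that D_j and D'_k
    are independent for distinct j and k, then the covariance of the sums of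
    the a_j D_j and of the a_j D'_j is c (alpha beta + v), where v is that of
    D_j and D'_j, covariances being understood without centering.

    With D_j = W(j) Y(j) it shows that the second moments of the smoothing sums
    Y_n follow an affine contraction with fixed point phi(E |W|^2), and that
    for a pair of marks (W, W') with covariance u the two limits, built with
    the same weights, have covariance phi(u) ([ip_ylim]). Hence T maps a law
    with second moment s to one with second moment phi(s), and a coupling of
    two laws with covariance u to a coupling of their images with covariance
    phi(u) ([T_coupling]).

    With D_j = Z(j0) Z(j1) it shows that the second moments of the martingale
    Z_n follow x' = c (alpha beta + x^2), and so increase from 1 to alpha, with
    a gap of order 1 / n ([zeta_gap]). This rate gives almost sure convergence
    ([ae_cvg_cubes]), and the limit Z, of second moment alpha, satisfies
    Z = sum of the a_j Z(j0) Z(j1): its law M solves the quadratic equation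
    ([quadratic_image_M], [is_quadratic_image_unique]).

    To see that T M = M ([T_fixed_M]), plant independent leaves with law M at
    the ends of the words of length n: by the quadratic equation, the smoothing
    sum with leaves still has law M, for every n. The leaves are forgotten in
    L2 when n grows, as s c < 1, so the limit has law M as well as T M. Finally
    start from the independent coupling of a law mu with M, of covariance 1,
    and apply T repeatedly: the squared distance from T^n mu to M is at most
    phi^n(s) + alpha - 2 phi^n(1) ([cost_iter_T]). The orbit of 1 increases
    to alpha, at speed 1 / n in general ([gap_harmonic]) and geometrically when
    alpha < beta ([gap_geometric], [excess_geometric]). This gives the rates;
    it also gives the uniqueness of the fixed point, since couplings of cost
    tending to 0 identify laws ([close_couplings_eq]).

    The variables are realized on canonical spaces: products of probability
    measures over countable sets of nodes are built by Kakutani's argument, and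
    any other realization of the independent families has the same joint law
    ([has_law_fam_prod]). On a canonical space the subtrees of a tree are
    obtained by reindexing the coordinates, and their independence is that of
    disjoint blocks of coordinates ([fam_prod_indep]). *)

Set Implicit Arguments.
Unset Strict Implicit.
Unset Printing Implicit Defensive.

Import Order.TTheory GRing.Theory Num.Theory.
Import numFieldNormedType.Exports.

Local Open Scope classical_set_scope.
Local Open Scope ring_scope.

(** * Infinite products of probability measures *)

(** [seqR R] is convertible to [famT R nat]. *)
Definition famT d (S : measurableType d) (I : Type) := g_sigma_algebraType
  (\bigcup_(i in [set: I])
     preimage_set_system [set: I -> S] (fun x => x i) (@measurable _ S)).

Section family.
Context d (S : measurableType d) (I : Type).

Lemma measurable_coord (i : I) :
  measurable_fun setT (fun x : famT S I => x i).
Proof.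
move=> _ B mB; apply: sub_sigma_algebra; exists i => //.
by exists B => //.
Qed.

Lemma measurable_fam d' (T : measurableType d') (f : T -> famT S I) :
  (forall i, measurable_fun setT (fun t => f t i)) -> measurable_fun setT f.
Proof.
move=> mf; apply: (@measurability _ _ _ _ setT f (\bigcup_(i in [set: I])
     preimage_set_system [set: I -> S] (fun x => x i) (@measurable _ S))) => //.
move=> _ [_ [i _ [B mB <-]] <-].
rewrite setTI; have := mf i measurableT B mB.
by congr (measurable _); rewrite !setTI.
Qed.

Definition depends_on T (J : set I) (f : (I -> S) -> T) :=
  forall x y, (forall i, J i -> x i = y i) -> f x = f y.

End family.

(** A copy of the sequence space, to be equipped with the algebra of
    cylinders. *)
Definition cylT d (S : measurableType d) := nat -> S.
HB.instance Definition _ d (S : measurableType d) := Pointed.on (cylT S).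

Section cylinder_algebra.
Context d (S : measurableType d).

Definition cylinder (C : set (nat -> S)) :=
  measurable (C : set (famT S nat)) /\
  exists n, depends_on `I_n C.

Let cyl0 : cylinder set0.
Proof. by split; [exact: measurable0|exists 0%N]. Qed.

Let cylU : setU_closed cylinder.
Proof.
move=> A B [mA [n nA]] [mB [m mmB]]; split; first exact: measurableU.
exists (maxn n m) => x y xy; rewrite /setU/=.
have -> : A x = A y by apply: nA => i /= im; apply: xy; rewrite /= leq_max im.
by have -> : B x = B y by apply: mmB => i /= im; apply: xy; rewrite /= leq_max im orbT.
Qed.

Let cylC : setC_closed cylinder.
Proof.
move=> A [mA [n nA]]; split; first exact: measurableC.
by exists n => x y /nA; rewrite /setC/= => ->.
Qed.

Fact cyl_display : measure_display. Proof. exact. Qed.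
HB.instance Definition _ := @isAlgebraOfSets.Build cyl_display (cylT S)
  cylinder cyl0 cylU cylC.

End cylinder_algebra.

Section kakutani.
Local Open Scope ereal_scope.
Context d (S : measurableType d) (R : realType) (p : nat -> probability S R).
Notation X := (famT S nat).

Definition upd (x : X) (k : nat) (s : S) : X :=
  fun i => if i == k then s else x i.

Lemma measurable_upd k : measurable_fun setT (fun z : X * S => upd z.1 k z.2).
Proof.
apply: measurable_fam => i; rewrite /upd; case: (i == k).
  exact: measurable_snd.
by apply: (measurableT_comp (measurable_coord i)); exact: measurable_fst.
Qed.

Definition int_coord k (f : X -> \bar R) (x : X) := \int[p k]_s f (upd x k s).

Fixpoint int_coords k n (f : X -> \bar R) : X -> \bar R :=
  if n is n'.+1 then int_coord k (int_coords k.+1 n' f) else f.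

Definition nnm (f : X -> \bar R) := measurable_fun [set: X] f /\ forall x, 0 <= f x.

Lemma nnm_upd k f : nnm f ->
  measurable_fun setT (fun z : X * S => f (upd z.1 k z.2)).
Proof. by move=> [mf _]; apply: (measurableT_comp mf (@measurable_upd k)). Qed.

Lemma nnm_updS k f x : nnm f -> measurable_fun setT (fun s => f (upd x k s)).
Proof.
move=> nf.
exact: (@measurableT_comp _ _ _ _ _ _ _ _ _ (nnm_upd k nf) (pair1_measurable x)).
Qed.

Lemma nnm_int_coord k f : nnm f -> nnm (int_coord k f).
Proof.
move=> nf; split; last by move=> x; apply: integral_ge0 => s _; exact: nf.2.
apply: (@measurable_fun_fubini_tonelli_F _ _ X S R (p k)
  (fun z => f (upd z.1 k z.2))).
  exact: nnm_upd.
by move=> x; exact: nf.2.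
Qed.

Lemma nnm_int_coords n k f : nnm f -> nnm (int_coords k n f).
Proof.
by elim: n k => [|n IH] k nf //=; apply: nnm_int_coord; exact: IH.
Qed.

Lemma int_coordsD n k f g : nnm f -> nnm g ->
  int_coords k n (fun x => f x + g x) =
  fun x => int_coords k n f x + int_coords k n g x.
Proof.
move=> nf ng; elim: n k => [//|n IH] k /=; rewrite IH; apply/funext => x.
have nf' := nnm_int_coords n k.+1 nf; have ng' := nnm_int_coords n k.+1 ng.
rewrite /int_coord ge0_integralD//; try (exact: nnm_updS).
- by move=> s _; exact: nf'.2.
- by move=> s _; exact: ng'.2.
Qed.

Lemma le_int_coords n k f g : nnm f -> nnm g -> (forall x, f x <= g x) ->
  forall x, int_coords k n f x <= int_coords k n g x.
Proof.
move=> nf ng fg; elim: n k => [//|n IH] k x /=.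
have nf' := nnm_int_coords n k.+1 nf; have ng' := nnm_int_coords n k.+1 ng.
apply: ge0_le_integral => //.
- by move=> s _; exact: nf'.2.
- exact: nnm_updS.
- exact: nnm_updS.
Qed.

Lemma int_coords_dep n k m f : nnm f -> depends_on `I_n f -> (n <= k)%N ->
  int_coords k m f = f.
Proof.
move=> nf df; elim: m k => [//|m IH] k nk /=; rewrite IH ?(leq_trans nk)//.
apply/funext => x; rewrite /int_coord (eq_integral (cst (f x))).
  by rewrite integral_cst//= probability_setT mule1.
move=> s _; apply: df => i /= ink; rewrite /upd ifF//.
by apply/negbTE; rewrite neq_ltn (leq_trans ink).
Qed.

Lemma int_coordsZ n k (g : X -> R) f : nnm f -> (forall x, 0 <= g x)%R ->
  depends_on `I_k g ->
  int_coords k n (fun x => (g x)%:E * f x) =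
  fun x => (g x)%:E * int_coords k n f x.
Proof.
move=> nf g0; elim: n k => [//|n IH] k dg /=.
rewrite IH; last by move=> x y xy; apply: dg => i ik; apply: xy; exact: ltnW.
apply/funext => x; have nf' := nnm_int_coords n k.+1 nf.
rewrite /int_coord -ge0_integralZl_EFin//; last 2 first.
- by move=> s _; exact: nf'.2.
- exact: nnm_updS.
apply: eq_integral => s _; congr ((_)%:E * _); apply: dg => i /= ik.
by rewrite /upd ltn_eqF.
Qed.

Lemma int_coordsS m k f : int_coords k m.+1 f =
  int_coords k m (int_coord (k + m)%N f).
Proof.
elim: m k => [|m IH] k /=; first by rewrite addn0.
by rewrite -[int_coord k.+1 _]/(int_coords k.+1 m.+1 f) IH addSnnS.
Qed.

Lemma int_coords_stable n k m f : nnm f -> depends_on `I_n f ->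
  (n <= k + m)%N -> int_coords k m f = int_coords k (n - k) f.
Proof.
move=> nf df nkm.
have [e|] := leqP n k.
  rewrite (int_coords_dep _ nf df)//.
  by move: e; rewrite -subn_eq0 => /eqP ->.
move=> kn; have -> : m = ((n - k) + (m - (n - k)))%N by lia.
elim: (m - _)%N => [|j IH]; first by rewrite addn0.
rewrite addnS int_coordsS -IH; congr int_coords.
have := @int_coords_dep n (k + (n - k + j)) 1 f nf df; apply; lia.
Qed.

End kakutani.

Section kakutani_measure.
Local Open Scope ereal_scope.
Context d (S : measurableType d) (R : realType) (p : nat -> probability S R).
Notation X := (famT S nat).

Definition cyl_ind (C : set X) : X -> \bar R := fun x => (\1_C x)%:E.

Lemma nnm_cyl_ind (C : set X) : measurable C -> nnm (cyl_ind C).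
Proof.
move=> mC; split => [|x]; last by rewrite lee_fin.
by apply/measurable_EFinP; exact: measurable_indic.
Qed.

Lemma depends_cyl_ind n (C : set X) :
  depends_on `I_n (C : X -> Prop) -> depends_on `I_n (cyl_ind C).
Proof.
move=> dC x y /dC e; rewrite /cyl_ind !indicE; congr (nat_of_bool _)%:R%:E.
by apply/idP/idP; rewrite !inE e.
Qed.

(** The conditional probability of the cylinder [C] given that the first [k]
    coordinates are those of [x]. The sequence is stationary, because [C]
    depends on finitely many coordinates. *)
Definition cyl_mass k (C : set X) (x : X) : \bar R :=
  limn (fun n => int_coords p k n (cyl_ind C) x).

Lemma cyl_massE k m n (C : set X) : measurable C ->
  depends_on `I_n (C : X -> Prop) -> (n <= k + m)%N ->
  cyl_mass k C = int_coords p k m (cyl_ind C).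
Proof.
move=> mC /depends_cyl_ind dC nkm; apply/funext => x; apply/cvg_lim => //.
apply: (@cvg_near_cst _ (\bar R)).
exists m => // j /= mj.
rewrite (int_coords_stable p (nnm_cyl_ind mC) dC); last by lia.
by rewrite [in RHS](int_coords_stable p (nnm_cyl_ind mC) dC).
Qed.

Lemma cyl_mass_step k (C : set X) : cylinder C ->
  cyl_mass k C = int_coord p k (cyl_mass k.+1 C).
Proof.
move=> [mC [n dC]]; rewrite (@cyl_massE k n.+1 n)//; last by lia.
by rewrite (@cyl_massE k.+1 n n)//; lia.
Qed.

Lemma nnm_cyl_mass k (C : set X) : cylinder C -> nnm (cyl_mass k C).
Proof.
move=> [mC [n dC]]; rewrite (@cyl_massE k n n)//; last by lia.
by apply: nnm_int_coords; exact: nnm_cyl_ind.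
Qed.

Lemma cyl_mass_end k n (C : set X) : measurable C ->
  depends_on `I_n (C : X -> Prop) -> (n <= k)%N -> cyl_mass k C = cyl_ind C.
Proof. by move=> mC dC nk; rewrite (@cyl_massE k 0 n)// addn0. Qed.

Lemma cyl_massU k (A B : set X) : cylinder A -> cylinder B ->
  A `&` B = set0 ->
  cyl_mass k (A `|` B) = fun x => cyl_mass k A x + cyl_mass k B x.
Proof.
move=> [mA [n dA]] [mB [m dB]] AB0.
have [mAB [l dAB]] : cylinder (A `|` B).
  apply: (@measurableU _ (cylT S)); split => //; [by exists n|by exists m].
pose N := (n + m + l)%N.
rewrite (@cyl_massE k N l)//; last by rewrite /N; lia.
rewrite (@cyl_massE k N n)//; last by rewrite /N; lia.
rewrite (@cyl_massE k N m)//; last by rewrite /N; lia.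
rewrite -int_coordsD; [|exact: nnm_cyl_ind..].
congr int_coords; apply/funext => x.
rewrite /cyl_ind -EFinD !indicE in_setU; congr (_%:E) => /=.
have : ~ (A x /\ B x) by move=> ABx; suff : (set0 : set X) x by []; rewrite -AB0.
case: (boolP (x \in A)); rewrite ?inE => Ax; case: (boolP (x \in B));
  rewrite ?inE => Bx; rewrite ?addr0 ?add0r// => /(_ (conj _ _)).
by case.
Qed.

Lemma le_cyl_mass k (A B : set X) : cylinder A -> cylinder B -> A `<=` B ->
  forall x, cyl_mass k A x <= cyl_mass k B x.
Proof.
move=> [mA [n dA]] [mB [m dB]] AB x.
rewrite (@cyl_massE k (n + m) n)//; last by lia.
rewrite (@cyl_massE k (n + m) m)//; last by lia.
apply: le_int_coords; [exact: nnm_cyl_ind..|move=> y].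
rewrite /cyl_ind lee_fin !indicE ler_nat.
by have := AB y; case: (boolP (y \in A)) => //; rewrite inE => yA /(_ yA) /mem_set ->.
Qed.

Lemma cyl_massT k x : cyl_mass k setT x = 1.
Proof. by rewrite (@cyl_mass_end k 0%N)// /cyl_ind indicE in_setT. Qed.

Lemma cylinderT : cylinder (setT : set X).
Proof. exact: (@measurableT _ (cylT S)). Qed.

Lemma cyl_mass0 k x : cyl_mass k set0 x = 0.
Proof.
by rewrite (@cyl_mass_end k 0%N)// /cyl_ind indicE in_set0.
Qed.

(** One step of Kakutani's argument: if all conditional masses of a decreasing
    sequence of cylinders exceed [e] given the first [k] coordinates, then for
    [e' < e] some value of the next coordinate keeps them all above [e']. *)
Lemma cyl_mass_extend k (C : nat -> set X) (x : X) (e e' : R) :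
  (forall j, cylinder (C j)) -> {homo C : i j / (i <= j)%N >-> j `<=` i} ->
  (0 <= e')%R -> (e' < e)%R ->
  (forall j, e%:E <= cyl_mass k (C j) x) ->
  exists s, forall j, e'%:E <= cyl_mass k.+1 (C j) (upd x k s).
Proof.
move=> cC dC e'0 e'e Ce.
pose g j s := cyl_mass k.+1 (C j) (upd x k s).
have mg j : measurable_fun setT (g j).
  by apply: nnm_updS; exact: nnm_cyl_mass.
pose B j := [set s | e'%:E <= g j s].
have mB j : measurable (B j).
  rewrite -[B j]setTI; exact: emeasurable_fun_c_infty.
have dB : {homo B : n m / (n <= m)%N >-> (m <= n)%O}.
  move=> i j ij; apply/subsetPset => s /= /le_trans; apply.
  by apply: le_cyl_mass => //; exact: dC.
have pB j : (e - e')%:E <= p k (B j).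
  have := Ce j; rewrite cyl_mass_step// /int_coord -/(g j) => eg.
  have : \int[p k]_s g j s <= p k (B j) + e'%:E.
    have -> : p k (B j) + e'%:E = \int[p k]_s ((\1_(B j) s)%:E + cst e'%:E s).
      rewrite ge0_integralD//; last exact/measurable_EFinP.
      by rewrite integral_indic// setIT integral_cst//= probability_setT mule1.
    apply: ge0_le_integral => //.
    - by move=> s _; exact: (nnm_cyl_mass k.+1 (cC j)).2.
    - apply: emeasurable_funD => //; exact/measurable_EFinP.
    - move=> s _; rewrite indicE; case: (boolP (s \in B j)) => [sB|].
        apply: (@le_trans _ _ 1); last by rewrite /= leeDl// lee_fin.
        by rewrite -(cyl_massT k.+1 (upd x k s)); apply: le_cyl_mass => //; exact: cylinderT.
      by rewrite add0e notin_setE /B /= => /negP; rewrite -ltNge => /ltW.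
  by move=> h; rewrite EFinB leeBlDr//; exact: le_trans eg h.
have : p k (\bigcap_j B j) != 0.
  have := @nonincreasing_cvg_mu _ _ _ (p k) B; rewrite -ge0_fin_numE//.
  move=> /(_ _ mB _ dB) cv.
  have {cv} cv : p k \o B @ \oo --> p k (\bigcap_j B j).
    apply: cv; last exact: bigcapT_measurable.
    by rewrite fin_num_measure.
  apply/negP => /eqP p0; rewrite p0 in cv.
  have : (e - e')%:E <= limn (p k \o B).
    apply: lime_ge; first by apply/cvg_ex; exists 0.
    exact: nearW.
  by rewrite (cvg_lim _ cv)// lee_fin subr_le0 leNgt e'e.
move=> pn0; have /set0P[s Bs] : \bigcap_j B j != set0.
  by apply: contraNneq pn0 => ->; rewrite measure0.
by exists s => j; exact: (Bs j).
Qed.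

(** Choosing the coordinates one after the other by [cyl_mass_extend] produces
    a point of the intersection: each [C j] depends on finitely many
    coordinates, so its indicator at that point is one of the masses kept
    positive. This is the continuity at the empty set from which the
    sigma-additivity of the product follows. *)
Lemma cyl_mass_inter (C : nat -> set X) (x : X) (e : R) :
  (forall j, cylinder (C j)) -> {homo C : i j / (i <= j)%N >-> j `<=` i} ->
  (0 < e)%R ->
  (forall j, e%:E <= cyl_mass 0 (C j) x) -> \bigcap_j C j !=set0.
Proof.
move=> cC dC e0 Ce.
(* Decreasing lower bounds, from [e] down to [e / 2]. *)
pose E k : R := (e / 2 + e / 2 ^+ k.+1)%R.
have E0 k : (0 <= E k)%R.
  by rewrite /E addr_ge0// divr_ge0// ?exprn_ge0// ltW.
have EE k : (E k.+1 < E k)%R.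
  rewrite /E ltrD2l ltr_pM2l// ltf_pV2 ?posrE ?exprn_gt0//.
  by rewrite ltr_eXn2l// ltr1n.
pose T := {kx : nat * X | forall j, (E kx.1)%:E <= cyl_mass kx.1 (C j) kx.2}.
have nxt (t : T) : {s | forall j,
    (E (sval t).1.+1)%:E <= cyl_mass (sval t).1.+1 (C j) (upd (sval t).2 (sval t).1 s)}.
  apply: cid; case: t => -[k y] /= H.
  exact: (cyl_mass_extend cC dC (E0 k.+1) (EE k) H).
pose step (t : T) : T := exist _ ((sval t).1.+1, upd (sval t).2 (sval t).1 (sval (nxt t))) (svalP (nxt t)).
have H0 j : (E 0%N)%:E <= cyl_mass 0 (C j) x.
  by have -> : E 0%N = e by rewrite /E expr1; lra.
pose t0 : T := exist _ (0%N, x) H0.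
pose t n := iter n step t0.
have t1 n : (sval (t n)).1 = n by elim: n => //= n ->.
pose y : X := fun i => (sval (t i.+1)).2 i.
have ty n i : (i < n)%N -> (sval (t n)).2 i = y i.
  elim: n => // n IH; rewrite ltnS leq_eqVlt => /orP[/eqP -> //|i_n].
  by rewrite -(IH i_n) /= /upd ifF//; apply/negbTE; rewrite t1 ltn_eqF.
exists y => j _.
have [mC [n dCn]] := cC j.
have := svalP (t n) j; rewrite t1 (cyl_mass_end _ dCn)// /cyl_ind indicE.
have -> : ((sval (t n)).2 \in C j) = (y \in C j).
  apply/idP/idP; rewrite !inE; rewrite (dCn (sval (t n)).2 y)// => i /= i_n; exact: ty.
case: (boolP (y \in C j)); rewrite ?inE// lee_fin => _.
rewrite leNgt ltr_pwDl// ?divr_gt0// divr_ge0// ?exprn_ge0//; exact: ltW.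
Qed.

End kakutani_measure.

Section sequence_product.
Local Open Scope ereal_scope.
Context d (S : measurableType d) (R : realType) (p : nat -> probability S R).
Notation X := (famT S nat).

(** The masses given no coordinate at all; [point] is an arbitrary sequence. *)
Definition cyl_prob (C : set (cylT S)) : \bar R :=
  if pselect (cylinder C) then cyl_mass p 0 C point else 0.

Lemma cyl_probE (C : set (cylT S)) : measurable C ->
  cyl_prob C = cyl_mass p 0 C point.
Proof. by rewrite /cyl_prob; case: pselect. Qed.

Let cyl_prob_ge0 C : 0 <= cyl_prob C.
Proof. by rewrite /cyl_prob; case: pselect => // cC; exact: (nnm_cyl_mass p 0 cC).2. Qed.

Let cyl_prob0 : cyl_prob set0 = 0.
Proof. by rewrite cyl_probE ?cyl_mass0//; exact: measurable0. Qed.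

Let cyl_probU (A B : set (cylT S)) : measurable A -> measurable B ->
  A `&` B = set0 -> cyl_prob (A `|` B) = cyl_prob A + cyl_prob B.
Proof.
move=> mA mB AB; rewrite !cyl_probE//; last exact: measurableU.
by rewrite cyl_massU.
Qed.

Let cyl_prob_le1 C : cyl_prob C <= 1.
Proof.
rewrite /cyl_prob; case: pselect => [cC|nC]; last exact: lee01.
rewrite -(cyl_massT p 0 point).
by apply: le_cyl_mass => //; exact: cylinderT.
Qed.

Let cyl_prob_fin C : cyl_prob C \is a fin_num.
Proof. by rewrite ge0_fin_numE// (le_lt_trans (cyl_prob_le1 C))// ltry. Qed.

Let cyl_prob_sigma : semi_sigma_additive cyl_prob.
Proof.
move=> F mF tF mUF.
set A := \bigcup_n F n in mUF *.
pose U n : set (cylT S) := \big[setU/set0]_(i < n) F i.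
have mU n : measurable (U n) by apply: bigsetU_measurable.
have US n : U n.+1 = U n `|` F n by rewrite /U big_ord_recr.
have sumU n : \sum_(0 <= i < n) cyl_prob (F i) = cyl_prob (U n).
  elim: n => [|n IH]; first by rewrite big_geq// /U big_ord0 cyl_prob0.
  rewrite big_nat_recr//= IH US cyl_probU//.
  rewrite -subset0 => x [+ Fx]; rewrite /U -bigcup_mkord => -[i /= i_n Fix].
  by have := tF i n I I (ex_intro _ x (conj Fix Fx)); move: i_n => /[swap] ->; rewrite ltnn.
pose C n := A `\` U n.
have mC n : measurable (C n) by exact: measurableD.
have UA n : U n `<=` A.
  by rewrite /U -bigcup_mkord => x [i _ Fx]; exists i.
have CU n : cyl_prob A = cyl_prob (U n) + cyl_prob (C n).
  rewrite -cyl_probU//; first by rewrite /C setDUK.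
  by rewrite /C setDIK.
have dC : {homo C : i j / (i <= j)%N >-> j `<=` i}.
  move=> i j ij x [Ax nUx]; split => //; apply: contra_not nUx.
  rewrite /U -!bigcup_mkord => -[k /= ki Fx]; exists k => //=; exact: leq_trans ij.
have C0 : \bigcap_j C j = set0.
  rewrite -subset0 => x Cx; have [Ax _] := Cx 0%N I; have [n _ Fx] := Ax.
  have [_ ] := Cx n.+1 I; apply; rewrite US; by right.
rewrite (_ : (fun n => _) = cyl_prob \o U); last by apply/funext => n; rewrite /= sumU.
have C_to0 : cyl_prob \o C @ \oo --> 0.
  apply/fine_cvgP; split; first by apply: nearW => n; exact: cyl_prob_fin.
  apply/cvgrPdist_lt => e e0; near=> n.
  rewrite sub0r normrN /= ger0_norm ?fine_ge0// -lte_fin fineK//.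
  near: n; apply: contrapT => H.
  have {}H n : e%:E <= cyl_prob (C n).
    rewrite leNgt; apply/negP => Cn; apply: H; exists n => // m /= nm.
    apply: le_lt_trans Cn; rewrite !cyl_probE//; by apply: le_cyl_mass; [exact: mC|exact: mC|exact: dC].
  have [x] : \bigcap_j C j !=set0; last by rewrite C0.
  apply: (cyl_mass_inter (p := p) (x := point) (e := e)) => // j.
  by rewrite -cyl_probE.
rewrite (_ : _ \o U = fun n => cyl_prob A - (cyl_prob \o C) n); last first.
  by apply/funext => n; rewrite /= (CU n) addeK.
rewrite -[X in _ --> X]sube0; apply: cvgeB => //; last exact: cvg_cst.
exact: fin_num_adde_defr.
Unshelve. all: by end_near. Qed.

HB.instance Definition _ := isMeasure.Build _ _ _ cyl_prob
  cyl_prob0 cyl_prob_ge0 cyl_prob_sigma.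

Let cylinder_coord i (B : set S) : measurable B ->
  cylinder [set x : nat -> S | B (x i)].
Proof.
move=> mB; split; last by exists i.+1 => x y /= ->.
by have := @measurable_coord _ S nat i measurableT B mB; rewrite setTI.
Qed.

Let fam_meas : @measurable _ X =
  @measurable _ (g_sigma_algebraType (@measurable _ (cylT S))).
Proof.
apply/seteqP; split.
  apply: sub_sigma_algebra2 => _ [i _ [B mB <-]]; rewrite setTI.
  exact: cylinder_coord.
by apply: smallest_sub; [exact: sigma_algebra_measurable|move=> C []].
Qed.

Definition seq_prod (B : set X) : \bar R := measure_extension cyl_prob B.

Let seq_prod0 : seq_prod set0 = 0.
Proof. exact: measure0. Qed.

Let seq_prod_ge0 B : 0 <= seq_prod B.
Proof. exact: measure_ge0. Qed.

Let seq_prod_sigma : semi_sigma_additive seq_prod.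
Proof.
move=> F mF tF mUF.
apply: (@measure_semi_sigma_additive _ _ _ (measure_extension cyl_prob)) => //.
  by move=> i; have := mF i; rewrite fam_meas.
by move: mUF; rewrite fam_meas.
Qed.

HB.instance Definition _ := isMeasure.Build _ X R seq_prod
  seq_prod0 seq_prod_ge0 seq_prod_sigma.

Lemma seq_prod_cylinder C : cylinder C -> seq_prod C = cyl_mass p 0 C point.
Proof.
move=> cC; rewrite /seq_prod /measure_extension measurable_mu_extE//.
exact: cyl_probE.
Qed.

Let seq_prodT : seq_prod setT = 1.
Proof. by rewrite seq_prod_cylinder ?cyl_massT//; exact: cylinderT. Qed.

HB.instance Definition _ := Measure_isProbability.Build _ X R seq_prod seq_prodT.

Lemma seq_prod_box n (E : nat -> set S) : (forall i, measurable (E i)) ->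
  seq_prod [set x | forall i, (i < n)%N -> E i (x i)] =
  \prod_(i < n) p i (E i).
Proof.
move=> mE.
pose B k n : set X := [set x | forall i, (k <= i < k + n)%N -> E i (x i)].
have cB k m : measurable (B k m) /\ depends_on `I_(k + m) (B k m : X -> Prop).
  split; last first.
    move=> x y xy; apply/propext; split => H i /andP[ki im]; have := H i;
    by rewrite ki im (xy i) ?im//; apply.
  have -> : B k m = \bigcap_i [set x | (k <= i < k + m)%N -> E i (x i)].
    by apply/seteqP; split => [x H i _|x H i]; [exact: H|exact: H].
  apply: bigcapT_measurable => i; case: (boolP (k <= i < k + m)%N) => _.
    rewrite (_ : mkset _ = [set x | E i (x i)]).
      by have := @measurable_coord _ S nat i measurableT (E i) (mE i); rewrite setTI.
    by apply/seteqP; split => x //=; apply.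
  rewrite (_ : mkset _ = setT)//.
  by apply/seteqP; split.
have H k m x : int_coords p k m (cyl_ind R (B k m)) x = \prod_(i < m) p (k + i)%N (E (k + i)%N).
  elim: m k x => [|m IH] k x /=.
    by rewrite big_ord0 /cyl_ind indicE mem_set// => i; lia.
  rewrite big_ord_recl/= addn0.
  under eq_bigr do rewrite /bump/= add1n addnS -addSn.
  have -> : cyl_ind R (B k m.+1) =
      fun y => (\1_(E k) (y k))%:E * cyl_ind R (B k.+1 m) y.
    apply/funext => y; rewrite /cyl_ind -EFinM !indicE -natrM mulnb.
    congr (nat_of_bool _)%:R%:E; apply/idP/andP; rewrite !inE.
      by move=> H; split; [apply: H; lia|move=> i ki; apply: H; lia].
    move=> [Ek H] i /andP[ki im]; move: ki; rewrite leq_eqVlt => /orP[/eqP <-//|ki].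
    by apply: H; lia.
  have nB : nnm (cyl_ind R (B k.+1 m)) by apply: nnm_cyl_ind; exact: (cB _ _).1.
  rewrite int_coordsZ//; last by move=> y z yz; rewrite yz/=.
  rewrite /int_coord.
  under eq_integral do rewrite IH /upd eqxx muleC.
  have q0 : 0 <= \prod_(i < m) p (k.+1 + i)%N (E (k.+1 + i)%N) by exact: prode_ge0.
  rewrite ge0_integralZl//.
  - by rewrite integral_indic// setIT muleC.
  - exact/measurable_EFinP.
have [mB dB] := cB 0%N n; rewrite add0n in dB.
rewrite (_ : mkset _ = B 0%N n); last first.
  by apply/seteqP; split => x h i; [move=> /andP[_]|move=> ?]; apply: h.
rewrite seq_prod_cylinder; last by split => //; exists n.
by rewrite (@cyl_massE _ _ _ _ 0%N n n).
Qed.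

End sequence_product.

(** * Laws and products over countable index sets *)

Section laws.
Context (R : realType).

Definition mkmfun d1 d2 (T1 : measurableType d1) (T2 : measurableType d2)
    (f : T1 -> T2) (mf : measurable_fun setT f) : {mfun T1 >-> T2} :=
  HB.pack f (isMeasurableFun.Build _ _ _ _ f mf).

Definition law d1 d2 (T1 : measurableType d1) (T2 : measurableType d2)
    (P : probability T1 R) (f : T1 -> T2) (mf : measurable_fun setT f) :
    probability T2 R :=
  distribution P (mkmfun mf).

Lemma has_law_law d1 d2 (T1 : measurableType d1) (T2 : measurableType d2)
    (P : probability T1 R) (f : T1 -> T2) (mf : measurable_fun setT f) :
  has_law P f (law P mf).
Proof. by []. Qed.

Lemma has_law_comp d1 d2 d3 (T1 : measurableType d1) (T2 : measurableType d2)
    (T3 : measurableType d3) (P : probability T1 R) (Q : probability T2 R)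
    (mu : set T3 -> \bar R) (f : T1 -> T2) (g : T2 -> T3) :
  measurable_fun setT g -> has_law P f Q -> has_law Q g mu ->
  has_law P (g \o f) mu.
Proof.
move=> mg Pf Qg B mB; rewrite comp_preimage Pf ?Qg//.
by rewrite -[X in measurable X]setTI; exact: mg.
Qed.

Section transfer.
Context d1 d2 (T1 : measurableType d1) (T2 : measurableType d2)
  (P : probability T1 R) (Q : probability T2 R) (f : T1 -> T2).
Hypotheses (mf : measurable_fun setT f) (Pf : has_law P f Q).

Lemma has_law_ge0_integral (g : T2 -> \bar R) :
  measurable_fun setT g -> (forall x, (0 <= g x)%E) ->
  (\int[Q]_x g x = \int[P]_x g (f x))%E.
Proof.
move=> mg g0; rewrite -(@ge0_integral_distribution _ _ _ _ _ P (mkmfun mf) g)//.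
by apply: eq_measure_integral => A mA _; exact: esym (Pf mA).
Qed.

Lemma has_law_integral (g : T2 -> \bar R) :
  measurable_fun setT g ->
  (\int[Q]_x g x = \int[P]_x g (f x))%E.
Proof.
move=> mg; rewrite integralE [RHS]integralE.
have H1 := has_law_ge0_integral (measurable_funepos mg) (funepos_ge0 g).
have H2 := has_law_ge0_integral (measurable_funeneg mg) (funeneg_ge0 g).
have -> : (fun x => g (f x)) = g \o f by [].
rewrite (funepos_comp g f) (funeneg_comp g f).
by rewrite H1 H2.
Qed.

Lemma has_law_integrable (g : T2 -> \bar R) :
  measurable_fun setT g ->
  Q.-integrable setT g <-> P.-integrable setT (g \o f).
Proof.
move=> mg; have mgf : measurable_fun setT (g \o f) by exact: measurableT_comp.
have e : (\int[Q]_x `|g x| = \int[P]_x `|(g \o f) x|)%E.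
  by rewrite has_law_ge0_integral//; exact: measurableT_comp.
by split=> /integrableP[_ H]; apply/integrableP; split => //; rewrite ?e// -?e.
Qed.

Lemma has_law_ae (A : T2 -> Prop) :
  {ae Q, forall y, A y} -> {ae P, forall x, A (f x)}.
Proof.
move=> [N [mN QN AN]]; exists (f @^-1` N); split.
- by rewrite -[X in measurable X]setTI; exact: mf.
- by rewrite Pf.
- by move=> x; exact: AN.
Qed.

End transfer.
End laws.

Section families.
Context d (S : measurableType d) (R : realType).

Definition box (I : eqType) (J : seq I) (E : I -> set S) : set (famT S I) :=
  [set x | forall i, i \in J -> E i (x i)].

Lemma measurable_box (I : eqType) J (E : I -> set S) :
  (forall i, measurable (E i)) -> measurable (box J E).
Proof.
move=> mE; elim: J => [|j J IH].
  by rewrite (_ : box _ _ = setT); [exact: measurableT|apply/seteqP; split].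
rewrite (_ : box _ _ = [set x | E j (x j)] `&` box J E).
  apply: measurableI => //.
  by have := @measurable_coord _ S I j measurableT (E j) (mE j); rewrite setTI.
apply/seteqP; split => [x H|x [H1 H2] i]; last by rewrite inE => /orP[/eqP ->|/H2].
by split=> [|i iJ]; apply: H; rewrite inE ?eqxx// iJ orbT.
Qed.

(** Boxes form a generating pi-system. *)
Lemma family_law_unique (I : choiceType) (m1 m2 : probability (famT S I) R) :
  (forall J E, uniq J -> (forall i, measurable (E i)) ->
     m1 (box J E) = m2 (box J E)) ->
  forall B, measurable B -> m1 B = m2 B.
Proof.
move=> m12 B mB.
pose G := [set C : set (famT S I) | exists (J : seq I) E,
  [/\ uniq J, forall i, measurable (E i) & C = box J E]].
apply: (@measure_unique _ _ _ G (fun=> setT)) => //.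
- apply/seteqP; split.
    apply: sub_sigma_algebra2 => _ [i _ [C mC <-]]; rewrite setTI.
    exists [:: i], (fun=> C); split => //; apply/seteqP; split => x.
      by move=> /= Cx j; rewrite inE => /eqP ->.
    by move=> /= /(_ i); rewrite inE eqxx; exact.
  apply: smallest_sub; first exact: sigma_algebra_measurable.
  by move=> _ [J [E [_ mE ->]]]; exact: measurable_box.
- move=> _ _ [J [E [uJ mE ->]]] [K [F [uK mF ->]]].
  exists (undup (J ++ K)), (fun i => (if i \in J then E i else setT) `&`
                             (if i \in K then F i else setT)); split.
  + exact: undup_uniq.
  + by move=> i; apply: measurableI; case: ifP.
  + apply/seteqP; split => [x [Ex Fx] i _|x H].
      by split; case: ifP => // ?; [exact: Ex|exact: Fx].
    split=> i iJ; have := H i; rewrite mem_undup mem_cat iJ ?orbT => /(_ isT) [] //.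
- by move=> _; exists [::], (fun=> setT); split => //; apply/seteqP; split.
- by rewrite bigcup_const//; exists 0%N.
- by move=> _ [J [E [uJ mE ->]]]; exact: m12.
- by move=> _; rewrite [X in (X < _)%E]probability_setT ltry.
Qed.

Section family_product.
Context (I : countType) (p : I -> probability S R).

(** Indices are coded by natural numbers; the numbers that code nothing get an
    arbitrary law. *)
Definition code_law (n : nat) : probability S R :=
  if unpickle n is Some i then p i else \d_(point : S).

Lemma measurable_decode :
  measurable_fun setT (fun x : famT S nat => (fun i => x (pickle i)) : famT S I).
Proof. by apply: measurable_fam => i; exact: measurable_coord. Qed.

Definition fam_prod : probability (famT S I) R :=
  law (seq_prod code_law) measurable_decode.

Lemma fam_prod_box J (E : I -> set S) : uniq J ->
  (forall i, measurable (E i)) ->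
  fam_prod (box J E) = (\prod_(i <- J) p i (E i))%E.
Proof.
move=> uJ mE.
pose pJ := [seq pickle i | i <- J].
pose n := (\sum_(m <- pJ) m.+1)%N.
have pn m : m \in pJ -> (m < n)%N.
  by move=> mJ; rewrite /n (big_rem m)//= ltn_addr.
pose F (m : nat) : set S :=
  if unpickle m is Some i then if m \in pJ then E i else setT else setT.
rewrite /fam_prod [LHS](_ : _ = seq_prod code_law
    [set x | forall m, (m < n)%N -> F m (x m)]); last first.
  congr (seq_prod _ _); apply/seteqP; split => x H.
    move=> m _; rewrite /F; case: (boolP (m \in pJ)); last by case: unpickle.
    by move=> /mapP[i iJ ->]; rewrite pickleK; exact: H.
  move=> i iJ; have ipJ : pickle i \in pJ by exact: map_f.
  by have := H (pickle i) (pn _ ipJ); rewrite /F pickleK ipJ.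
rewrite seq_prod_box; last first.
  by move=> m; rewrite /F; case: unpickle => // i; case: ifP.
rewrite -(big_mkord xpredT (fun m => code_law m (F m))) (bigID (fun m => m \in pJ))/=.
rewrite [X in (_ * X)%E]big1 ?mule1; last first.
  move=> m /negPf mpJ; rewrite /F /code_law.
  by case: unpickle => [i|]; rewrite ?mpJ /= ?probability_setT// diracE in_setT.
rewrite -big_filter (perm_big pJ); last first.
  apply: uniq_perm.
  - by rewrite filter_uniq// iota_uniq.
  - by rewrite map_inj_uniq//; exact: (can_inj pickleK).
  - move=> m; rewrite mem_filter mem_index_iota/=.
    by case: (boolP (m \in pJ)) => // /pn ->.
rewrite big_map big_seq [RHS]big_seq; apply: eq_bigr => i iJ.
by rewrite /code_law /F pickleK map_f.
Qed.

Lemma fam_prod_unique (m : probability (famT S I) R) :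
  (forall J E, uniq J -> (forall i, measurable (E i)) ->
     m (box J E) = (\prod_(i <- J) p i (E i))%E) ->
  forall B, measurable B -> m B = fam_prod B.
Proof.
move=> mp; apply: family_law_unique => J E uJ mE.
by rewrite mp// fam_prod_box.
Qed.

Lemma fam_prod_coord i : has_law fam_prod (fun x => x i) (p i).
Proof.
move=> B mB; have := @fam_prod_box [:: i] (fun=> B) isT (fun=> mB).
rewrite big_seq1 => <-; congr (fam_prod _); apply/seteqP; split => x /=.
  by move=> ? j; rewrite inE => /eqP ->.
by move=> /(_ i); rewrite inE eqxx; exact.
Qed.

(** The universal property through which any realization of independent
    variables is carried to the canonical one. *)
Lemma has_law_fam_prod d' (Omega : measurableType d') (P : probability Omega R)
    (X : Omega -> famT S I) (F : I -> set_system Omega) :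
  (forall i, has_law P (fun w => X w i) (p i)) ->
  (forall i, measurable_fun setT (fun w => X w i)) ->
  (forall i (B : set S), measurable B -> F i ((fun w => X w i) @^-1` B)) ->
  mutually_independent P setT F ->
  has_law P X fam_prod.
Proof.
move=> Xp mX XF indF.
have mX' : measurable_fun setT X by exact: measurable_fam.
move=> B mB; rewrite -[LHS]/(law P mX' B); apply: fam_prod_unique => // J E uJ mE.
have := indF [fset i in J]%fset (fun i => (fun w => X w i) @^-1` (E i)).
rewrite (perm_big J); last first.
  by apply: uniq_perm => //; [exact: fset_uniq|move=> i; rewrite /= !inE].
rewrite (eq_bigr (fun i => p i (E i))); last by move=> i _; exact: Xp.
move=> <-//; last by move=> i _; exact: XF.
  have -> : law P mX' (box J E) = P (X @^-1` box J E) by [].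
  congr (P _); apply/seteqP; split => w H i iJ; apply: H => //=.
  - by move: iJ; rewrite /= !inE.
  - by rewrite !inE.
Qed.

End family_product.
End families.

(** * Independence of disjoint blocks of coordinates *)

Section blocks.
Context d (S : measurableType d) (R : realType).

Section reindex.
Context (I I' : countType) (p : I -> probability S R) (p' : I' -> probability S R).

(** The inverse image of a box by a reindexing is a box, whose side at [i'] is
    the intersection, over the at most one [i] sent to [i'], of the [E i]. *)
Lemma fam_prod_reindex (tau : I -> I') : injective tau ->
  (forall i, p i = p' (tau i)) ->
  has_law (fam_prod p') (fun x => (x \o tau : famT S I)) (fam_prod p).
Proof.
move=> tau_inj pp'.
have mt : measurable_fun setT (fun x : famT S I' => (x \o tau : famT S I)).
  by apply: measurable_fam => i; exact: measurable_coord.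
move=> B mB; rewrite -[LHS]/(law (fam_prod p') mt B).
apply: fam_prod_unique => // J E uJ mE.
pose E' i' := [set s | forall i, tau i = i' -> E i s].
have E'E i : E' (tau i) = E i.
  by apply/seteqP; split => s; [exact|move=> Es j /tau_inj ->].
have mE' i' : measurable (E' i').
  have [[i <-]|ni] := pselect (exists i, tau i = i'); first by rewrite E'E.
  rewrite (_ : E' i' = setT)//; apply/seteqP; split => // s _ i ii'.
  by exfalso; apply: ni; exists i.
rewrite [LHS](_ : _ = fam_prod p' (box (map tau J) E')); last first.
  congr (fam_prod p' _); apply/seteqP; split => x H.
    by move=> _ /mapP[i iJ ->]; rewrite E'E; exact: H.
  by move=> i iJ; rewrite /= -E'E; apply: H; exact: map_f.
rewrite fam_prod_box ?map_inj_uniq// big_map.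
by apply: eq_bigr => i _; rewrite E'E pp'.
Qed.

End reindex.

Context (I : countType) (p : I -> probability S R).
Notation X := (famT S I).
Notation Pi := (fam_prod p).

Definition merge (J : set I) (z : X * X) : X :=
  fun i => if i \in J then z.1 i else z.2 i.

Lemma measurable_merge J : measurable_fun setT (merge J).
Proof.
apply: measurable_fam => i; rewrite /merge; case: (i \in J).
  exact: (measurableT_comp (measurable_coord i) measurable_fst).
exact: (measurableT_comp (measurable_coord i) measurable_snd).
Qed.

Let Pi2 := (Pi \x Pi)%E.

(** The coordinates outside [J] can be replaced by independent copies. *)
Lemma fam_prod_merge J B : measurable B -> Pi2 (merge J @^-1` B) = Pi B.
Proof.
move=> mB; rewrite -[LHS]/(law (Pi \x Pi)%E (measurable_merge J) B).
apply: fam_prod_unique => // K E uK mE.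
rewrite [LHS](_ : _ = Pi2 (box [seq i <- K | i \in J] E `*`
                           box [seq i <- K | i \notin J] E)); last first.
  congr (Pi2 _); apply/seteqP; split => [x H|x [H1 H2] i iK]; rewrite /merge.
    split=> i; rewrite mem_filter => /andP[iJ iK]; have := H i iK.
      by rewrite /merge /= iJ.
    by rewrite /merge /= (negPf iJ).
  have := H1 i; have := H2 i; rewrite !mem_filter iK.
  by rewrite /= /merge; case: (i \in J) => /= [_ /(_ isT)|/(_ isT)].
transitivity (Pi (box [seq i <- K | i \in J] E) *
              Pi (box [seq i <- K | i \notin J] E))%E.
  by apply: product_measure1E; exact: measurable_box.
rewrite !fam_prod_box ?filter_uniq// !big_filter [RHS](bigID (fun i => i \in J))/=.
by [].
Qed.

(** Resampling the second group of coordinates by [merge] leaves the law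
    unchanged, and makes [f] and [g] functions of the two factors of a product
    measure. *)
Lemma fam_prod_indep d1 d2 (T1 : measurableType d1) (T2 : measurableType d2)
    (J K : set I) (f : X -> T1) (g : X -> T2) (A : set T1) (B : set T2) :
  measurable_fun setT f -> measurable_fun setT g ->
  depends_on J f -> depends_on K g -> J `&` K = set0 ->
  measurable A -> measurable B ->
  Pi (f @^-1` A `&` g @^-1` B) = (Pi (f @^-1` A) * Pi (g @^-1` B))%E.
Proof.
move=> mf mg df dg JK mA mB.
have mfA : measurable (f @^-1` A) by rewrite -[X in measurable X]setTI; exact: mf.
have mgB : measurable (g @^-1` B) by rewrite -[X in measurable X]setTI; exact: mg.
rewrite -(@fam_prod_merge J); last exact: measurableI.
rewrite -(product_measure1E Pi Pi mfA mgB); congr (Pi2 _).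
have ef z : f (merge J z) = f z.1.
  by apply: df => i Ji; rewrite /merge mem_set.
have eg z : g (merge J z) = g z.2.
  apply: dg => i Ki; rewrite /merge memNset// => Ji.
  by suff : (set0 : set I) i by []; rewrite -JK.
by apply/seteqP; split => z /=; rewrite ef eg.
Qed.

Lemma fam_prod_indep_events (K : eqType) (L : seq K) (J : K -> set I)
    (E : K -> set X) :
  uniq L -> (forall k, k \in L -> measurable (E k)) ->
  (forall k, k \in L -> depends_on (J k) (E k : X -> Prop)) ->
  (forall k l, k != l -> J k `&` J l = set0) ->
  Pi (\bigcap_(k in [set` L]) E k) = (\prod_(k <- L) Pi (E k))%E.
Proof.
move=> + + + trivJ; elim: L => [|k L IH].
  by move=> _ _ _; rewrite big_nil set_nil bigcap_set0 probability_setT.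
move=> /= /andP[kL uL] mE dE.
have mE' l : l \in L -> measurable (E l) by move=> lL; apply: mE; rewrite inE lL orbT.
rewrite big_cons -IH//; last by move=> l lL; apply: dE; rewrite inE lL orbT.
have -> : \bigcap_(l in [set` k :: L]) E l = E k `&` \bigcap_(l in [set` L]) E l.
  apply/seteqP; split => [x H|x [Hk H] l /=].
    by split=> [|l lL]; apply: H; rewrite /= inE ?eqxx// (lL : l \in L) orbT.
  by rewrite inE => /orP[/eqP ->//|lL]; exact: H.
pose J' := \bigcup_(l in [set` L]) J l.
have mI : measurable (\bigcap_(l in [set` L]) E l).
  by apply: fin_bigcap_measurable => [|l lL]; [exact: finite_seq|exact: mE'].
have mEk : measurable (E k) by apply: mE; rewrite inE eqxx.
have := @fam_prod_indep _ _ _ _ (J k) J' (fun x => asbool (E k x))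
  (fun x => asbool ((\bigcap_(l in [set` L]) E l) x)) [set true] [set true].
have e (C : set X) : (fun x => `[< C x >]) @^-1` [set true] = C.
  by apply/seteqP; split => x /=; [move/asboolP|move/asboolP].
have me (C : set X) : measurable C -> measurable_fun setT (fun x => `[< C x >]).
  by move=> mC; apply: (measurable_fun_bool true); rewrite setTI e.
rewrite !e; apply => //.
- exact: me.
- exact: me.
- by move=> x y xy; congr asbool; apply: dE xy; rewrite inE eqxx.
- move=> x y xy; congr asbool; apply/propext; split => H l lL; have := H l lL;
  rewrite (dE l _ x y)// ?inE ?(lL : l \in L) ?orbT// => i Ji; apply: xy; exists l => //.
- rewrite /J' setI_bigcupr bigcup0// => l lL; apply: trivJ.
  by apply: contraNneq kL => ->.
Qed.

Lemma fam_prod_mutually_independent (K : choiceType) (D : set K)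
    (J : K -> set I) (F : K -> set_system X) :
  (forall k E, F k E -> measurable E /\ depends_on (J k) (E : X -> Prop)) ->
  (forall k l, k != l -> J k `&` J l = set0) ->
  mutually_independent Pi D F.
Proof.
move=> FJ trivJ L E LD FE.
apply: (fam_prod_indep_events (L := L) (J := J)) => //.
- by move=> k kL; exact: (FJ _ _ (FE k kL)).1.
- by move=> k kL; exact: (FJ _ _ (FE k kL)).2.
Qed.

Lemma generated_sigma_depends d' (T : measurableType d') (J : set I)
    (f : X -> T) : measurable_fun setT f -> depends_on J f ->
  forall E, generated_sigma f E ->
    measurable E /\ depends_on J (E : X -> Prop).
Proof.
move=> mf df _ [B mB <-]; split; first exact: mf.
by move=> x y /df e; rewrite /setI/= e.
Qed.

End blocks.

Local Open Scope complex_scope.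

(** * Complex-valued random variables *)

Notation Cre := (@complex.Re _).
Notation Cim := (@complex.Im _).
Notation cabs := ComplexField.Normc.normc.

Section complex_numbers.
Context (R : realType).
Implicit Types (z : R[i]).

Lemma sqr_cabs z : cabs z ^+ 2 = Cre z ^+ 2 + Cim z ^+ 2.
Proof. by case: z => x y /=; rewrite sqr_sqrtr// addr_ge0// sqr_ge0. Qed.

Lemma cabs_ge0 z : 0 <= cabs z.
Proof. by case: z => x y /=; rewrite sqrtr_ge0. Qed.

Lemma norm_cabs z : `|z| = (cabs z)%:C.
Proof. by case: z. Qed.

Lemma cabsM z w : cabs (z * w) = cabs z * cabs w.
Proof. exact: ComplexField.Normc.normcM. Qed.

Lemma cabs_real (x : R) : cabs x%:C = `|x|.
Proof. by rewrite /= expr0n/= addr0 sqrtr_sqr. Qed.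

Lemma cabsD z w : cabs (z + w) <= cabs z + cabs w.
Proof. exact: le_normcD. Qed.

Lemma cabsN z : cabs (- z) = cabs z.
Proof. exact: normcN. Qed.

Lemma cabsJ z : cabs z^* = cabs z.
Proof. by case: z => x y /=; rewrite sqrrN. Qed.

Lemma cabs_eq0 z : (cabs z == 0) = (z == 0).
Proof.
by apply/eqP/eqP => [/ComplexField.Normc.eq0_normc//|->]; exact: ComplexField.Normc.normc0.
Qed.

Lemma normCre_le z : `|Cre z| <= cabs z.
Proof.
rewrite -ler_sqr ?nnegrE ?cabs_ge0// sqr_cabs real_normK ?num_real//.
by rewrite lerDl sqr_ge0.
Qed.

Lemma normCim_le z : `|Cim z| <= cabs z.
Proof.
rewrite -ler_sqr ?nnegrE ?cabs_ge0// sqr_cabs real_normK ?num_real//.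
by rewrite lerDr sqr_ge0.
Qed.

Lemma cabs_le z : cabs z <= `|Cre z| + `|Cim z|.
Proof.
rewrite -ler_sqr ?nnegrE ?addr_ge0// ?cabs_ge0// sqr_cabs sqrrD.
rewrite !real_normK ?num_real// -addrA [X in _ <= _ + X]addrC addrA lerDl.
by rewrite mulrn_wge0// mulr_ge0.
Qed.

Lemma CreD z w : Cre (z + w) = Cre z + Cre w. Proof. by case: z; case: w. Qed.
Lemma CimD z w : Cim (z + w) = Cim z + Cim w. Proof. by case: z; case: w. Qed.
Lemma CreN z : Cre (- z) = - Cre z. Proof. by case: z. Qed.
Lemma CimN z : Cim (- z) = - Cim z. Proof. by case: z. Qed.
Lemma CreM z w : Cre (z * w) = Cre z * Cre w - Cim z * Cim w.
Proof. by case: z; case: w. Qed.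
Lemma CimM z w : Cim (z * w) = Cre z * Cim w + Cim z * Cre w.
Proof. by case: z; case: w. Qed.
Lemma CreJ z : Cre z^* = Cre z. Proof. by case: z. Qed.
Lemma CimJ z : Cim z^* = - Cim z. Proof. by case: z. Qed.
Lemma complex_ext z w : Cre z = Cre w -> Cim z = Cim w -> z = w.
Proof. by case: z => ? ?; case: w => ? ? /= -> ->. Qed.

Lemma Cre_sum (I : Type) (r : seq I) (P : pred I) (F : I -> R[i]) :
  Cre (\sum_(i <- r | P i) F i) = \sum_(i <- r | P i) Cre (F i).
Proof. exact: (big_morph _ CreD erefl). Qed.

Lemma Cim_sum (I : Type) (r : seq I) (P : pred I) (F : I -> R[i]) :
  Cim (\sum_(i <- r | P i) F i) = \sum_(i <- r | P i) Cim (F i).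
Proof. exact: (big_morph _ CimD erefl). Qed.

Lemma cabs_sum (I : Type) (r : seq I) (P : pred I) (F : I -> R[i]) :
  cabs (\sum_(i <- r | P i) F i) <= \sum_(i <- r | P i) cabs (F i).
Proof.
elim/big_ind2 : _ => //; first by rewrite ComplexField.Normc.normc0.
by move=> x x' y y' xx' yy'; apply: le_trans (cabsD _ _) _; exact: lerD.
Qed.

Lemma cvg_complexP (T : Type) (F : set_system T) (FF : Filter F)
    (f : T -> R[i]) z :
  (f : T -> R[i]^o) @ F --> (z : R[i]^o) <->
  (Cre \o f @ F --> Cre z) /\ (Cim \o f @ F --> Cim z).
Proof.
split=> [fz|[fr fi]].
  split; apply/cvgrPdist_lt => e e0; move/cvgrPdist_lt : fz => /(_ e%:C);
  rewrite ltcR => /(_ e0); apply: filterS => t; rewrite norm_cabs ltcR;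
  apply: le_lt_trans.
    by rewrite -CreN -CreD; exact: normCre_le.
  by rewrite -CimN -CimD; exact: normCim_le.
apply/cvgrPdist_lt => -[e i]; rewrite ltcE/= => /andP[/eqP -> e0].
have e20 : 0 < e / 2 by rewrite divr_gt0.
move/cvgrPdist_lt : fr => /(_ _ e20); move/cvgrPdist_lt : fi => /(_ _ e20).
apply: filterS2 => t /= i2 r2; rewrite norm_cabs complexr0 ltcR.
apply: le_lt_trans (cabs_le _) _; rewrite CreD CimD CreN CimN.
by rewrite (splitr e) ltrD.
Qed.

Let open_halfplane (f : R[i] -> R) : (forall z w, f (z - w) = f z - f w) ->
  (forall z, `|f z| <= cabs z) -> forall a, open ([set z : R[i]^o | a < f z]).
Proof.
move=> fB fle a; rewrite openE => z /= az.
apply/nbhs_ballP; exists (f z - a)%:C => /=; first by rewrite ltcR subr_gt0.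
move=> w; rewrite /ball/= norm_cabs ltcR => H.
have : `|f (z - w)| < f z - a by exact: le_lt_trans (fle _) H.
by rewrite fB ltr_norml => /andP[_]; rewrite ltrBlDr addrAC ltrBrDr ltrD2l.
Qed.

Let measurable_borelC_real (f : R[i] -> R) :
  (forall z w, f (z - w) = f z - f w) ->
  (forall z, `|f z| <= cabs z) -> measurable_fun setT (f : borelC R -> R).
Proof.
move=> fB fle; apply: (@measurability _ _ _ _ setT _
  (@RGenOInfty.G R)); first exact: RGenOInfty.measurableE.
move=> _ [_ [a ->] <-]; rewrite setTI; apply: sub_sigma_algebra.
rewrite (_ : _ @^-1` _ = [set z : R[i]^o | a < f z]); first exact: open_halfplane.
by apply/seteqP; split => z /=; rewrite in_itv/= andbT.
Qed.

Lemma measurable_Cre : measurable_fun setT (Cre : borelC R -> R).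
Proof.
by apply: measurable_borelC_real => [z w|]; [rewrite CreD CreN|exact: normCre_le].
Qed.

Lemma measurable_Cim : measurable_fun setT (Cim : borelC R -> R).
Proof.
by apply: measurable_borelC_real => [z w|]; [rewrite CimD CimN|exact: normCim_le].
Qed.

Section cmeas.
Context d (Omega : measurableType d).

Definition cmeas (f : Omega -> R[i]) :=
  measurable_fun setT (Cre \o f) /\ measurable_fun setT (Cim \o f).

(** An open set is the union of the countably many open squares with rational
    centre and side that it contains. *)
Lemma cmeasP (f : Omega -> R[i]) :
  cmeas f <-> measurable_fun setT (f : Omega -> borelC R).
Proof.
split=> [[mr mi]|mf]; last first.
  split; first exact: (measurableT_comp measurable_Cre mf).
  exact: (measurableT_comp measurable_Cim mf).
apply: (@measurability _ _ _ (borelC R) setT f (@open R[i]^o)) => //.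
move=> _ [U oU <-]; rewrite setTI.
pose sq (t : rat * rat * rat) := [set z : R[i] |
  `|Cre z - ratr t.1.1| < ratr t.2 /\ `|Cim z - ratr t.1.2| < ratr t.2].
pose V t := if `[< sq t `<=` U >] then f @^-1` sq t else set0.
rewrite (_ : f @^-1` U = \bigcup_t V t).
  apply: countable_bigcupT_measurable; first exact: countableP.
  move=> t; rewrite /V; case: asboolP => // _.
  rewrite (_ : f @^-1` _ =
    (Cre \o f) @^-1` [set x | `|x - ratr t.1.1| < ratr t.2] `&`
    (Cim \o f) @^-1` [set x | `|x - ratr t.1.2| < ratr t.2])//.
  have mI (x y : R) : measurable [set u : R | `|u - x| < y].
    rewrite (_ : mkset _ = `]x - y, x + y[%classic); first exact: measurable_itv.
    by apply/seteqP; split => u /=; rewrite in_itv/= ltr_distl.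
  by apply: measurableI; rewrite -[X in measurable X]setTI; [exact: mr|exact: mi].
apply/seteqP; split => w; last first.
  by move=> [t _]; rewrite /V; case: asboolP => // tU; exact: tU.
move=> Uw; move: oU; rewrite openE => /(_ _ Uw) /nbhs_ballP[[e i]].
rewrite /= ltcE/= => /andP[/eqP -> e0] eU.
have [r] := rat_in_itvoo (divr_gt0 e0 (ltr0n _ 4)).
rewrite in_itv/= => /andP[r0 re].
have near (x : R) : exists q : rat, `|x - ratr q| < ratr r.
  have [q] : exists q, ratr q \in `](x - ratr r), (x + ratr r)[.
    by apply: rat_in_itvoo; rewrite ltrBlDr -addrA ltrDl addr_gt0.
  by rewrite in_itv/= => /andP[q1 q2]; exists q; rewrite ltr_distlC ?q1 ?q2// -ltr_distl distrC ltr_distl q1.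
have [p1 p1r] := near (Cre (f w)); have [p2 p2r] := near (Cim (f w)).
exists (p1, p2, r) => //; rewrite /V; case: asboolP => //; case => z /= [z1 z2].
apply: eU; rewrite /ball/= norm_cabs complexr0 ltcR.
apply: le_lt_trans (cabs_le _) _; rewrite CreD CimD CreN CimN.
have h1 : `|Cre (f w) - Cre z| < e / 4 + e / 4.
  rewrite (_ : _ - _ = (Cre (f w) - ratr p1) - (Cre z - ratr p1)); last by ring.
  apply: le_lt_trans (ler_normB _ _) _; apply: ltrD; exact: lt_trans re.
have h2 : `|Cim (f w) - Cim z| < e / 4 + e / 4.
  rewrite (_ : _ - _ = (Cim (f w) - ratr p2) - (Cim z - ratr p2)); last by ring.
  apply: le_lt_trans (ler_normB _ _) _; apply: ltrD; exact: lt_trans re.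
lra.
Qed.

Lemma cmeas_cst z : cmeas (fun=> z). Proof. by split; exact: measurable_cst. Qed.

Lemma cmeasD f g : cmeas f -> cmeas g -> cmeas (fun w => f w + g w).
Proof.
move=> [fr fi] [gr gi]; split.
  rewrite (_ : _ \o _ = (Cre \o f) \+ (Cre \o g)); last by apply/funext => w /=; rewrite CreD.
  exact: measurable_funD.
rewrite (_ : _ \o _ = (Cim \o f) \+ (Cim \o g)); last by apply/funext => w /=; rewrite CimD.
exact: measurable_funD.
Qed.

Lemma cmeasN f : cmeas f -> cmeas (fun w => - f w).
Proof.
move=> [fr fi]; split.
  rewrite (_ : _ \o _ = \- (Cre \o f)); last by apply/funext => w /=; rewrite CreN.
  exact: measurable_funN.
rewrite (_ : _ \o _ = \- (Cim \o f)); last by apply/funext => w /=; rewrite CimN.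
exact: measurable_funN.
Qed.

Lemma cmeasB f g : cmeas f -> cmeas g -> cmeas (fun w => f w - g w).
Proof. by move=> mf mg; apply: cmeasD => //; exact: cmeasN. Qed.

Lemma cmeasM f g : cmeas f -> cmeas g -> cmeas (fun w => f w * g w).
Proof.
move=> [fr fi] [gr gi]; split.
  rewrite (_ : _ \o _ = (Cre \o f) \* (Cre \o g) \- (Cim \o f) \* (Cim \o g)).
    by apply: measurable_funB; exact: measurable_funM.
  by apply/funext => w /=; rewrite CreM.
rewrite (_ : _ \o _ = (Cre \o f) \* (Cim \o g) \+ (Cim \o f) \* (Cre \o g)).
  by apply: measurable_funD; exact: measurable_funM.
by apply/funext => w /=; rewrite CimM.
Qed.

Lemma cmeasJ f : cmeas f -> cmeas (fun w => (f w)^*).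
Proof.
move=> [fr fi]; split.
  by rewrite (_ : _ \o _ = Cre \o f)//; apply/funext => w /=; rewrite CreJ.
rewrite (_ : _ \o _ = \- (Cim \o f)); last by apply/funext => w /=; rewrite CimJ.
exact: measurable_funN.
Qed.

Lemma cmeas_real (f : Omega -> R) : measurable_fun setT f ->
  cmeas (fun w => (f w)%:C).
Proof. by move=> mf; split => //; exact: measurable_cst. Qed.

Lemma cmeas_sum (I : Type) (r : seq I) (F : I -> Omega -> R[i]) :
  (forall i, cmeas (F i)) -> cmeas (fun w => \sum_(i <- r) F i w).
Proof.
move=> mF; split.
  rewrite (_ : _ \o _ = fun w => \sum_(i <- r) Cre (F i w)).
    by apply: measurable_sum => i; exact: (mF i).1.
  by apply/funext => w /=; rewrite Cre_sum.
rewrite (_ : _ \o _ = fun w => \sum_(i <- r) Cim (F i w)).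
  by apply: measurable_sum => i; exact: (mF i).2.
by apply/funext => w /=; rewrite Cim_sum.
Qed.

Lemma measurable_cabs f : cmeas f -> measurable_fun setT (fun w => cabs (f w)).
Proof.
move=> [fr fi].
rewrite (_ : (fun w => _) =
  (fun x => Num.sqrt x) \o (fun w => (Cre \o f) w ^+ 2 + (Cim \o f) w ^+ 2)).
  apply: measurableT_comp.
    by apply: continuous_measurable_fun; exact: sqrt_continuous.
  by apply: measurable_funD; exact: measurable_funX.
by apply/funext => w /=; case: (f w).
Qed.

End cmeas.
End complex_numbers.

Lemma cmeas_comp (R : realType) d d' (T : measurableType d)
    (Omega : measurableType d') (f : T -> R[i]) (g : Omega -> T) :
  measurable_fun setT g -> cmeas f -> cmeas (f \o g).
Proof.
by move=> mg [fr fi]; split; [exact: (measurableT_comp fr mg)|exact: (measurableT_comp fi mg)].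
Qed.

(** * Independence and expectations *)

Section independence.
Context (R : realType) d (Omega : measurableType d) (P : probability Omega R).

Definition indep d1 d2 (T1 : measurableType d1) (T2 : measurableType d2)
    (f : Omega -> T1) (g : Omega -> T2) :=
  forall A B, measurable A -> measurable B ->
    P (f @^-1` A `&` g @^-1` B) = (P (f @^-1` A) * P (g @^-1` B))%E.

Lemma indep_comp d1 d2 d3 d4 (T1 : measurableType d1) (T2 : measurableType d2)
    (T3 : measurableType d3) (T4 : measurableType d4)
    (f : Omega -> T1) (g : Omega -> T2) (h : T1 -> T3) (k : T2 -> T4) :
  measurable_fun setT h -> measurable_fun setT k ->
  indep f g -> indep (h \o f) (k \o g).
Proof.
move=> mh mk fg A B mA mB; apply: (fg (h @^-1` A) (k @^-1` B)).
- by rewrite -[X in measurable X]setTI; exact: mh.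
- by rewrite -[X in measurable X]setTI; exact: mk.
Qed.

Section product_law.
Context d1 d2 (T1 : measurableType d1) (T2 : measurableType d2)
  (f : Omega -> T1) (g : Omega -> T2).
Hypotheses (mf : measurable_fun setT f) (mg : measurable_fun setT g)
  (fg : indep f g).

Lemma indep_law : has_law P (fun w => (f w, g w)) (law P mf \x law P mg)%E.
Proof.
move=> B mB; apply: esym.
have mfg := measurable_fun_pair mf mg.
rewrite -[RHS]/(law P mfg B).
by apply: product_measure_unique => // A1 A2 mA1 mA2; exact: fg.
Qed.

Lemma indep_ge0_integral (h : T1 -> \bar R) (k : T2 -> \bar R) :
  measurable_fun setT h -> measurable_fun setT k ->
  (forall x, (0 <= h x)%E) -> (forall x, (0 <= k x)%E) ->
  (\int[P]_w (h (f w) * k (g w)) =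
   \int[P]_w h (f w) * \int[P]_w k (g w))%E.
Proof.
move=> mh mk h0 k0.
have mhk : measurable_fun setT (fun z : T1 * T2 => h z.1 * k z.2)%E.
  by apply: emeasurable_funM; [exact: (measurableT_comp mh measurable_fst)|
    exact: (measurableT_comp mk measurable_snd)].
rewrite -(has_law_ge0_integral (measurable_fun_pair mf mg) indep_law mhk); last first.
  by move=> z; exact: mule_ge0.
rewrite fubini_tonelli1//; last by move=> z; exact: mule_ge0.
rewrite /fubini_F/=.
under eq_integral do rewrite ge0_integralZl//.
rewrite ge0_integralZr//; last exact: integral_ge0.
have e1 := has_law_ge0_integral mf (has_law_law P mf) mh h0.
have e2 := has_law_ge0_integral mg (has_law_law P mg) mk k0.
by rewrite e1 e2.
Qed.

End product_law.

Lemma indep_integrable (X Y : Omega -> R) :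
  indep X Y ->
  P.-integrable setT (EFin \o X) -> P.-integrable setT (EFin \o Y) ->
  P.-integrable setT (EFin \o (X \* Y)) /\
  (\int[P]_w (X w * Y w) = (\int[P]_w X w) * (\int[P]_w Y w))%R.
Proof.
move=> XY iX iY.
have mX : measurable_fun setT X by apply/measurable_EFinP; exact: (measurable_int P iX).
have mY : measurable_fun setT Y by apply/measurable_EFinP; exact: (measurable_int P iY).
have mn : measurable_fun setT (fun x : R => `|x%:E|%E).
  by apply: measurableT_comp => //; exact/measurable_EFinP.
pose Z (z : R * R) : \bar R := (z.1 * z.2)%:E.
have mZ : measurable_fun setT Z.
  by apply/measurable_EFinP; apply: measurable_funM; [exact: measurable_fst|exact: measurable_snd].
have iXY : P.-integrable setT (EFin \o (X \* Y)).
  apply/integrableP; split; first exact/measurable_EFinP/measurable_funM.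
  rewrite (eq_integral (fun w => `|(X w)%:E| * `|(Y w)%:E|)%E); last first.
    by move=> w _; rewrite /= -EFinM normrM.
  rewrite (indep_ge0_integral mX mY XY mn mn)//.
  by move/integrableP : iX => [_ iX]; move/integrableP : iY => [_ iY];
    rewrite lte_mul_pinfty// ?integral_ge0// ge0_fin_numE ?integral_ge0.
split=> //.
have lXY := indep_law mX mY XY.
have mXY := measurable_fun_pair mX mY.
have iZ : ((law P mX \x law P mY)%E).-integrable setT Z.
  exact/(has_law_integrable mXY lXY mZ).
rewrite /Rintegral -(has_law_integral mXY lXY mZ) -integral12_prod_meas1//.
rewrite /fubini_F/= /Z/=.
have iY' : (law P mY).-integrable setT (EFin : R -> \bar R).
  by apply/(has_law_integrable mY (has_law_law P mY)) => //; exact/measurable_EFinP.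
have iX' : (law P mX).-integrable setT (EFin : R -> \bar R).
  by apply/(has_law_integrable mX (has_law_law P mX)) => //; exact/measurable_EFinP.
have inner (x : R) : (\int[law P mY]_y (x * y)%:E =
    x%:E * \int[law P mY]_y y%:E)%E.
  by under eq_integral do rewrite EFinM; rewrite integralZl.
under eq_integral do rewrite inner.
have fY : (\int[law P mY]_y y%:E)%E \is a fin_num by exact: integrable_fin_num iY'.
have fX : (\int[law P mX]_y y%:E)%E \is a fin_num by exact: integrable_fin_num iX'.
rewrite -(fineK fY) integralZr// fineM//.
have mE : measurable_fun setT (EFin : R -> \bar R) by exact/measurable_EFinP.
have e1 := has_law_integral mX (has_law_law P mX) mE.
have e2 := has_law_integral mY (has_law_law P mY) mE.
by rewrite e1 e2.
Qed.

End independence.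

Section expectation.
Context (R : realType) d (Omega : measurableType d) (P : probability Omega R).
Implicit Types (f g h : Omega -> R[i]).

Lemma integrableD_EFin (F G : Omega -> R) :
  P.-integrable setT (EFin \o F) -> P.-integrable setT (EFin \o G) ->
  P.-integrable setT (EFin \o (fun w => F w + G w)).
Proof. by move=> iF iG; exact: (integrableD measurableT iF iG). Qed.

Lemma integrableZ_EFin (F : Omega -> R) (k : R) :
  P.-integrable setT (EFin \o F) ->
  P.-integrable setT (EFin \o (fun w => k * F w)).
Proof. by move=> iF; exact: (integrableZl measurableT k iF). Qed.

Definition Ec f : R[i] :=
  (\int[P]_w Cre (f w))%R +i* (\int[P]_w Cim (f w))%R.

Definition cint f := P.-integrable setT (EFin \o (Cre \o f)) /\
  P.-integrable setT (EFin \o (Cim \o f)).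

Lemma cint_cmeas f : cint f -> cmeas f.
Proof.
by move=> [ir ii]; split; apply/measurable_EFinP; exact: (measurable_int P).
Qed.

Lemma le_cint f (G : Omega -> R) : cmeas f ->
  P.-integrable setT (EFin \o G) -> (forall w, cabs (f w) <= G w) -> cint f.
Proof.
move=> [mr mi] iG fG.
have G0 w : 0 <= G w by exact: le_trans (cabs_ge0 _) (fG w).
split; apply: (le_integrable measurableT _ _ iG); try exact/measurable_EFinP.
  by move=> w _; rewrite /= lee_fin (ger0_norm (G0 w)); exact: le_trans (normCre_le _) (fG w).
by move=> w _; rewrite /= lee_fin (ger0_norm (G0 w)); exact: le_trans (normCim_le _) (fG w).
Qed.

Lemma cint_cst (z : R[i]) : cint (fun=> z).
Proof. by split; exact: finite_measure_integrable_cst. Qed.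

Lemma cintD f g : cint f -> cint g -> cint (fun w => f w + g w).
Proof.
move=> [fr fi] [gr gi]; split.
  rewrite (_ : _ \o _ = (EFin \o (Cre \o f)) \+ (EFin \o (Cre \o g)))%E.
    exact: integrableD.
  by apply/funext => w /=; rewrite CreD.
rewrite (_ : _ \o _ = (EFin \o (Cim \o f)) \+ (EFin \o (Cim \o g)))%E.
  exact: integrableD.
by apply/funext => w /=; rewrite CimD.
Qed.

Lemma cintN f : cint f -> cint (fun w => - f w).
Proof.
move=> [fr fi]; split.
  rewrite (_ : _ \o _ = \- (EFin \o (Cre \o f)))%E; first exact: integrableN.
  by apply/funext => w /=; rewrite CreN.
rewrite (_ : _ \o _ = \- (EFin \o (Cim \o f)))%E; first exact: integrableN.
by apply/funext => w /=; rewrite CimN.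
Qed.

Lemma cint_sum (I : Type) (r : seq I) (F : I -> Omega -> R[i]) :
  (forall i, cint (F i)) -> cint (fun w => \sum_(i <- r) F i w).
Proof.
move=> cF; elim: r => [|i r IH].
  under eq_fun do rewrite big_nil; exact: cint_cst.
by under eq_fun do rewrite big_cons; exact: cintD.
Qed.

Lemma Ec_cst (z : R[i]) : Ec (fun=> z) = z.
Proof.
rewrite /Ec !Rintegral_cst//= probability_setT/= !mulr1.
by case: z.
Qed.

Lemma EcD f g : cint f -> cint g -> Ec (fun w => f w + g w) = Ec f + Ec g.
Proof.
move=> [fr fi] [gr gi]; rewrite /Ec.
under eq_Rintegral do rewrite CreD.
under [X in _ +i* X]eq_Rintegral do rewrite CimD.
by rewrite !RintegralD.
Qed.

Lemma EcN f : cint f -> Ec (fun w => - f w) = - Ec f.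
Proof.
move=> [fr fi]; rewrite /Ec.
under eq_Rintegral do rewrite CreN -mulN1r.
under [X in _ +i* X]eq_Rintegral do rewrite CimN -mulN1r.
by rewrite !RintegralZl// !mulN1r.
Qed.

Lemma EcB f g : cint f -> cint g -> Ec (fun w => f w - g w) = Ec f - Ec g.
Proof. by move=> cf cg; rewrite EcD ?EcN//; exact: cintN. Qed.

Lemma Ec_sum (I : Type) (r : seq I) (F : I -> Omega -> R[i]) :
  (forall i, cint (F i)) ->
  Ec (fun w => \sum_(i <- r) F i w) = \sum_(i <- r) Ec (F i).
Proof.
move=> cF; elim: r => [|i r IH].
  by under eq_fun do rewrite big_nil; rewrite Ec_cst big_nil.
under eq_fun do rewrite big_cons.
by rewrite EcD ?IH ?big_cons//; exact: cint_sum.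
Qed.

Lemma EcJ f : cint f -> Ec (fun w => (f w)^*) = (Ec f)^*.
Proof.
move=> [fr fi]; rewrite /Ec.
under eq_Rintegral do rewrite CreJ.
under [X in _ +i* X]eq_Rintegral do rewrite CimJ -mulN1r.
by rewrite RintegralZl// mulN1r.
Qed.

Lemma Ec_indep f g :
  indep P (f : Omega -> borelC R) (g : Omega -> borelC R) -> cint f -> cint g ->
  cint (fun w => f w * g w) /\ Ec (fun w => f w * g w) = Ec f * Ec g.
Proof.
move=> fg [fr fi] [gr gi].
have rr := indep_comp (@measurable_Cre R) (@measurable_Cre R) fg.
have ri := indep_comp (@measurable_Cre R) (@measurable_Cim R) fg.
have ir := indep_comp (@measurable_Cim R) (@measurable_Cre R) fg.
have ii := indep_comp (@measurable_Cim R) (@measurable_Cim R) fg.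
have [irr err] := indep_integrable rr fr gr.
have [iri eri] := indep_integrable ri fr gi.
have [iir eir] := indep_integrable ir fi gr.
have [iii eii] := indep_integrable ii fi gi.
split.
  split.
    rewrite (_ : _ \o _ = (EFin \o ((Cre \o f) \* (Cre \o g))%R) \-
                          (EFin \o ((Cim \o f) \* (Cim \o g))%R))%E.
      exact: integrableB.
    by apply/funext => w /=; rewrite CreM.
  rewrite (_ : _ \o _ = (EFin \o ((Cre \o f) \* (Cim \o g))%R) \+
                        (EFin \o ((Cim \o f) \* (Cre \o g))%R))%E.
    exact: integrableD.
  by apply/funext => w /=; rewrite CimM.
rewrite /Ec.
under eq_Rintegral do rewrite CreM.
under [X in _ +i* X]eq_Rintegral do rewrite CimM.
apply: complex_ext; rewrite ?CreM ?CimM/=.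
  by rewrite RintegralB// err eii.
by rewrite RintegralD// eri eir.
Qed.

(** ** Square-integrable complex random variables *)

Definition sqm f : \bar R := (\int[P]_w (cabs (f w) ^+ 2)%:E)%E.
Definition cL2 f := cmeas f /\ (sqm f < +oo)%E.

Lemma measurable_sqr_cabs f : cmeas f ->
  measurable_fun setT (fun w => (cabs (f w) ^+ 2)%:E).
Proof.
by move=> mf; apply/measurable_EFinP; apply: measurable_funX; exact: measurable_cabs.
Qed.

Lemma sqm_ge0 f : (0 <= sqm f)%E.
Proof. by apply: integral_ge0 => w _; rewrite lee_fin sqr_ge0. Qed.

Lemma cL2_integrable f : cL2 f ->
  P.-integrable setT (EFin \o (fun w => cabs (f w) ^+ 2)).
Proof.
move=> [mf ff]; apply/integrableP; split; first exact: measurable_sqr_cabs.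
apply: le_lt_trans ff; rewrite le_eqVlt; apply/orP; left; apply/eqP.
by apply: eq_integral => w _; rewrite /= ger0_norm// sqr_ge0.
Qed.

Lemma sqm_fin f : cL2 f -> sqm f \is a fin_num.
Proof. by move=> [_ ff]; rewrite ge0_fin_numE// sqm_ge0. Qed.

Lemma le_cL2 f g : cmeas f -> cL2 g -> (forall w, cabs (f w) <= cabs (g w)) ->
  cL2 f.
Proof.
move=> mf [mg fg] H; split => //; apply: le_lt_trans fg.
apply: ge0_le_integral => //.
- by move=> w _; rewrite lee_fin sqr_ge0.
- exact: measurable_sqr_cabs.
- exact: measurable_sqr_cabs.
- by move=> w _; rewrite lee_fin ler_sqr ?nnegrE ?cabs_ge0.
Qed.

Lemma cL2_cst (z : R[i]) : cL2 (fun=> z).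
Proof.
split; first exact: cmeas_cst.
by rewrite /sqm integral_cst//= probability_setT mule1 ltry.
Qed.

Lemma cabs_sqrD (z w : R[i]) :
  cabs (z + w) ^+ 2 <= 2 * cabs z ^+ 2 + 2 * cabs w ^+ 2.
Proof.
rewrite !sqr_cabs CreD CimD.
have := sqr_ge0 (Cre z - Cre w); have := sqr_ge0 (Cim z - Cim w); nra.
Qed.

Lemma sqmD f g : cmeas f -> cmeas g ->
  (sqm (fun w => f w + g w)%R <= 2%:E * sqm f + 2%:E * sqm g)%E.
Proof.
move=> mf mg; rewrite /sqm -!ge0_integralZl_EFin//; first last.
- exact: measurable_sqr_cabs.
- by move=> w _; rewrite lee_fin sqr_ge0.
- exact: measurable_sqr_cabs.
- by move=> w _; rewrite lee_fin sqr_ge0.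
rewrite -ge0_integralD//.
- apply: ge0_le_integral => //.
  + by move=> w _; rewrite lee_fin sqr_ge0.
  + by apply: measurable_sqr_cabs; exact: cmeasD.
  + by apply: emeasurable_funD; apply: measurable_funeM; exact: measurable_sqr_cabs.
  + by move=> w _; rewrite -!EFinM -EFinD lee_fin cabs_sqrD.
- by move=> w _; rewrite -EFinM lee_fin mulr_ge0// sqr_ge0.
- by apply: measurable_funeM; exact: measurable_sqr_cabs.
- by move=> w _; rewrite -EFinM lee_fin mulr_ge0// sqr_ge0.
- by apply: measurable_funeM; exact: measurable_sqr_cabs.
Qed.

Lemma sqmN f : sqm (fun w => - f w) = sqm f.
Proof. by apply: eq_integral => w _; rewrite cabsN. Qed.

Lemma cL2D f g : cL2 f -> cL2 g -> cL2 (fun w => f w + g w).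
Proof.
move=> [mf ff] [mg fg]; split; first exact: cmeasD.
apply: le_lt_trans (sqmD mf mg) _.
by rewrite lte_add_pinfty// lte_mul_pinfty.
Qed.

Lemma cL2N f : cL2 f -> cL2 (fun w => - f w).
Proof. by move=> [mf ff]; split; [exact: cmeasN|rewrite sqmN]. Qed.

Lemma cL2B f g : cL2 f -> cL2 g -> cL2 (fun w => f w - g w).
Proof. by move=> lf lg; apply: cL2D => //; exact: cL2N. Qed.

Lemma sqmBC f g : sqm (fun w => f w - g w) = sqm (fun w => g w - f w).
Proof. by apply: eq_integral => w _; rewrite -cabsN opprB. Qed.

(** From |u + v|^2 <= 2 |u|^2 + 2 |v|^2. *)
Lemma sqm_triangle f g h : cmeas f -> cmeas g -> cmeas h ->
  (sqm (fun w => f w - h w)%R <=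
   2%:E * sqm (fun w => f w - g w)%R + 2%:E * sqm (fun w => g w - h w)%R)%E.
Proof.
move=> mf mg mh; rewrite (_ : (fun w => f w - h w) =
    (fun w => (f w - g w) + (g w - h w))); last by apply/funext => w; ring.
by apply: sqmD; exact: cmeasB.
Qed.

Lemma sqm0_ae f : cmeas f -> sqm f = 0%E -> {ae P, forall w, f w = 0}.
Proof.
move=> mf f0.
have : (\int[P]_w `|(cabs (f w) ^+ 2)%:E| = 0)%E.
  by rewrite -[RHS]f0; apply: eq_integral => w _; rewrite /= ger0_norm// sqr_ge0.
move/(ae_eq_integral_abs P measurableT (measurable_sqr_cabs mf)).
apply: filterS => w /(_ I) /= [] /eqP; rewrite sqrf_eq0 cabs_eq0.
by move/eqP.
Qed.

Lemma cint_mulJ f g : cL2 f -> cL2 g -> cint (fun w => f w * (g w)^*).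
Proof.
move=> lf lg; have [mf _] := lf; have [mg _] := lg.
apply: (@le_cint _ (fun w => cabs (f w) ^+ 2 + cabs (g w) ^+ 2)).
- by apply: cmeasM => //; exact: cmeasJ.
- by apply: integrableD_EFin; exact: cL2_integrable.
- move=> w; rewrite cabsM cabsJ.
  have := cabs_ge0 (f w); have := cabs_ge0 (g w); nra.
Qed.

Lemma cL2_cint f : cL2 f -> cint f.
Proof.
move=> lf; have := cint_mulJ lf (cL2_cst 1).
rewrite (_ : (fun w => _) = f)//; apply/funext => w.
by transitivity (f w * 1); [congr (_ * _); exact: conjc1|rewrite mulr1].
Qed.

Definition ip f g : R[i] := Ec (fun w => f w * (g w)^*).

Lemma ip1 f : ip f (fun=> 1) = Ec f.
Proof.
congr Ec; apply/funext => w.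
by transitivity (f w * 1); [congr (_ * _); exact: conjc1|rewrite mulr1].
Qed.

Lemma ipC f g : cL2 f -> cL2 g -> ip g f = (ip f g)^*.
Proof.
move=> lf lg; rewrite /ip -EcJ; last exact: cint_mulJ.
by congr Ec; apply/funext => w; rewrite rmorphM/= conjcK mulrC.
Qed.

Lemma ipBl f g h : cL2 f -> cL2 g -> cL2 h ->
  ip (fun w => f w - g w) h = ip f h - ip g h.
Proof.
move=> lf lg lh; rewrite /ip -EcB; [|exact: cint_mulJ..].
by congr Ec; apply/funext => w; rewrite mulrBl.
Qed.

Lemma ipBr f g h : cL2 f -> cL2 g -> cL2 h ->
  ip h (fun w => f w - g w) = ip h f - ip h g.
Proof.
move=> lf lg lh; rewrite /ip -EcB; [|exact: cint_mulJ..].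
by congr Ec; apply/funext => w; rewrite rmorphB/= mulrBr.
Qed.

Lemma CreMJ (z : R[i]) : Cre (z * z^*) = cabs z ^+ 2.
Proof. by rewrite CreM CreJ CimJ sqr_cabs; ring. Qed.

Lemma sqm_ip f : cL2 f -> sqm f = (Cre (ip f f))%:E.
Proof.
move=> lf; rewrite /ip /Ec/= /Rintegral.
under [in RHS]eq_integral do rewrite CreMJ.
by rewrite fineK//; exact: sqm_fin.
Qed.

Lemma sqmB f g : cL2 f -> cL2 g ->
  sqm (fun w => f w - g w) =
  (Cre (ip f f) + Cre (ip g g) - 2 * Cre (ip f g))%:E.
Proof.
move=> lf lg; have lfg := cL2B lf lg; rewrite sqm_ip// ipBl// !ipBr//.
by rewrite [ip g f]ipC// !(CreD, CreN, CreJ); congr (_%:E); ring.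
Qed.

(** A weak form of the Cauchy-Schwarz inequality: the weight [t] is at the
    disposal of the user. *)
Lemma ip_weighted f g (t : R) : cL2 f -> cL2 g -> 0 < t ->
  cabs (ip f g) <= t * fine (sqm f) + t^-1 * fine (sqm g).
Proof.
move=> lf lg t0; have [ir ii] := cint_mulJ lf lg.
pose G w := (t * cabs (f w) ^+ 2 + t^-1 * cabs (g w) ^+ 2) / 2.
have Gge w : cabs (f w * (g w)^*) <= G w.
  rewrite cabsM cabsJ /G ler_pdivlMr//.
  have tV : t * t^-1 = 1 by rewrite divff// gt_eqF.
  have tV0 : 0 < t^-1 by rewrite invr_gt0.
  have : 0 <= t^-1 * (t * cabs (f w) - cabs (g w)) ^+ 2 by rewrite mulr_ge0// ?sqr_ge0// ltW.
  rewrite (_ : t^-1 * _ = (t * t^-1) * t * cabs (f w) ^+ 2 + t^-1 * cabs (g w) ^+ 2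
     - (t * t^-1) * 2 * (cabs (f w) * cabs (g w))); last by ring.
  rewrite tV; lra.
have i1 := cL2_integrable lf; have i2 := cL2_integrable lg.
have i1' := integrableZ_EFin t i1; have i2' := integrableZ_EFin t^-1 i2.
have iS := integrableD_EFin i1' i2'.
have iG : P.-integrable setT (EFin \o G).
  rewrite (_ : G = fun w => 2^-1 * (t * cabs (f w) ^+ 2 + t^-1 * cabs (g w) ^+ 2)).
    exact: integrableZ_EFin.
  by apply/funext => w; rewrite /G mulrC.
have bound (k : Omega -> R) : P.-integrable setT (EFin \o k) ->
    (forall w, `|k w| <= G w) ->
    `|(\int[P]_w k w)%R| <= (t * fine (sqm f) + t^-1 * fine (sqm g)) / 2.
  move=> ik kG.
  have H := le_normr_Rintegral measurableT ik; apply: le_trans H _.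
  apply: (@le_trans _ _ (\int[P]_w G w)%R).
    apply: le_Rintegral => //; exact: integrable_norm.
  have -> : G = fun w => 2^-1 * (t * cabs (f w) ^+ 2 + t^-1 * cabs (g w) ^+ 2).
    by apply/funext => w; rewrite /G mulrC.
  by rewrite RintegralZl// RintegralD// !RintegralZl// mulrC.
apply: le_trans (cabs_le _) _.
rewrite [leRHS]splitr; apply: lerD; apply: bound => // w.
  exact: le_trans (normCre_le _) (Gge w).
exact: le_trans (normCim_le _) (Gge w).
Qed.

End expectation.

Section transfer_moments.
Context (R : realType) d d' (T1 : measurableType d) (T2 : measurableType d')
  (P : probability T1 R) (Q : probability T2 R) (f : T1 -> T2).
Hypotheses (mf : measurable_fun setT f) (Pf : has_law P f Q).

Lemma sqm_law (g : T2 -> R[i]) : cmeas g -> sqm P (g \o f) = sqm Q g.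
Proof.
move=> mg; apply: esym.
apply: (has_law_ge0_integral mf Pf (measurable_sqr_cabs mg)) => x.
by rewrite lee_fin sqr_ge0.
Qed.

Lemma cL2_law (g : T2 -> R[i]) : cL2 Q g -> cL2 P (g \o f).
Proof. by move=> [mg fg]; split; [exact: cmeas_comp|rewrite sqm_law]. Qed.

Lemma Ec_law (g : T2 -> R[i]) : cmeas g -> Ec P (g \o f) = Ec Q g.
Proof.
move=> [mr mi]; rewrite /Ec /Rintegral.
have mr' : measurable_fun setT (EFin \o (Cre \o g)) by exact/measurable_EFinP.
have mi' : measurable_fun setT (EFin \o (Cim \o g)) by exact/measurable_EFinP.
have er := has_law_integral mf Pf mr'.
have ei := has_law_integral mf Pf mi'.
by congr (fine _ +i* fine _); [exact: esym er|exact: esym ei].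
Qed.

Lemma ip_law (g h : T2 -> R[i]) : cmeas g -> cmeas h -> ip P (g \o f) (h \o f) = ip Q g h.
Proof. by move=> mg mh; rewrite /ip -Ec_law//; apply: cmeasM => //; exact: cmeasJ. Qed.

End transfer_moments.

(** * Almost sure and L2 limits *)

Section complex_limits.
Context (R : realType).
Implicit Types (u : nat -> R[i]).

(** A limit operator that is measurable even where the sequence diverges. *)
Definition Clim u : R[i] :=
  fine (limn_esup (fun n => (Cre (u n))%:E)) +i*
  fine (limn_esup (fun n => (Cim (u n))%:E)).

Definition Csum u : R[i] := Clim (fun n => \sum_(0 <= j < n) u j).

Lemma Clim_cvg u z : (u : nat -> R[i]^o) @ \oo --> (z : R[i]^o) -> Clim u = z.
Proof.
move=> /cvg_complexP[ur ui]; rewrite /Clim.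
have aux (v : nat -> R) (x : R) : v @ \oo --> x ->
    fine (limn_esup (fun n => (v n)%:E)) = x.
  move=> vx; have : EFin \o v @ \oo --> x%:E by apply/fine_cvgP; split => //; exact: nearW.
  by move=> /cvg_limn_einf_sup[_ ->].
by rewrite (aux (Cre \o u) _ ur) (aux (Cim \o u) _ ui); case: z {ur ui}.
Qed.

Lemma cmeas_Clim d (Omega : measurableType d) (f : nat -> Omega -> R[i]) :
  (forall n, cmeas (f n)) -> cmeas (fun w => Clim (f ^~ w)).
Proof.
move=> mf; split; apply: (measurableT_comp (@fine_measurable R setT measurableT));
  apply: measurable_fun_limn_esup => n; apply/measurable_EFinP.
- exact: (mf n).1.
- exact: (mf n).2.
Qed.

Lemma cmeas_Csum d (Omega : measurableType d) (f : nat -> Omega -> R[i]) :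
  (forall n, cmeas (f n)) -> cmeas (fun w => Csum (f ^~ w)).
Proof.
by move=> mf; apply: (@cmeas_Clim _ _ (fun n w => \sum_(0 <= j < n) f j w)) => n; exact: cmeas_sum.
Qed.

Lemma real_series_cvg (v : nat -> R) (b : nat -> R) : (forall j, `|v j| <= b j) ->
  (\sum_(0 <= j <oo) (b j)%:E < +oo)%E ->
  cvgn (fun n => \sum_(0 <= j < n) v j).
Proof.
move=> vb boo.
have b0 j : 0 <= b j by exact: le_trans (normr_ge0 _) (vb j).
have : cvgn (series (fun j => `|v j|)).
  apply: (series_le_cvg _ b0 vb) => //.
  apply: nondecreasing_is_cvgn; first exact: nondecreasing_series.
  exists (fine (\sum_(0 <= j <oo) (b j)%:E)) => _ [n _ <-].
  rewrite -lee_fin fineK; last first.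
    by rewrite ge0_fin_numE//; apply: nneseries_ge0 => j _ _; rewrite lee_fin.
  rewrite /series/= -sumEFin; apply: nneseries_lim_ge => j _ _.
  by rewrite lee_fin.
exact: normed_cvg.
Qed.

Lemma cvg_Csum u : (\sum_(0 <= j <oo) (cabs (u j))%:E < +oo)%E ->
  (fun n => \sum_(0 <= j < n) u j : R[i]^o) @ \oo --> (Csum u : R[i]^o).
Proof.
move=> uoo.
have cr := real_series_cvg (fun j => normCre_le (u j)) uoo.
have ci := real_series_cvg (fun j => normCim_le (u j)) uoo.
pose l : R[i] := limn (fun n => \sum_(0 <= j < n) Cre (u j)) +i*
                 limn (fun n => \sum_(0 <= j < n) Cim (u j)).
suff ul : (fun n => \sum_(0 <= j < n) u j : R[i]^o) @ \oo --> (l : R[i]^o).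
  by rewrite /Csum (Clim_cvg ul).
apply/cvg_complexP; split => /=.
  rewrite (_ : _ \o _ = fun n => \sum_(0 <= j < n) Cre (u j))//.
  by apply/funext => n /=; rewrite Cre_sum.
rewrite (_ : _ \o _ = fun n => \sum_(0 <= j < n) Cim (u j))//.
by apply/funext => n /=; rewrite Cim_sum.
Qed.

Lemma cvg_Clim_increments u :
  (\sum_(0 <= j <oo) (cabs (u j.+1 - u j))%:E < +oo)%E ->
  (u : nat -> R[i]^o) @ \oo --> (Clim u : R[i]^o).
Proof.
move=> /cvg_Csum cs.
suff c : (u : nat -> R[i]^o) @ \oo --> (u 0%N + Csum (fun j => u j.+1 - u j) : R[i]^o).
  by rewrite (Clim_cvg c).
have H : (fun n => u 0%N + \sum_(0 <= j < n) (u j.+1 - u j) : R[i]^o) @ \oo -->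
    (u 0%N + Csum (fun j => u j.+1 - u j) : R[i]^o).
  have /cvg_complexP[cr ci] := cs; apply/cvg_complexP; split.
    rewrite (_ : _ \o _ = fun n => Cre (u 0%N) + Cre (\sum_(0 <= j < n) (u j.+1 - u j))).
      by rewrite CreD; apply: cvgD; [exact: cvg_cst|exact: cr].
    by apply/funext => n /=; rewrite CreD.
  rewrite (_ : _ \o _ = fun n => Cim (u 0%N) + Cim (\sum_(0 <= j < n) (u j.+1 - u j))).
    by rewrite CimD; apply: cvgD; [exact: cvg_cst|exact: ci].
  by apply/funext => n /=; rewrite CimD.
rewrite (_ : (fun n => _) = u) in H => //.
by apply/funext => n; rewrite telescope_sumr// addrC subrK.
Qed.

End complex_limits.

Lemma cvg_complex_unique (R : realType) (u v : nat -> R[i]) (y z : R[i]) :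
  (forall n, u n = v n) ->
  (u : nat -> R[i]^o) @ \oo --> (y : R[i]^o) ->
  (v : nat -> R[i]^o) @ \oo --> (z : R[i]^o) -> y = z.
Proof.
move=> /funext -> uy uz.
exact: (@cvg_unique _ (@norm_hausdorff _ R[i]^o) _ _ _ _ uy uz).
Qed.

Section L2_limits.
Context (R : realType) d (Omega : measurableType d) (P : probability Omega R).
Implicit Types (f g h : Omega -> R[i]).

Definition L2_to (f_ : nat -> Omega -> R[i]) f :=
  (fun n => sqm P (fun w => f_ n w - f w)) @ \oo --> 0%E.

Lemma ae_lty_nneseries (g : nat -> Omega -> \bar R) :
  (forall n, measurable_fun setT (g n)) -> (forall n w, (0 <= g n w)%E) ->
  (\sum_(0 <= n <oo) \int[P]_w g n w < +oo)%E ->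
  {ae P, forall w, (\sum_(0 <= n <oo) g n w < +oo)%E}.
Proof.
move=> mg g0 goo.
have iG : P.-integrable setT (fun w => \sum_(0 <= n <oo) g n w)%E.
  apply/integrableP; split; first exact: ge0_emeasurable_sum.
  rewrite (eq_integral (fun w => \sum_(0 <= n <oo) g n w)%E); last first.
    by move=> w _; rewrite gee0_abs//; exact: nneseries_ge0.
  by rewrite integral_nneseries.
apply: filterS (integrable_ae measurableT iG) => w /(_ I).
by rewrite ge0_fin_numE//; exact: nneseries_ge0.
Qed.

Lemma cvg_cabs_sub0 (u : nat -> R[i]) (z : R[i]) :
  (u : nat -> R[i]^o) @ \oo --> (z : R[i]^o) <->
  (fun n => cabs (u n - z)) @ \oo --> (0 : R).
Proof.
split=> [uz|uz].
  apply/cvgrPdist_lt => e e0; move/cvgrPdist_lt : uz => /(_ e%:C).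
  rewrite ltcR => /(_ e0); apply: filterS => n; rewrite norm_cabs ltcR.
  by rewrite sub0r normrN ger0_norm ?cabs_ge0// -cabsN opprB.
apply/cvgrPdist_lt => -[e i]; rewrite ltcE/= => /andP[/eqP -> e0].
move/cvgrPdist_lt : uz => /(_ _ e0); apply: filterS => n.
rewrite sub0r normrN ger0_norm ?cabs_ge0// norm_cabs complexr0 ltcR.
by rewrite -cabsN opprB.
Qed.

Lemma cvg_sqr_cabs (u : nat -> R[i]) (z y : R[i]) :
  (u : nat -> R[i]^o) @ \oo --> (z : R[i]^o) ->
  (fun n => (cabs (u n - y) ^+ 2)%:E) @ \oo --> (cabs (z - y) ^+ 2)%:E.
Proof.
move=> /cvg_complexP[ur ui].
have H : (fun n => (Cre (u n) - Cre y) ^+ 2 + (Cim (u n) - Cim y) ^+ 2) @ \oo -->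
   ((Cre z - Cre y) ^+ 2 + (Cim z - Cim y) ^+ 2).
  rewrite !expr2; apply: cvgD; (apply: cvgM; apply: cvgB; [|exact: cvg_cst|  |exact: cvg_cst]) => //.
rewrite sqr_cabs CreD CreN CimD CimN; apply/fine_cvgP; split; first exact: nearW.
apply: cvg_trans H; apply: near_eq_cvg; apply: nearW => n /=.
by rewrite sqr_cabs CreD CreN CimD CimN.
Qed.

(** Fatou: an L2 Cauchy estimate passes to the almost sure limit. *)
Lemma L2_fatou (f_ : nat -> Omega -> R[i]) f g (e : \bar R) :
  (forall n, cmeas (f_ n)) -> cmeas f -> cmeas g ->
  {ae P, forall w, (f_ ^~ w : nat -> R[i]^o) @ \oo --> (f w : R[i]^o)} ->
  (\forall m \near \oo, sqm P (fun w => f_ m w - g w)%R <= e)%E ->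
  (sqm P (fun w => f w - g w)%R <= e)%E.
Proof.
move=> mf_ mf mg f_f He.
pose F m w := (cabs (f_ m w - g w) ^+ 2)%:E.
have mF m : measurable_fun setT (F m).
  by apply: measurable_sqr_cabs; exact: cmeasB.
have F0 m w : setT w -> (0 <= F m w)%E by move=> _; rewrite lee_fin sqr_ge0.
have <- : (\int[P]_w limn_einf (F ^~ w) = sqm P (fun w => f w - g w)%R)%E.
  apply: ae_eq_integral => //.
  - rewrite (_ : (fun w => _) = (fun w => - limn_esup (fun n => - F n w))%E).
      apply: measurableT_comp => //; apply: measurable_fun_limn_esup => n.
      exact: measurableT_comp.
    apply/funext => w.
    by rewrite -[X in _ = (- X)%E]/(limn_esup (-%E \o F ^~ w)) limn_esupN oppeK.
  - by apply: measurable_sqr_cabs; exact: cmeasB.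
  - apply: filterS f_f => w fw _.
    exact: (cvg_limn_einf_sup (@cvg_sqr_cabs _ _ (g w) fw)).1.
apply: le_trans (fatou P measurableT mF F0) _.
rewrite limn_einf_lim; apply: lime_le; first exact: is_cvg_einfs.
move: He => [N _ HN]; apply: nearW => n.
apply: (@le_trans _ _ (sqm P (fun w => f_ (maxn n N) w - g w))).
  by apply: ereal_inf_lbound; exists (maxn n N) => //=; exact: leq_maxl.
by apply: HN => /=; exact: leq_maxr.
Qed.

Lemma L2_to_ip (f_ g_ : nat -> Omega -> R[i]) f g :
  (forall n, cL2 P (f_ n)) -> (forall n, cL2 P (g_ n)) -> cL2 P f -> cL2 P g ->
  L2_to f_ f -> L2_to g_ g ->
  (fun n => ip P (f_ n) (g_ n) : R[i]^o) @ \oo --> (ip P f g : R[i]^o).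
Proof.
move=> lf_ lg_ lf lg ff gg.
have fin_cvg (h_ : nat -> Omega -> R[i]) h : (forall n, cL2 P (h_ n)) -> cL2 P h ->
    L2_to h_ h -> (fun n => fine (sqm P (fun w => h_ n w - h w))) @ \oo --> (0 : R).
  by move=> lh_ lh; apply: fine_cvg.
have ff' := fin_cvg _ _ lf_ lf ff; have gg' := fin_cvg _ _ lg_ lg gg.
apply/cvg_cabs_sub0/cvgrPdist_lt => e e0.
pose F n := fine (sqm P (fun w => f_ n w - f w)).
pose G n := fine (sqm P (fun w => g_ n w - g w)).
have F0 n : 0 <= F n by exact/fine_ge0/sqm_ge0.
have G0 n : 0 <= G n by exact/fine_ge0/sqm_ge0.
pose A := fine (sqm P f); pose B := fine (sqm P g).
have A0 : 0 <= A by exact/fine_ge0/sqm_ge0.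
have B0 : 0 <= B by exact/fine_ge0/sqm_ge0.
(* Large enough for the terms that do not tend to 0 to stay below [e / 2]. *)
pose t := e^-1 * 4 * (A + B + 1).
have t0 : 0 < t by rewrite /t !mulr_gt0// ?invr_gt0//; lra.
have bound n : cabs (ip P (f_ n) (g_ n) - ip P f g) <=
    (t + 1) * F n + (t + 1) * G n + t^-1 * (A + B).
  have lfn := cL2B (lf_ n) lf; have lgn := cL2B (lg_ n) lg.
  rewrite (_ : ip P (f_ n) (g_ n) - ip P f g =
    ip P (fun w => f_ n w - f w) (fun w => g_ n w - g w) +
    (ip P (fun w => f_ n w - f w) g + ip P f (fun w => g_ n w - g w))); last first.
    by rewrite !ipBl// !ipBr//; ring.
  apply: le_trans (cabsD _ _) _; apply: le_trans (lerD (lexx _) (cabsD _ _)) _.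
  have h1 := ip_weighted lfn lgn ltr01.
  have h2 := ip_weighted lfn lg t0.
  have tV0 : 0 < t^-1 by rewrite invr_gt0.
  have h3 := ip_weighted lf lgn tV0.
  rewrite invr1 !mul1r -/(F n) -/(G n) in h1.
  rewrite -/(F n) -/B in h2; rewrite invrK -/(G n) -/A in h3.
  lra.
have tAB : t^-1 * (A + B) < e / 2.
  rewrite mulrC ltr_pdivrMr// (_ : e / 2 * t = 2 * (A + B + 1)); first by lra.
  by rewrite /t; field; rewrite gt_eqF.
have Hs : (fun n => (t + 1) * F n + (t + 1) * G n) @ \oo --> (0 : R).
  have aux (u : nat -> R) : u @ \oo --> (0 : R) -> (fun n => (t + 1) * u n) @ \oo --> (0 : R).
    by move=> u0; rewrite -(mulr0 (t + 1)); apply: cvgM => //; exact: cvg_cst.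
  by rewrite -[X in _ --> X](addr0 (0 : R)); apply: cvgD; exact: aux.
have e20 : 0 < e / 2 by rewrite divr_gt0.
move/cvgrPdist_lt : Hs => /(_ _ e20); apply: filterS => n.
rewrite !sub0r !normrN (ger0_norm (cabs_ge0 _)) => H.
apply: le_lt_trans (bound n) _.
have := le_lt_trans (ler_norm _) H; lra.
Qed.

Lemma L2_to_cst f : L2_to (fun=> f) f.
Proof.
rewrite /L2_to (_ : (fun n => _) = cst 0%E); first exact: cvg_cst.
apply/funext => n /=; rewrite /sqm (eq_integral (cst 0%E)) ?integral0// => w _.
by rewrite subrr ComplexField.Normc.normc0 expr0n.
Qed.

Lemma L2_to_Ec (f_ : nat -> Omega -> R[i]) f (m : R[i]) :
  (forall n, cL2 P (f_ n)) -> cL2 P f -> L2_to f_ f ->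
  (forall n, Ec P (f_ n) = m) -> Ec P f = m.
Proof.
move=> lf_ lf ff Em; have l1 := cL2_cst P 1.
have H := L2_to_ip lf_ (fun=> l1) lf l1 ff (L2_to_cst _).
rewrite -ip1; apply: (cvg_complex_unique _ H (@cvg_cst R[i]^o m _ _ _)) => n.
by rewrite ip1 Em.
Qed.

(** Extended real values let the dominating function be a series of nonnegative
    terms. *)
Lemma L2_dominated (f_ : nat -> Omega -> R[i]) f (G : Omega -> \bar R) :
  (forall n, cmeas (f_ n)) -> cmeas f ->
  {ae P, forall w, (f_ ^~ w : nat -> R[i]^o) @ \oo --> (f w : R[i]^o)} ->
  measurable_fun setT G -> (\int[P]_w (G w ^+ 2) < +oo)%E ->
  (forall w, 0 <= G w)%E ->
  (forall n w, (cabs (f_ n w))%:E <= G w)%E ->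
  [/\ forall n, cL2 P (f_ n), cL2 P f & L2_to f_ f].
Proof.
move=> mf_ mf f_f mG Goo G0 fG.
have mG2 : measurable_fun setT (fun w => G w ^+ 2)%E 
  by under eq_fun do rewrite expe2; exact: emeasurable_funM.
have sq_le (x : R) (y : \bar R) : 0 <= x -> (x%:E <= y -> (x ^+ 2)%:E <= y ^+ 2)%E.
  move=> x0; case: y => [y| |]//.
    by rewrite lee_fin => xy; rewrite -EFin_expe lee_fin ler_sqr ?nnegrE ?(le_trans x0).
  by move=> _; rewrite expe2 mulyy leey.
have l_n n : cL2 P (f_ n).
  split => //; apply: le_lt_trans Goo; apply: ge0_le_integral => //.
  - by move=> w _; rewrite lee_fin sqr_ge0.
  - exact: measurable_sqr_cabs.
  - by move=> w _; apply: sq_le => //; exact: cabs_ge0.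
have fG' : {ae P, forall w, (cabs (f w))%:E <= G w}%E.
  apply: filterS f_f => w fw.
  have H : (fun n => (cabs (f_ n w - 0) ^+ 2)%:E) @ \oo --> (cabs (f w - 0) ^+ 2)%:E.
    exact: cvg_sqr_cabs.
  have := G0 w; case Gw : (G w) => [y| |] //= y0; last by rewrite leey.
  have y0' : 0 <= y by rewrite -lee_fin.
  rewrite lee_fin -ler_sqr ?nnegrE ?cabs_ge0// -lee_fin -[f w]subr0.
  rewrite -(cvg_lim _ H)//; apply: lime_le; first by apply/cvg_ex; eexists; exact: H.
  apply: nearW => n.
  rewrite lee_fin subr0 ler_sqr ?nnegrE ?cabs_ge0//.
  by rewrite -lee_fin -Gw.
have lf : cL2 P f.
  split => //; apply: le_lt_trans Goo; apply: ae_ge0_le_integral => //.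
  - by move=> w _; rewrite lee_fin sqr_ge0.
  - exact: measurable_sqr_cabs.
  - by move=> w _; exact: sqre_ge0.
  - by apply: filterS fG' => w H _; apply: sq_le => //; exact: cabs_ge0.
split=> //.
have iG : P.-integrable setT (fun w => 4%:E * G w ^+ 2)%E.
  apply: integrableZl => //; apply/integrableP; split => //.
  by under eq_integral do rewrite gee0_abs ?sqre_ge0//.
have := @dominated_convergence _ _ _ P setT measurableT
  (fun n w => (cabs (f_ n w - f w) ^+ 2)%:E) (cst 0%E) _ _ (measurable_cst _) _ iG.
case.
- by move=> n; apply: measurable_sqr_cabs; exact: cmeasB.
- apply: filterS f_f => w fw _.
  have := @cvg_sqr_cabs _ _ (f w) fw; rewrite subrr.
  by rewrite ComplexField.Normc.normc0 expr0n.
- apply: filterS fG' => w fGw n _.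
  rewrite gee0_abs; last by rewrite lee_fin sqr_ge0.
  apply: (@le_trans _ _ (2 * cabs (f_ n w) ^+ 2 + 2 * cabs (- f w) ^+ 2)%:E).
    by rewrite lee_fin cabs_sqrD.
  rewrite cabsN EFinD !EFinM.
  have h1 := sq_le _ _ (cabs_ge0 _) (fG n w); have h2 := sq_le _ _ (cabs_ge0 _) fGw.
  rewrite (_ : 4%:E = 2%:E + 2%:E)%E; last by rewrite -EFinD; congr (_%:E); ring.
  rewrite ge0_muleDl ?lee_fin//; by apply: leeD; apply: lee_wpmul2l.
- move=> _ _; rewrite integral0; exact.
Qed.

End L2_limits.

(** * Series with random weights *)

Lemma cvg_realC_mul (R : realType) (x_ : nat -> R) (x : R) (z : R[i]) :
  x_ @ \oo --> x ->
  (fun n => (x_ n)%:C * z : R[i]^o) @ \oo --> (x%:C * z : R[i]^o).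
Proof.
move=> xx; apply: cvgMl; apply/cvg_complexP.
by split; [exact: xx|exact: cvg_cst].
Qed.

Section weighted_sums.
Context (R : realType) d (Omega : measurableType d) (P : probability Omega R).

Lemma measurable_nneseries (g : nat -> Omega -> R) :
  (forall j, measurable_fun setT (g j)) -> (forall j w, 0 <= g j w) ->
  measurable_fun setT (fun w => \sum_(0 <= j <oo) (g j w)%:E)%E.
Proof.
move=> mg g0; apply: ge0_emeasurable_sum => [j w _ _|j _].
  by rewrite lee_fin.
exact/measurable_EFinP.
Qed.

Lemma measurable_nneseries_sqr (g : nat -> Omega -> R) :
  (forall j, measurable_fun setT (g j)) -> (forall j w, 0 <= g j w) ->
  measurable_fun setT (fun w => (\sum_(0 <= j <oo) (g j w)%:E) ^+ 2)%E.
Proof.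
move=> mg g0; under eq_fun do rewrite expe2.
by apply: emeasurable_funM; exact: measurable_nneseries.
Qed.

Lemma nneseries_sqr_lim (g : nat -> Omega -> R) :
  (forall j, measurable_fun setT (g j)) -> (forall j w, 0 <= g j w) ->
  (fun n => \int[P]_w ((\sum_(0 <= j < n) g j w) ^+ 2)%:E)%E @ \oo -->
  (\int[P]_w ((\sum_(0 <= j <oo) (g j w)%:E) ^+ 2))%E.
Proof.
move=> mg g0.
have S0 n w : 0 <= \sum_(0 <= j < n) g j w by exact: sumr_ge0.
have Slim w : (fun n => ((\sum_(0 <= j < n) g j w) ^+ 2)%:E) @ \oo -->
    ((\sum_(0 <= j <oo) (g j w)%:E) ^+ 2)%E.
  pose u n := (\sum_(0 <= j < n) (g j w)%:E)%E.
  have uc : u @ \oo --> (\sum_(0 <= j <oo) (g j w)%:E)%E.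
    by apply: is_cvg_nneseries => j _ _; rewrite lee_fin.
  have u2 : (fun n => u n * u n)%E @ \oo --> ((\sum_(0 <= j <oo) (g j w)%:E) ^+ 2)%E.
    rewrite expe2; apply: cvgeM => //; rewrite /mule_def.
    by case: (\sum_(0 <= j <oo) _)%E => [x| |] //=; rewrite ?andbF ?orbF//; case: eqP.
  rewrite (_ : (fun n => _) = (fun n => u n * u n)%E)//.
  by apply/funext => n; rewrite /u sumEFin -EFinM expr2.
under eq_integral do rewrite -(cvg_lim (@ereal_hausdorff R) (Slim _)).
apply: cvg_monotone_convergence => //.
- move=> n; apply/measurable_EFinP; apply: measurable_funX; exact: measurable_sum.
- by move=> n w _; rewrite lee_fin sqr_ge0.
- move=> w _ n m nm; rewrite lee_fin ler_sqr ?nnegrE//.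
  by rewrite (big_cat_nat _ nm)//= lerDl sumr_ge0.
Qed.

Context (a : nat -> Omega -> R) (A2 c : R).
Hypotheses (ma : forall j, measurable_fun setT (a j))
  (a0 : forall j w, 0 <= a j w)
  (a_mean : (\int[P]_w \sum_(0 <= j <oo) (a j w)%:E = 1)%E)
  (a_sqr : (\int[P]_w ((\sum_(0 <= j <oo) (a j w)%:E) ^+ 2) = A2%:E)%E)
  (a_diag : (\int[P]_w \sum_(0 <= j <oo) (a j w ^+ 2)%:E = c%:E)%E).

Let aa_fin j k : (\int[P]_w (a j w * a k w)%:E)%E \is a fin_num.
Proof.
rewrite ge0_fin_numE; last by apply: integral_ge0 => w _; rewrite lee_fin mulr_ge0.
apply: (@le_lt_trans _ _ A2%:E); last exact: ltry.
rewrite -a_sqr; apply: ge0_le_integral => //.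
- by move=> w _; rewrite lee_fin mulr_ge0.
- by apply/measurable_EFinP; exact: measurable_funM.
- exact: measurable_nneseries_sqr.
- move=> w _; rewrite expe2 EFinM; apply: lee_pmul; rewrite ?lee_fin//.
    rewrite (@nneseriesD1 _ _ j)//; last by move=> i _; rewrite lee_fin.
    by rewrite leeDl//; apply: nneseries_ge0 => i _ _; rewrite lee_fin.
  rewrite (@nneseriesD1 _ _ k)//; last by move=> i _; rewrite lee_fin.
  by rewrite leeDl//; apply: nneseries_ge0 => i _ _; rewrite lee_fin.
Qed.

Let aa j k : R := \int[P]_w (a j w * a k w).

Let aa_integrable j k : P.-integrable setT (EFin \o (fun w => a j w * a k w)).
Proof.
apply/integrableP; split.
  by apply/measurable_EFinP; exact: measurable_funM.
have := aa_fin j k; rewrite ge0_fin_numE; last first.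
  by apply: integral_ge0 => w _; rewrite lee_fin mulr_ge0.
by under [in X in _ -> X]eq_integral do rewrite /= ger0_norm ?mulr_ge0//.
Qed.

Let sqr_sum (u : nat -> R) n : (\sum_(0 <= j < n) u j) ^+ 2 =
  \sum_(0 <= j < n) \sum_(0 <= k < n) u j * u k.
Proof.
by rewrite expr2 mulr_suml; apply: eq_bigr => j _; rewrite mulr_sumr.
Qed.

Let integrable_Rsum n (F : nat -> Omega -> R) :
  (forall j, P.-integrable setT (EFin \o F j)) ->
  P.-integrable setT (EFin \o (fun w => \sum_(0 <= j < n) F j w)).
Proof.
move=> iF; elim: n => [|n IH].
  under eq_fun do rewrite big_geq//; exact: finite_measure_integrable_cst.
by under eq_fun do rewrite big_nat_recr//=; exact: integrableD_EFin.
Qed.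

Let Rint_sum n (F : nat -> Omega -> R) :
  (forall j, P.-integrable setT (EFin \o F j)) ->
  \int[P]_w (\sum_(0 <= j < n) F j w) = \sum_(0 <= j < n) \int[P]_w F j w.
Proof.
move=> iF; elim: n => [|n IH].
  by under eq_Rintegral do rewrite big_geq//; rewrite Rintegral_cst// mul0r big_geq.
under eq_Rintegral do rewrite big_nat_recr//=.
by rewrite RintegralD ?big_nat_recr ?IH//=; exact: integrable_Rsum.
Qed.

Let cvg_aa : (fun n => \sum_(0 <= j < n) \sum_(0 <= k < n) aa j k) @ \oo --> A2.
Proof.
have := nneseries_sqr_lim ma a0; rewrite a_sqr => /fine_cvgP[_].
apply: cvg_trans; apply: near_eq_cvg; apply: nearW => n /=; apply: esym.
under [in RHS]eq_integral do rewrite sqr_sum.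
rewrite -[RHS]/(\int[P]_w (\sum_(0 <= j < n) \sum_(0 <= k < n) a j w * a k w))%R.
rewrite (Rint_sum n (F := fun j w => \sum_(0 <= k < n) a j w * a k w)).
  by apply: eq_bigr => j _; rewrite Rint_sum.
by move=> j; exact: integrable_Rsum.
Qed.

Let cvg_diag : (fun n => \sum_(0 <= j < n) aa j j) @ \oo --> c.
Proof.
have H : (fun n => \sum_(0 <= j < n) \int[P]_w (a j w ^+ 2)%:E)%E @ \oo --> c%:E.
  rewrite -a_diag integral_nneseries//; last 2 first.
  - by move=> j; apply/measurable_EFinP; exact: measurable_funX.
  - by move=> j w _; rewrite lee_fin sqr_ge0.
  by apply: is_cvg_nneseries => j _ _; apply: integral_ge0 => w _; rewrite lee_fin sqr_ge0.
move/fine_cvgP : H => [_]; apply: cvg_trans; apply: near_eq_cvg; apply: nearW => n /=; apply: esym.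
rewrite -sum_fine => [|j _].
  by apply: eq_bigr => j _; rewrite /aa /Rintegral; under [in RHS]eq_integral do rewrite expr2.
by have := aa_fin j j; under eq_integral do rewrite -expr2.
Qed.

Let a_integrable j : P.-integrable setT (EFin \o a j).
Proof.
apply/integrableP; split; first exact/measurable_EFinP.
apply: (@le_lt_trans _ _ 1%E); last exact: ltry.
rewrite -a_mean; apply: ge0_le_integral => //.
- by apply: measurableT_comp => //; exact/measurable_EFinP.
- exact: measurable_nneseries.
- move=> w _; rewrite /= ger0_norm// (@nneseriesD1 _ _ j)//; last by move=> i _; rewrite lee_fin.
  by rewrite leeDl//; apply: nneseries_ge0 => i _ _; rewrite lee_fin.
Qed.

Let cvg_mean : (fun n => \sum_(0 <= j < n) \int[P]_w a j w) @ \oo --> (1 : R).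
Proof.
have H : (fun n => \sum_(0 <= j < n) \int[P]_w (a j w)%:E)%E @ \oo --> 1%:E.
  rewrite -a_mean integral_nneseries//; last 2 first.
  - by move=> j; exact/measurable_EFinP.
  - by move=> j w _; rewrite lee_fin.
  by apply: is_cvg_nneseries => j _ _; apply: integral_ge0 => w _; rewrite lee_fin.
move/fine_cvgP : H => [_]; apply: cvg_trans; apply: near_eq_cvg; apply: nearW => n /=; apply: esym.
rewrite -sum_fine// => j _; exact: integrable_fin_num (a_integrable j).
Qed.

Section one_family.
Context (D : nat -> Omega -> R[i]) (s : R).
Hypotheses (lD : forall j, cL2 P (D j)) (sD : forall j, sqm P (D j) = s%:E)
  (aD : forall j k, indep P (fun w => (a j w, a k w)) (D k : Omega -> borelC R)).

Definition wsum : Omega -> R[i] :=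
  fun w => Csum (fun j => (a j w)%:C * D j w).

Let mD j : cmeas (D j). Proof. exact: (lD j).1. Qed.

Let G w : \bar R := (\sum_(0 <= j <oo) (a j w * cabs (D j w))%:E)%E.

Let mG : measurable_fun setT G.
Proof.
apply: measurable_nneseries => [j|j w]; last by rewrite mulr_ge0 ?cabs_ge0.
by apply: measurable_funM => //; exact: measurable_cabs.
Qed.

Let aaD j k : (\int[P]_w (a j w * a k w * cabs (D k w) ^+ 2)%:E = (aa j k * s)%:E)%E.
Proof.
pose h (z : R * R) : \bar R := `|z.1 * z.2|%:E.
pose g (z : borelC R) : \bar R := (cabs (z : R[i]) ^+ 2)%:E.
have mh : measurable_fun setT h.
  apply/measurable_EFinP; apply: measurableT_comp => //.
  by apply: measurable_funM; [exact: measurable_fst|exact: measurable_snd].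
have mid : cmeas (fun z : borelC R => z : R[i]).
  by apply/cmeasP; exact: measurable_id.
have mg : measurable_fun setT g by exact: measurable_sqr_cabs.
have maa : measurable_fun setT (fun w => (a j w, a k w)) by exact: measurable_fun_pair.
have mDk : measurable_fun setT (D k : Omega -> borelC R) by exact/cmeasP.
rewrite (eq_integral (fun w => h (a j w, a k w) * g (D k w))%E); last first.
  by move=> w _; rewrite /h /g /= ger0_norm ?mulr_ge0// -EFinM.
rewrite (indep_ge0_integral maa mDk (aD j k) mh mg); last 2 first.
- by move=> z; rewrite lee_fin.
- by move=> z; rewrite lee_fin sqr_ge0.
rewrite EFinM -(sD k); congr (_ * _)%E.
rewrite /aa /Rintegral fineK//; apply: eq_integral => w _.
by rewrite /h /= ger0_norm// mulr_ge0.
Qed.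

(** A product |D_j| |D_k| is at most the mean of the two squares, each of which
    is independent of the weights. *)
Let G_sqr : (\int[P]_w (G w ^+ 2) <= (A2 * s)%:E)%E.
Proof.
pose g j w := a j w * cabs (D j w).
have mg j : measurable_fun setT (g j).
  by apply: measurable_funM => //; exact: measurable_cabs.
have g0 j w : 0 <= g j w by rewrite mulr_ge0 ?cabs_ge0.
have H := nneseries_sqr_lim mg g0.
rewrite -[leLHS]/(\int[P]_w ((\sum_(0 <= j <oo) (g j w)%:E) ^+ 2))%E -(cvg_lim _ H)//.
have s0 : 0 <= s by rewrite -lee_fin -(sD 0%N) sqm_ge0.
have bound n : (\int[P]_w ((\sum_(0 <= j < n) g j w) ^+ 2)%:E <=
    ((\sum_(0 <= j < n) \sum_(0 <= k < n) aa j k) * s)%:E)%E.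
  rewrite mulr_suml -sumEFin.
  under eq_bigr do rewrite mulr_suml -sumEFin.
  under eq_bigr do under eq_bigr do rewrite -aaD.
  have mt j k : measurable_fun setT (fun w => (a j w * a k w * cabs (D k w) ^+ 2)%:E).
    apply/measurable_EFinP; apply: measurable_funM; first exact: measurable_funM.
    by apply: measurable_funX; exact: measurable_cabs.
  have t0 j k w : (0 <= (a j w * a k w * cabs (D k w) ^+ 2)%:E)%E.
    by rewrite lee_fin; apply: mulr_ge0; [exact: mulr_ge0|exact: sqr_ge0].
  under eq_bigr do rewrite -ge0_integral_sum//.
  rewrite -ge0_integral_sum//; last 2 first.
  - by move=> j; exact: emeasurable_sum.
  - by move=> j w _; exact: sume_ge0.
  apply: ge0_le_integral => //.
  - by move=> w _; rewrite lee_fin sqr_ge0.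
  - by apply/measurable_EFinP; apply: measurable_funX; exact: measurable_sum.
  - by apply: emeasurable_sum => j; exact: emeasurable_sum.
  - move=> w _; under [X in (_ <= X)%E]eq_bigr do rewrite sumEFin.
    rewrite sumEFin lee_fin sqr_sum.
    pose S := \sum_(0 <= j < n) \sum_(0 <= k < n) a j w * a k w * cabs (D k w) ^+ 2.
    have eS : S = \sum_(0 <= j < n) \sum_(0 <= k < n) a j w * a k w * cabs (D j w) ^+ 2.
      rewrite /S exchange_big/=; apply: eq_bigr => j _; apply: eq_bigr => k _.
      by rewrite [a k w * _]mulrC.
    rewrite -/S (_ : S = (S + S) / 2); last by field.
    rewrite {2}eS /S -big_split/= mulr_suml; apply: ler_sum => j _.
    rewrite -big_split/= mulr_suml; apply: ler_sum => k _.
    rewrite /g -mulrDr (_ : _ * _ * (_ * _) = (a j w * a k w) * (cabs (D j w) * cabs (D k w))); last by ring.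
    rewrite -[leRHS]mulrA; apply: ler_wpM2l; first exact: mulr_ge0.
    have := sqr_ge0 (cabs (D j w) - cabs (D k w)); nra.
apply: lime_le; first by apply/cvg_ex; eexists; exact: H.
apply: nearW => n; apply: le_trans (bound n) _; rewrite lee_fin ler_wpM2r//.
have aa0 j k : 0 <= aa j k by apply: Rintegral_ge0 => w _; rewrite mulr_ge0.
rewrite -(cvg_lim _ cvg_aa)//.
apply: nondecreasing_cvgn_le; last by apply/cvg_ex; eexists; exact: cvg_aa.
move=> {}n m nm.
rewrite (big_cat_nat _ nm)//= ler_wpDr ?sumr_ge0//; first by move=> *; exact: sumr_ge0.
by apply: ler_sum => j _; rewrite (big_cat_nat _ nm)//= lerDl sumr_ge0.
Qed.

Let G_lty : (\int[P]_w (G w ^+ 2) < +oo)%E.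
Proof. by apply: le_lt_trans G_sqr _; exact: ltry. Qed.

Lemma wsum_summable :
  {ae P, forall w, (\sum_(0 <= j <oo) (cabs ((a j w)%:C * D j w))%:E < +oo)%E}.
Proof.
have G0 w : (0 <= G w)%E.
  by apply: nneseries_ge0 => j _ _; rewrite lee_fin mulr_ge0 ?cabs_ge0.
have iG : P.-integrable setT (fun w => G w ^+ 2)%E.
  apply/integrableP; split.
    by under eq_fun do rewrite expe2; exact: emeasurable_funM.
  by under eq_integral do rewrite gee0_abs ?sqre_ge0//.
apply: filterS (integrable_ae measurableT iG) => w /(_ I) Gw.
under eq_eseriesr do rewrite cabsM cabs_real ger0_norm//.
rewrite -/(G w) ltey; apply: contraTneq Gw => ->.
by rewrite expe2 mulyy.
Qed.

Let part n w := \sum_(0 <= j < n) (a j w)%:C * D j w.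

Let mterm j : cmeas (fun w => (a j w)%:C * D j w).
Proof. by apply: cmeasM => //; exact: cmeas_real. Qed.

Lemma cmeas_wsum : cmeas wsum.
Proof. exact: cmeas_Csum. Qed.

Let part_wsum : [/\ forall n, cL2 P (part n), cL2 P wsum & L2_to P part wsum].
Proof.
have G0 w : (0 <= G w)%E.
  by apply: nneseries_ge0 => j _ _; rewrite lee_fin mulr_ge0 ?cabs_ge0.
apply: (L2_dominated (G := G)) => //.
- by move=> n; exact: cmeas_sum.
- exact: cmeas_wsum.
- by apply: filterS wsum_summable => w; exact: cvg_Csum.
- move=> n w; apply: (@le_trans _ _ (\sum_(0 <= j < n) (a j w * cabs (D j w))%:E)%E).
    rewrite sumEFin lee_fin; apply: le_trans (cabs_sum _ _ _) _.
    by apply: ler_sum => j _; rewrite cabsM cabs_real ger0_norm.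
  by apply: nneseries_lim_ge => j _ _; rewrite lee_fin mulr_ge0 ?cabs_ge0.
Qed.

Lemma cL2_wsum : cL2 P wsum. Proof. by case: part_wsum. Qed.

Lemma wsum_L2 :
  (forall n, cL2 P (fun w => \sum_(0 <= j < n) (a j w)%:C * D j w)) /\
  L2_to P (fun n w => \sum_(0 <= j < n) (a j w)%:C * D j w) wsum.
Proof. by case: part_wsum. Qed.

Lemma Ec_wsum (m : R[i]) : (forall j, Ec P (D j) = m) -> Ec P wsum = m.
Proof.
move=> Dm; have [lp pw] := wsum_L2.
have H := L2_to_ip lp (fun=> cL2_cst P 1) cL2_wsum (cL2_cst P 1) pw (L2_to_cst P (fun=> 1)).
rewrite -(ip1 P wsum).
have term j : cint P (fun w => (a j w)%:C * D j w) /\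
    Ec P (fun w => (a j w)%:C * D j w) = (\int[P]_w a j w)%:C * m.
  have iaD : indep P (fun w => (a j w)%:C : borelC R) (D j : Omega -> borelC R).
    apply: (indep_comp (h := fun z : R * R => z.1%:C : borelC R) (k := idfun) _ _ (aD j j)).
      by apply/cmeasP; apply: cmeas_real; exact: measurable_fst.
    exact: measurable_id.
  have ca : cint P (fun w => (a j w)%:C).
    by split; [exact: a_integrable|exact: (finite_measure_integrable_cst _ 0)].
  have [] := Ec_indep iaD ca (cL2_cint (lD j)).
  by rewrite Dm => ? ->; split=> //; congr (_ * _); rewrite /Ec/= Rintegral_cst// mul0r.
have e n : ip P (fun w => \sum_(0 <= j < n) (a j w)%:C * D j w) (fun=> 1) =
    (\sum_(0 <= j < n) \int[P]_w a j w)%:C * m.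
  rewrite ip1 Ec_sum; last by move=> j; exact: (term j).1.
  under eq_bigr do rewrite (term _).2.
  by rewrite -mulr_suml -rmorph_sum.
by have := cvg_complex_unique e H (cvg_realC_mul (z := m) cvg_mean); rewrite mul1r.
Qed.

End one_family.

(** Off-diagonal pairs only see [u], typically a product of means, and the
    diagonal has total weight [c]. *)
Lemma ip_wsum (D D' : nat -> Omega -> R[i]) (s s' : R) (u v : R[i]) :
  (forall j, cL2 P (D j)) -> (forall j, sqm P (D j) = s%:E) ->
  (forall j k, indep P (fun w => (a j w, a k w)) (D k : Omega -> borelC R)) ->
  (forall j, cL2 P (D' j)) -> (forall j, sqm P (D' j) = s'%:E) ->
  (forall j k, indep P (fun w => (a j w, a k w)) (D' k : Omega -> borelC R)) ->
  (forall j k, indep P (fun w => (a j w, a k w))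
                 (fun w => D j w * (D' k w)^* : borelC R)) ->
  (forall j k, ip P (D j) (D' k) = if j == k then v else u) ->
  ip P (wsum D) (wsum D') = (A2 - c)%:C * u + c%:C * v.
Proof.
move=> lD sD aD lD' sD' aD' aDD' eDD'.
have [lp pw] := wsum_L2 lD sD aD; have [lp' pw'] := wsum_L2 lD' sD' aD'.
have H := L2_to_ip lp lp' (cL2_wsum lD sD aD) (cL2_wsum lD' sD' aD') pw pw'.
have term j k : cint P (fun w => ((a j w)%:C * D j w) * ((a k w)%:C * D' k w)^*) /\
    Ec P (fun w => ((a j w)%:C * D j w) * ((a k w)%:C * D' k w)^*) =
    (aa j k)%:C * (if j == k then v else u).
  have iaD : indep P (fun w => (a j w * a k w)%:C : borelC R)
      (fun w => D j w * (D' k w)^* : borelC R).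
    apply: (indep_comp (h := fun z : R * R => (z.1 * z.2)%:C : borelC R) (k := idfun) _ _ (aDD' j k)).
      by apply/cmeasP; apply: cmeas_real; apply: measurable_funM; [exact: measurable_fst|exact: measurable_snd].
    exact: measurable_id.
  have ca : cint P (fun w => (a j w * a k w)%:C).
    by split; [exact: aa_integrable|exact: (finite_measure_integrable_cst _ 0)].
  have [] := Ec_indep iaD ca (cint_mulJ (lD j) (lD' k)).
  have e w : (a j w)%:C * D j w * ((a k w)%:C * D' k w)^* =
     (a j w * a k w)%:C * (D j w * (D' k w)^*).
    by apply: complex_ext; rewrite !(CreM, CimM, CreJ, CimJ) /=; ring.
  rewrite (_ : (fun w => (a j w)%:C * D j w * ((a k w)%:C * D' k w)^*) =
    (fun w => (a j w * a k w)%:C * (D j w * (D' k w)^*))); last exact/funext.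
  move=> h1 ->; split=> //; rewrite -eDD'; congr (_ * _).
  by rewrite /Ec/= Rintegral_cst// mul0r.
have e n : ip P (fun w => \sum_(0 <= j < n) (a j w)%:C * D j w)
       (fun w => \sum_(0 <= k < n) (a k w)%:C * D' k w) =
    (\sum_(0 <= j < n) \sum_(0 <= k < n) aa j k)%:C * u +
    (\sum_(0 <= j < n) aa j j)%:C * (v - u).
  rewrite /ip.
  have e1 w : (\sum_(0 <= j < n) (a j w)%:C * D j w) *
      (\sum_(0 <= k < n) (a k w)%:C * D' k w)^* =
      \sum_(0 <= j < n) \sum_(0 <= k < n) ((a j w)%:C * D j w) * ((a k w)%:C * D' k w)^*.
    rewrite mulr_suml; apply: eq_bigr => j _; rewrite rmorph_sum mulr_sumr.
    by apply: eq_bigr.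
  under eq_fun do rewrite e1.
  rewrite Ec_sum; last by move=> j; apply: cint_sum => k; exact: (term j k).1.
  rewrite !rmorph_sum !mulr_suml -big_split/= big_seq [RHS]big_seq; apply: eq_bigr => j.
  rewrite mem_index_iota/= => jn.
  rewrite Ec_sum; last by move=> k; exact: (term j k).1.
  rewrite rmorph_sum mulr_suml (bigD1_seq j)/= ?mem_index_iota ?iota_uniq//.
  rewrite [in RHS](bigD1_seq j)/= ?mem_index_iota ?iota_uniq// (term j j).2 eqxx.
  rewrite (eq_bigr (fun k => (aa j k)%:C * u)); last first.
    by move=> k kj; rewrite (term j k).2 eq_sym (negbTE kj).
  by ring.
have H' : (fun n => (\sum_(0 <= j < n) \sum_(0 <= k < n) aa j k)%:C * u +
    (\sum_(0 <= j < n) aa j j)%:C * (v - u) : R[i]^o) @ \oo -->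
    (A2%:C * u + c%:C * (v - u) : R[i]^o).
  by apply: cvgD; [exact: cvg_realC_mul cvg_aa|exact: cvg_realC_mul cvg_diag].
by rewrite (cvg_complex_unique e H H') rmorphB/=; ring.
Qed.

End weighted_sums.

(** * Branching sums on canonical trees *)

(** Nonnegativity is required everywhere, rather than almost surely; it will be
    obtained by taking absolute values. *)
Definition good_weights (R : realType) d (T : measurableType d)
    (Q : probability T R) (A : T -> nat -> R) (A2 c : R) :=
  [/\ forall j, measurable_fun setT (A ^~ j), forall t j, 0 <= A t j,
      (\int[Q]_t \sum_(0 <= j <oo) (A t j)%:E = 1)%E,
      (\int[Q]_t ((\sum_(0 <= j <oo) (A t j)%:E) ^+ 2) = A2%:E)%E &
      (\int[Q]_t \sum_(0 <= j <oo) (A t j ^+ 2)%:E = c%:E)%E].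

Lemma good_weights_law (R : realType) d d' (T : measurableType d)
    (T' : measurableType d') (P : probability T' R) (Q : probability T R)
    (f : T' -> T) (A : T -> nat -> R) (A2 c : R) :
  measurable_fun setT f -> has_law P f Q ->
  good_weights Q A A2 c <->
  ((forall j, measurable_fun setT (A ^~ j)) /\ (forall t j, 0 <= A t j)) /\
  good_weights P (fun t => A (f t)) A2 c.
Proof.
move=> mf Pf.
have tr (mA : forall j, measurable_fun setT (A ^~ j)) (A0 : forall t j, 0 <= A t j) :
  [/\ (\int[Q]_t \sum_(0 <= j <oo) (A t j)%:E =
       \int[P]_t \sum_(0 <= j <oo) (A (f t) j)%:E)%E,
      (\int[Q]_t ((\sum_(0 <= j <oo) (A t j)%:E) ^+ 2) =
       \int[P]_t ((\sum_(0 <= j <oo) (A (f t) j)%:E) ^+ 2))%E &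
      (\int[Q]_t \sum_(0 <= j <oo) (A t j ^+ 2)%:E =
       \int[P]_t \sum_(0 <= j <oo) (A (f t) j ^+ 2)%:E)%E].
  have A0' j t : 0 <= A t j by exact: A0.
  split.
  - apply: (has_law_ge0_integral mf Pf (measurable_nneseries mA A0')) => t.
    by apply: nneseries_ge0 => j _ _; rewrite lee_fin.
  - apply: (has_law_ge0_integral mf Pf (measurable_nneseries_sqr mA A0')) => t.
    exact: sqre_ge0.
  - apply: (has_law_ge0_integral mf Pf (measurable_nneseries (g := fun j t => A t j ^+ 2) _ _)) => [j|j t|t].
    + by apply: measurable_funX; exact: mA.
    + exact: sqr_ge0.
    + by apply: nneseries_ge0 => j _ _; rewrite lee_fin sqr_ge0.
split=> [[mA A0 e1 e2 e3]|[[mA A0] [_ _ e1 e2 e3]]].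
  have [h1 h2 h3] := tr mA A0.
  split=> //; split=> //; rewrite -?h1 -?h2 -?h3//.
  by move=> j; exact: (measurableT_comp (mA j) mf).
by have [h1 h2 h3] := tr mA A0; split=> //; rewrite ?h1 ?h2 ?h3.
Qed.

Section branching.
Context (R : realType) d (S : measurableType d) (I : countType)
  (p : I -> probability S R) (k0 : I) (A : S -> nat -> R) (A2 c : R)
  (gA : good_weights (p k0) A A2 c).
Notation X := (famT S I).
Notation Pi := (fam_prod p).

Let a j (x : X) := A (x k0) j.

Let gPi : good_weights Pi (fun x : X => A (x k0)) A2 c.
Proof.
by have [] := (good_weights_law A A2 c (@measurable_coord _ S I k0) (fam_prod_coord p k0)).1 gA.
Qed.

Let ma j : measurable_fun setT (a j).
Proof. by case: gPi => H _ _ _ _; exact: H. Qed.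
Let a0 j w : 0 <= a j w.
Proof. by case: gPi => _ H _ _ _; exact: H. Qed.

Definition bsum (D : nat -> X -> R[i]) : X -> R[i] :=
  fun x => Csum (fun j => (A (x k0) j)%:C * D j x).

Let depends_a j k : depends_on [set k0] (fun x => (a j x, a k x)).
Proof. by move=> x y xy; rewrite /a (xy k0). Qed.

Let maa j k : measurable_fun setT (fun x => (a j x, a k x)).
Proof. exact: measurable_fun_pair. Qed.

Section one.
Context (D : nat -> X -> R[i]) (J : nat -> set I) (s : R).
Hypotheses (lD : forall j, cL2 Pi (D j)) (sD : forall j, sqm Pi (D j) = s%:E)
  (dD : forall j, depends_on (J j) (D j)) (Jk0 : forall j, ~ J j k0).

Let aD j k : indep Pi (fun w => (a j w, a k w)) (D k : X -> borelC R).
Proof.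
move=> B C mB mC; apply: (fam_prod_indep p (J := [set k0]) (K := J k)) => //.
- by apply/cmeasP; exact: (lD k).1.
- by rewrite -subset0 => i [/= ->]; exact: Jk0.
Qed.

Lemma bsum_summable :
  {ae Pi, forall x, (\sum_(0 <= j <oo) (cabs ((A (x k0) j)%:C * D j x))%:E < +oo)%E}.
Proof. by case: gPi => _ _ h1 h2 h3; exact: (wsum_summable ma a0 h2 lD sD aD). Qed.

Lemma cL2_bsum : cL2 Pi (bsum D).
Proof. by case: gPi => _ _ h1 h2 h3; exact: (cL2_wsum ma a0 h2 lD sD aD). Qed.

Lemma Ec_bsum m : (forall j, Ec Pi (D j) = m) -> Ec Pi (bsum D) = m.
Proof. by case: gPi => _ _ h1 h2 h3; exact: (Ec_wsum ma a0 h1 h2 lD sD aD). Qed.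

End one.

Lemma ip_bsum (D D' : nat -> X -> R[i]) (J : nat -> set I) (s s' : R)
    (m m' v : R[i]) :
  (forall j, cL2 Pi (D j)) -> (forall j, sqm Pi (D j) = s%:E) ->
  (forall j, depends_on (J j) (D j)) ->
  (forall j, cL2 Pi (D' j)) -> (forall j, sqm Pi (D' j) = s'%:E) ->
  (forall j, depends_on (J j) (D' j)) ->
  (forall j, ~ J j k0) -> (forall j k, j != k -> J j `&` J k = set0) ->
  (forall j, Ec Pi (D j) = m) -> (forall j, Ec Pi (D' j) = m') ->
  (forall j, ip Pi (D j) (D' j) = v) ->
  ip Pi (bsum D) (bsum D') = (A2 - c)%:C * (m * m'^*) + c%:C * v.
Proof.
move=> lD sD dD lD' sD' dD' Jk0 trivJ mD mD' vD.
have aD (E : nat -> X -> R[i]) : (forall j, cL2 Pi (E j)) ->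
    (forall j, depends_on (J j) (E j)) -> forall j k,
    indep Pi (fun w => (a j w, a k w)) (E k : X -> borelC R).
  move=> lE dE j k B C mB mC; apply: (fam_prod_indep p (J := [set k0]) (K := J k)) => //.
  - by apply/cmeasP; exact: (lE k).1.
  - by rewrite -subset0 => i [/= ->]; exact: Jk0.
case: gPi => _ _ h1 h2 h3.
apply: (ip_wsum ma a0 h2 h3 lD sD (aD _ lD dD) lD' sD' (aD _ lD' dD')) => j k.
- move=> B C mB mC; apply: (fam_prod_indep p (J := [set k0]) (K := J j `|` J k)) => //.
  + by apply/cmeasP; apply: cmeasM; [exact: (lD j).1|apply: cmeasJ; exact: (lD' k).1].
  + by move=> x y xy; rewrite (dD j x y)// ?(dD' k x y)// => i Ji; apply: xy; [right|left].
  + by rewrite -subset0 => i [/= -> []]; exact: Jk0.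
- case: eqP => [<-//|/eqP jk].
  have cJ : cint Pi (fun x => (D' k x)^*).
    have := cint_mulJ (cL2_cst Pi 1) (lD' k).
    by rewrite (_ : (fun w => _) = (fun x => (D' k x)^*))//; apply/funext => w; rewrite mul1r.
  have iDD : indep Pi (D j : X -> borelC R) (fun x => (D' k x)^* : borelC R).
    move=> B C mB mC; apply: (fam_prod_indep p (J := J j) (K := J k)) => //.
    + by apply/cmeasP; exact: (lD j).1.
    + by apply/cmeasP; apply: cmeasJ; exact: (lD' k).1.
    + by move=> x y xy; rewrite (dD' k x y).
    + exact: trivJ.
  rewrite /ip (Ec_indep iDD (cL2_cint (lD j)) cJ).2 mD EcJ ?mD'//.
  exact: cL2_cint.
Qed.

Context (tau sigma : nat -> I -> I) (JF JG : set I).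
Hypotheses (tau_inj : forall j, injective (tau j))
  (sigma_inj : forall j, injective (sigma j))
  (p_tau : forall j i, p (tau j i) = p i)
  (p_sigma : forall j i, p (sigma j i) = p i)
  (root_out : forall j i, tau j i <> k0 /\ sigma j i <> k0)
  (FG_disj : forall j i i', JF i -> JG i' -> tau j i <> sigma j i')
  (jk_disj : forall j k i i', j <> k -> [/\ tau j i <> tau k i',
     tau j i <> sigma k i' & sigma j i <> sigma k i']).

(** The child [j] of the root contributes the product of [F] on the shifted
    tree [tau j] and of [G] on the shifted tree [sigma j]. One step of the
    smoothing sums and one step of the quadratic recursion are of this form. *)
Definition bb (F G : X -> R[i]) : X -> R[i] :=
  bsum (fun j x => F (x \o tau j) * G (x \o sigma j)).

Let JFG j := (tau j @` JF) `|` (sigma j @` JG).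

Let JFG_root j : ~ JFG j k0.
Proof. by move=> [[i _]|[i _]]; have [] := root_out j i. Qed.

Let JFG_triv j k : j != k -> JFG j `&` JFG k = set0.
Proof.
move=> /eqP jk; rewrite -subset0 => i [[[u _ <-]|[u _ <-]] [[v _]|[v _]]] e.
- by have [/(_ (esym e))] := jk_disj u v jk.
- by have [_ /(_ (esym e))] := jk_disj u v jk.
- by have [_ /(_ e)] := jk_disj v u (nesym jk).
- by have [_ _ /(_ (esym e))] := jk_disj u v jk.
Qed.

Let m_re (t : I -> I) : measurable_fun setT (fun x : X => (x \o t : X)).
Proof. by apply: measurable_fam => i; exact: measurable_coord. Qed.

Let law_re (t : I -> I) : injective t -> (forall i, p (t i) = p i) ->
  has_law Pi (fun x : X => (x \o t : X)) Pi.
Proof. by move=> ti pt; apply: fam_prod_reindex => // i; rewrite pt. Qed.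

Lemma sqm_re (t : I -> I) (F : X -> R[i]) : injective t -> (forall i, p (t i) = p i) ->
  cmeas F -> sqm Pi (fun x : X => F (x \o t)) = sqm Pi F.
Proof. by move=> ti pt; exact: sqm_law (m_re t) (law_re ti pt) _. Qed.

Lemma cL2_re (t : I -> I) (F : X -> R[i]) : injective t -> (forall i, p (t i) = p i) ->
  cL2 Pi F -> cL2 Pi (fun x : X => F (x \o t)).
Proof. by move=> ti pt; exact: cL2_law (m_re t) (law_re ti pt) _. Qed.

Lemma Ec_re (t : I -> I) (F : X -> R[i]) : injective t -> (forall i, p (t i) = p i) ->
  cmeas F -> Ec Pi (fun x : X => F (x \o t)) = Ec Pi F.
Proof. by move=> ti pt; exact: Ec_law (m_re t) (law_re ti pt) _. Qed.

Section factors.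
Context (F G : X -> R[i]).
Hypotheses (lF : cL2 Pi F) (lG : cL2 Pi G)
  (dF : depends_on JF F) (dG : depends_on JG G).

Let D j (x : X) := F (x \o tau j) * G (x \o sigma j).

Let lFj j := cL2_re (@tau_inj j) (@p_tau j) lF.
Let lGj j := cL2_re (@sigma_inj j) (@p_sigma j) lG.

Let dFj j : depends_on (tau j @` JF) (fun x : X => F (x \o tau j)).
Proof. by move=> x y xy; apply: dF => i Ji; apply: xy; exists i. Qed.
Let dGj j : depends_on (sigma j @` JG) (fun x : X => G (x \o sigma j)).
Proof. by move=> x y xy; apply: dG => i Ji; apply: xy; exists i. Qed.

Let disjFG j : (tau j @` JF) `&` (sigma j @` JG) = set0.
Proof.
by rewrite -subset0 => i [[u Ju <-] [v Jv /esym]]; exact: FG_disj.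
Qed.

Let iFG j : indep Pi (fun x : X => F (x \o tau j) : borelC R)
                     (fun x : X => G (x \o sigma j) : borelC R).
Proof.
move=> B C mB mC; apply: (fam_prod_indep p (J := tau j @` JF) (K := sigma j @` JG)) => //.
- by apply/cmeasP; exact: (lFj j).1.
- by apply/cmeasP; exact: (lGj j).1.
Qed.

Lemma cmeas_factors j : cmeas (D j).
Proof. by apply: cmeasM; [exact: (lFj j).1|exact: (lGj j).1]. Qed.

Lemma sqm_factors j : sqm Pi (D j) = (sqm Pi F * sqm Pi G)%E.
Proof.
rewrite /sqm (eq_integral (fun x : X => (cabs (F (x \o tau j)) ^+ 2)%:E *
    (cabs (G (x \o sigma j)) ^+ 2)%:E)%E); last first.
  by move=> x _; rewrite /D cabsM exprMn EFinM.
have mid : cmeas (fun z : borelC R => z : R[i]).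
  by apply/cmeasP; exact: measurable_id.
have mF : measurable_fun setT (fun x : X => F (x \o tau j) : borelC R).
  by apply/cmeasP; exact: (lFj j).1.
have mG : measurable_fun setT (fun x : X => G (x \o sigma j) : borelC R).
  by apply/cmeasP; exact: (lGj j).1.
rewrite (indep_ge0_integral mF mG (iFG j) (measurable_sqr_cabs mid) (measurable_sqr_cabs mid)).
- congr (_ * _)%E.
    exact: (sqm_re (@tau_inj j) (@p_tau j) lF.1).
  exact: (sqm_re (@sigma_inj j) (@p_sigma j) lG.1).
- by move=> z; rewrite lee_fin sqr_ge0.
- by move=> z; rewrite lee_fin sqr_ge0.
Qed.

Lemma cL2_factors j : cL2 Pi (D j).
Proof.
split; first exact: cmeas_factors.
by rewrite sqm_factors lte_mul_pinfty ?sqm_ge0 ?sqm_fin//; case: lG.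
Qed.

Lemma Ec_factors j : Ec Pi (D j) = Ec Pi F * Ec Pi G.
Proof.
rewrite /D (Ec_indep (iFG j) (cL2_cint (lFj j)) (cL2_cint (lGj j))).2.
by rewrite (Ec_re (@tau_inj j) (@p_tau j) lF.1) (Ec_re (@sigma_inj j) (@p_sigma j) lG.1).
Qed.

Lemma depends_factors j : depends_on (JFG j) (D j).
Proof.
by move=> x y xy; congr (_ * _); [apply: dFj|apply: dGj] => i Ji; apply: xy; [left|right].
Qed.

Let sD j : sqm Pi (D j) = (fine (sqm Pi F) * fine (sqm Pi G))%:E.
Proof. by rewrite sqm_factors EFinM !fineK//; exact: sqm_fin. Qed.

Lemma bb_summable : {ae Pi, forall x : X, (\sum_(0 <= j <oo)
  (cabs ((A (x k0) j)%:C * (F (x \o tau j) * G (x \o sigma j))))%:E < +oo)%E}.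
Proof. exact: (bsum_summable cL2_factors sD depends_factors JFG_root). Qed.

Lemma cL2_bb : cL2 Pi (bb F G).
Proof. exact: (cL2_bsum cL2_factors sD depends_factors JFG_root). Qed.

Lemma Ec_bb : Ec Pi (bb F G) = Ec Pi F * Ec Pi G.
Proof. exact: (Ec_bsum cL2_factors sD depends_factors JFG_root Ec_factors). Qed.

End factors.

(** The factors at distinct children are independent, and so are both factors
    at one child: [ip_wsum] applies with these products as off-diagonal and
    diagonal terms. *)
Lemma ip_bb (F G F' G' : X -> R[i]) :
  cL2 Pi F -> cL2 Pi G -> depends_on JF F -> depends_on JG G ->
  cL2 Pi F' -> cL2 Pi G' -> depends_on JF F' -> depends_on JG G' ->
  ip Pi (bb F G) (bb F' G') =
  (A2 - c)%:C * (Ec Pi F * Ec Pi G * (Ec Pi F' * Ec Pi G')^*) +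
  c%:C * (ip Pi F F' * ip Pi G G').
Proof.
move=> lF lG dF dG lF' lG' dF' dG'.
have sD j : sqm Pi (fun x : X => F (x \o tau j) * G (x \o sigma j)) =
    (fine (sqm Pi F) * fine (sqm Pi G))%:E.
  by rewrite sqm_factors// EFinM !fineK//; exact: sqm_fin.
have sD' j : sqm Pi (fun x : X => F' (x \o tau j) * G' (x \o sigma j)) =
    (fine (sqm Pi F') * fine (sqm Pi G'))%:E.
  by rewrite sqm_factors// EFinM !fineK//; exact: sqm_fin.
apply: (ip_bsum (J := JFG) (cL2_factors lF lG dF dG) sD (depends_factors dF dG)
  (cL2_factors lF' lG' dF' dG') sD' (depends_factors dF' dG') JFG_root JFG_triv
  (Ec_factors lF lG dF dG) (Ec_factors lF' lG' dF' dG')) => j.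
have lFj := cL2_re (@tau_inj j) (@p_tau j) lF.
have lFj' := cL2_re (@tau_inj j) (@p_tau j) lF'.
have lGj := cL2_re (@sigma_inj j) (@p_sigma j) lG.
have lGj' := cL2_re (@sigma_inj j) (@p_sigma j) lG'.
have cF := cint_mulJ lFj lFj'; have cG := cint_mulJ lGj lGj'.
have iFG : indep Pi (fun x : X => F (x \o tau j) * (F' (x \o tau j))^* : borelC R)
                    (fun x : X => G (x \o sigma j) * (G' (x \o sigma j))^* : borelC R).
  move=> B C mB mC; apply: (fam_prod_indep p (J := tau j @` JF) (K := sigma j @` JG)) => //.
  - by apply/cmeasP; exact: cint_cmeas cF.
  - by apply/cmeasP; exact: cint_cmeas cG.
  - move=> x y xy; have e : forall i, JF i -> (x \o tau j) i = (y \o tau j) i.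
      by move=> i Ji; apply: xy; exists i.
    by rewrite (dF _ _ e) (dF' _ _ e).
  - move=> x y xy; have e : forall i, JG i -> (x \o sigma j) i = (y \o sigma j) i.
      by move=> i Ji; apply: xy; exists i.
    by rewrite (dG _ _ e) (dG' _ _ e).
  - by rewrite -subset0 => i [[u Ju <-] [v Jv /esym]]; exact: FG_disj.
rewrite /ip (_ : (fun x => _) = (fun x : X => (F (x \o tau j) * (F' (x \o tau j))^*) *
    (G (x \o sigma j) * (G' (x \o sigma j))^*))); last first.
  by apply/funext => x; rewrite rmorphM/=; ring.
rewrite (Ec_indep iFG cF cG).2; congr (_ * _).
  rewrite -(Ec_re (@tau_inj j) (@p_tau j) (F := fun x => F x * (F' x)^*))//.
  by apply: cmeasM; [exact: lF.1|apply: cmeasJ; exact: lF'.1].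
rewrite -(Ec_re (@sigma_inj j) (@p_sigma j) (F := fun x => G x * (G' x)^*))//.
by apply: cmeasM; [exact: lG.1|apply: cmeasJ; exact: lG'.1].
Qed.

End branching.

(** * Almost sure convergence along blocks *)

Section cube_blocks.
Context (R : realType).

Lemma sum_inv_sqr (N : nat) : \sum_(0 <= k < N) (k.+1%:R ^+ 2)^-1 <= 2 :> R.
Proof.
suff H : \sum_(0 <= k < N.+1) (k.+1%:R ^+ 2)^-1 <= 2 - N.+1%:R^-1 :> R.
  apply: (@le_trans _ _ (\sum_(0 <= k < N.+1) (k.+1%:R ^+ 2)^-1)).
    by rewrite [leRHS]big_nat_recr//= lerDl invr_ge0 exprn_ge0.
  by apply: le_trans H _; rewrite lerBlDr lerDl invr_ge0.
elim: N => [|N IH]; first by rewrite big_nat1 expr1n invr1; lra.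
rewrite big_nat_recr//=; apply: le_trans (lerD IH (lexx _)) _.
set x : R := N.+1%:R; have x0 : 0 < x by rewrite ltr0n.
have -> : N.+2%:R = x + 1 :> R by rewrite -natr1.
have x10 : 0 < x + 1 by lra.
rewrite -addrA lerD2l -subr_ge0.
rewrite (_ : _ - _ = (x * (x + 1) ^+ 2)^-1); first by rewrite invr_ge0 mulr_ge0 ?exprn_ge0//; lra.
by field; rewrite !gt_eqF.
Qed.

(** Abel summation turns the weights (k+1)^2 into 2k+1, against which a
    sequence of order 1/k^3 is summable. *)
Lemma abel_cubes (E : nat -> R) (K : R) : (forall k, 0 <= E k) ->
  (forall k, (k ^ 3).+1%:R * E k <= K) -> forall N,
  \sum_(0 <= k < N) k.+1%:R ^+ 2 * (E k - E k.+1) <= 16 * K.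
Proof.
move=> E0 EK N.
have K0 : 0 <= K by apply: le_trans (EK 0%N); rewrite mulr_ge0.
have -> : \sum_(0 <= k < N) k.+1%:R ^+ 2 * (E k - E k.+1) =
    \sum_(0 <= k < N) (2 * k%:R + 1) * E k - N%:R ^+ 2 * E N.
  elim: N => [|N IH]; first by rewrite !big_geq// expr0n/= mul0r subr0.
  by rewrite !big_nat_recr//= IH -natr1; ring.
apply: (@le_trans _ _ (\sum_(0 <= k < N) 8 * K * (k.+1%:R ^+ 2)^-1)).
  rewrite lerBlDr ler_wpDr ?mulr_ge0 ?exprn_ge0//.
  apply: ler_sum => k _; rewrite ler_pdivlMr ?exprn_gt0//.
  have := EK k; rewrite -natr1 natrX -natr1; set x : R := k%:R => H.
  have x0 : 0 <= x by rewrite ler0n.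
  apply: (@le_trans _ _ (8 * ((x ^+ 3 + 1) * E k))); last by rewrite ler_wpM2l.
  rewrite mulrA mulrAC ler_wpM2r//.
  have h1 : 0 <= x * (x - 1) ^+ 2 by rewrite mulr_ge0 ?sqr_ge0.
  have h2 : 0 <= (x + 1) * (x - 1) ^+ 2 by rewrite mulr_ge0 ?sqr_ge0//; lra.
  have h3 : 0 <= x ^+ 3 by rewrite exprn_ge0.
  lra.
rewrite -mulr_sumr; have := sum_inv_sqr N; nra.
Qed.

Lemma cube_root_block (n : nat) : exists k, (k ^ 3 <= n < k.+1 ^ 3)%N.
Proof.
elim: n => [|n [k /andP[kn nk]]]; first by exists 0%N.
have [lt|ge] := ltnP n.+1 (k.+1 ^ 3); first by exists k; rewrite lt (leq_trans kn).
by exists k.+1; rewrite ge (leq_ltn_trans nk)// ltn_exp2r.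
Qed.

Lemma sqr_sum_le (u : nat -> R) (m n : nat) : (forall i, 0 <= u i) ->
  (\sum_(m <= i < n) u i) ^+ 2 <= (n - m)%:R * \sum_(m <= i < n) u i ^+ 2.
Proof.
move=> u0.
have -> : (\sum_(m <= i < n) u i) ^+ 2 =
    \sum_(m <= i < n) \sum_(m <= j < n) u i * u j.
  by rewrite expr2 mulr_suml; apply: eq_bigr => i _; rewrite mulr_sumr.
have -> : (n - m)%:R * \sum_(m <= i < n) u i ^+ 2 =
    \sum_(m <= i < n) \sum_(m <= j < n) (u i ^+ 2 + u j ^+ 2) / 2.
  set A := \sum_(m <= i < n) u i ^+ 2.
  have e i : \sum_(m <= j < n) (u i ^+ 2 + u j ^+ 2) / 2 =
      ((n - m)%:R * u i ^+ 2 + A) / 2.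
    by rewrite -mulr_suml big_split/= sumr_const_nat mulr_natl.
  rewrite (eq_bigr _ (fun i _ => e i)) -mulr_suml big_split/= sumr_const_nat.
  by rewrite -mulr_sumr -/A -[A *+ _]mulr_natl; field.
apply: ler_sum => i _; apply: ler_sum => j _.
have := sqr_ge0 (u i - u j); lra.
Qed.

Context d (Omega : measurableType d) (P : probability Omega R).

(** Along the cubes, the increments are absolutely summable, since
    2 |x| <= t x^2 + 1/t with t = (k+1)^2. Between two consecutive cubes there
    are at most 3 (k+1)^2 steps, so that the oscillation is controlled by the
    Cauchy-Schwarz inequality and the second bound on the increments. When
    [D k] is a difference of second moments of an L2 martingale, this needs a
    rate of convergence of these moments, and no maximal inequality. *)
Lemma ae_cvg_cubes (u : nat -> Omega -> R[i]) (D : nat -> R) (C : R) :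
  (forall n, cmeas (u n)) ->
  (forall k, sqm P (fun w => u (k.+1 ^ 3)%N w - u (k ^ 3)%N w)%R <= (D k)%:E)%E ->
  (forall k, \sum_((k ^ 3)%N <= n < (k.+1 ^ 3)%N)
     sqm P (fun w => u n.+1 w - u n w)%R <= (D k)%:E)%E ->
  (forall N, \sum_(0 <= k < N) k.+1%:R ^+ 2 * D k <= C) ->
  {ae P, forall w, (u ^~ w : nat -> R[i]^o) @ \oo --> (Clim (u ^~ w) : R[i]^o)}.
Proof.
move=> mu uD sumD DC.
have D0 k : 0 <= D k by rewrite -lee_fin; apply: le_trans (uD k); exact: sqm_ge0.
pose V k w := cabs (u (k.+1 ^ 3)%N w - u (k ^ 3)%N w).
have mV k : measurable_fun setT (V k).
  by apply: measurable_cabs; exact: cmeasB.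
pose S k w := 3 * k.+1%:R ^+ 2 * \sum_((k ^ 3)%N <= n < (k.+1 ^ 3)%N) cabs (u n.+1 w - u n w) ^+ 2.
have mincr n : measurable_fun setT (fun w => cabs (u n.+1 w - u n w) ^+ 2).
  by apply: measurable_funX; apply: measurable_cabs; exact: cmeasB.
have mS k : measurable_fun setT (S k).
  by apply: measurable_funM => //; exact: measurable_sum.
have S0 k w : 0 <= S k w.
  by rewrite /S mulr_ge0 ?mulr_ge0 ?exprn_ge0// sumr_ge0// => n _; exact: sqr_ge0.
have cS : {ae P, forall w, (\sum_(0 <= k <oo) (S k w)%:E < +oo)%E}.
  apply: ae_lty_nneseries => [k|k w|].
  - exact/measurable_EFinP.
  - by rewrite lee_fin.
  - apply: (@le_lt_trans _ _ (3 * C)%:E); last exact: ltry.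
    apply: lime_le.
      by apply: is_cvg_nneseries => k _ _; apply: integral_ge0 => w _; rewrite lee_fin.
    apply: nearW => N.
    apply: (@le_trans _ _ (\sum_(0 <= k < N) (3 * (k.+1%:R ^+ 2 * D k))%:E)%E); last first.
      by rewrite sumEFin lee_fin -mulr_sumr ler_wpM2l.
    apply: lee_sum => k _; rewrite /S.
    under eq_integral do rewrite EFinM.
    rewrite ge0_integralZl_EFin//; last 2 first.
    + by move=> w _; rewrite lee_fin sumr_ge0// => n _; exact: sqr_ge0.
    + by apply/measurable_EFinP; exact: measurable_sum.
    rewrite mulrA [X in (_ <= X)%E]EFinM; apply: lee_wpmul2l; first by rewrite lee_fin mulr_ge0// exprn_ge0.
    apply: le_trans (sumD k); under eq_integral do rewrite -sumEFin.
    rewrite ge0_integral_sum//.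
    + by move=> n; exact/measurable_EFinP.
    + by move=> n w _; rewrite lee_fin sqr_ge0.
have cV : {ae P, forall w, (\sum_(0 <= k <oo) (V k w)%:E < +oo)%E}.
  apply: ae_lty_nneseries => [k|k w|].
  - exact/measurable_EFinP.
  - by rewrite lee_fin cabs_ge0.
  - apply: (@le_lt_trans _ _ (C + 2)%:E); last exact: ltry.
    apply: lime_le.
      by apply: is_cvg_nneseries => k _ _; apply: integral_ge0 => w _; rewrite lee_fin cabs_ge0.
    apply: nearW => N.
    apply: (@le_trans _ _ (\sum_(0 <= k < N) (k.+1%:R ^+ 2 * D k + (k.+1%:R ^+ 2)^-1)%:E)%E); last first.
      by rewrite sumEFin lee_fin big_split/= lerD// sum_inv_sqr.
    apply: lee_sum => k _.
    set t : R := k.+1%:R ^+ 2; have t0 : 0 < t by rewrite exprn_gt0.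
    apply: (@le_trans _ _ (\int[P]_w (t%:E * (V k w ^+ 2)%:E + cst (t^-1)%:E w))%E).
      apply: ge0_le_integral => //.
      + by move=> w _; rewrite lee_fin cabs_ge0.
      + exact/measurable_EFinP.
      + apply: emeasurable_funD => //; apply: measurable_funeM.
        by apply/measurable_EFinP; exact: measurable_funX.
      + move=> w _; rewrite /cst/= -EFinM -EFinD lee_fin.
        have h : 0 <= t^-1 * (t * V k w - 1) ^+ 2 by rewrite mulr_ge0 ?sqr_ge0// invr_ge0 ltW.
        have V0 : 0 <= V k w by exact: cabs_ge0.
        have tt : t^-1 * t = 1 by rewrite mulVf// gt_eqF.
        have : t^-1 * (t * V k w - 1) ^+ 2 =
           (t^-1 * t) * t * V k w ^+ 2 - (t^-1 * t) * 2 * V k w + t^-1 by ring.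
        by rewrite tt => e; rewrite e in h; lra.
    rewrite ge0_integralD//; last 3 first.
    + by move=> w _; rewrite -EFinM lee_fin mulr_ge0 ?sqr_ge0// ltW.
    + by apply: measurable_funeM; apply/measurable_EFinP; exact: measurable_funX.
    + by move=> w _; rewrite /cst/= lee_fin invr_ge0 ltW.
    rewrite integral_cst//= probability_setT mule1 EFinD leeD2r//.
    rewrite ge0_integralZl_EFin//; last 3 first.
    + by move=> w _; rewrite lee_fin sqr_ge0.
    + by apply/measurable_EFinP; exact: measurable_funX.
    + exact: ltW.
    by rewrite [X in (_ <= X)%E]EFinM; apply: lee_wpmul2l; [rewrite lee_fin ltW|exact: uD].
apply: filterS2 cS cV => w Sw Vw.
suff [l ul] : exists l : R[i], (u ^~ w : nat -> R[i]^o) @ \oo --> (l : R[i]^o).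
  by rewrite (Clim_cvg ul).
have vc := @cvg_Clim_increments R (fun k => u (k ^ 3)%N w) Vw.
set l := Clim _ in vc; exists l.
apply/cvg_cabs_sub0/cvgrPdist_lt => e e0.
have e20 : 0 < e / 2 by rewrite divr_gt0.
have e220 : 0 < (e / 2) ^+ 2 by rewrite exprn_gt0.
have S_to0 : S ^~ w @ \oo --> (0 : R).
  have le k : `|S k w| <= S k w by rewrite ger0_norm.
  have := real_series_cvg le Sw.
  exact: cvg_series_cvg_0.
move/cvg_cabs_sub0 : vc => /cvgrPdist_lt /(_ _ e20) [k1 _ H1].
move/cvgrPdist_lt : S_to0 => /(_ _ e220) [k2 _ H2].
pose k0 := maxn k1 k2; exists (k0 ^ 3)%N => // n /= k0n.
have [k /andP[kn nk]] := cube_root_block n.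
have k0k : (k0 <= k)%N.
  by have := leq_ltn_trans k0n nk; rewrite ltn_exp2r.
have := H1 k (leq_trans (leq_maxl _ _) k0k); rewrite !sub0r !normrN ger0_norm ?cabs_ge0// => h1.
have := H2 k (leq_trans (leq_maxr _ _) k0k); rewrite /= sub0r normrN ger0_norm// => h2.
rewrite ger0_norm ?cabs_ge0//.
have h3 : cabs (u n w - u (k ^ 3)%N w) < e / 2.
  rewrite -ltr_sqr ?nnegrE ?cabs_ge0 ?(ltW e20)//; apply: le_lt_trans h2.
  rewrite -(telescope_sumr (u ^~ w) kn).
  apply: (@le_trans _ _ ((\sum_((k ^ 3)%N <= i < n) cabs (u i.+1 w - u i w)) ^+ 2)).
    rewrite ler_sqr ?nnegrE ?cabs_ge0 ?sumr_ge0//; first exact: cabs_sum.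
    by move=> i _; exact: cabs_ge0.
  apply: le_trans (@sqr_sum_le (fun i => cabs (u i.+1 w - u i w)) _ _ _) _.
    by move=> i; exact: cabs_ge0.
  rewrite /S; apply: ler_pM => //.
  - by apply: sumr_ge0 => i _; exact: sqr_ge0.
  - rewrite -natrX -natrM ler_nat.
    apply: (@leq_trans (k.+1 ^ 3 - k ^ 3)%N); first by apply: leq_sub2r; exact: ltnW.
    by rewrite -!mulnn !expnS !expn0; lia.
  - rewrite [leRHS](big_cat_nat kn (ltnW nk))/= lerDl.
    by apply: sumr_ge0 => i _; exact: sqr_ge0.
rewrite (_ : u n w - l = (u n w - u (k ^ 3)%N w) + (u (k ^ 3)%N w - l)); last by ring.
by apply: le_lt_trans (cabsD _ _) _; rewrite (splitr e); apply: ltrD.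
Qed.

End cube_blocks.

(** * The quadratic recursion *)

Section second_moments.
Context (R : realType) (alpha beta : R).
Hypotheses (alpha1 : 1 <= alpha) (ab : alpha <= beta).

(** The second moment of the n-th term of the martingale defining [M]; the
    fixed points of the recursion are [alpha] and [beta]. *)
Fixpoint zeta (n : nat) : R :=
  if n is n'.+1 then (alpha * beta + zeta n' ^+ 2) / (alpha + beta) else 1.

Let K := alpha + beta.
Let K0 : 0 < K. Proof. by rewrite /K; move: alpha1 ab => h1 h2; lra. Qed.

Lemma zeta_bounds n : 1 <= zeta n <= alpha.
Proof.
elim: n => [|n /andP[h1 h2]] /=; first by rewrite lexx.
rewrite ler_pdivlMr// ler_pdivrMr// -/K /K; apply/andP; split; move: alpha1 ab => h3 h4; nra.
Qed.

(** When [alpha = beta] the recursion is tangent to the diagonal at [alpha];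
    in all cases the gap e satisfies e' <= e - e^2 / K. *)
Lemma zeta_gap n : n.+1%:R * (alpha - zeta n) <= K.
Proof.
have KV : K * K^-1 = 1 by rewrite divff// gt_eqF.
elim: n => [|n IH].
  by rewrite mul1r /= /K; move: alpha1 ab => h1 h2; lra.
have /andP[z1 z2] := zeta_bounds n.
set e := alpha - zeta n in IH *.
have e0 : 0 <= e by rewrite subr_ge0.
have step : alpha - zeta n.+1 <= e - e ^+ 2 / K.
  rewrite (_ : _ - zeta n.+1 = e * (2 * alpha - e) / K); last first.
    by rewrite /e/= /K; field; rewrite gt_eqF.
  rewrite (_ : e - _ = e * (K - e) / K); last by field; rewrite gt_eqF.
  rewrite ler_pM2r ?invr_gt0// ler_wpM2l// lerD2r /K; move: ab => h; lra.
apply: (@le_trans _ _ (n.+2%:R * (e - e ^+ 2 / K))); first by rewrite ler_wpM2l.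
pose y := e / K; have -> : e = y * K by rewrite /y divfK// gt_eqF.
have -> : y * K - (y * K) ^+ 2 / K = (y - y ^+ 2) * K by field; rewrite gt_eqF.
rewrite mulrA ler_piMl ?(ltW K0)// -natr1.
have y0 : 0 <= y by rewrite divr_ge0// ltW.
have : n.+1%:R * y <= 1 by rewrite /y mulrA ler_pdivrMr// mul1r.
set x : R := n.+1%:R => xy.
have y1 : y <= 1.
  apply: le_trans xy; rewrite ler_peMl// /x ler1n//.
have : 0 <= (1 - x * y) * (1 - y) by rewrite mulr_ge0// subr_ge0.
have : 0 <= y ^+ 2 by exact: sqr_ge0.
lra.
Qed.

Lemma cvg_zeta : zeta @ \oo --> alpha.
Proof.
apply/cvgrPdist_le => e e0; near=> n.
have /andP[_ z2] := zeta_bounds n.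
rewrite ger0_norm ?subr_ge0//.
have H := zeta_gap n; rewrite mulrC -ler_pdivlMr// in H.
apply: le_trans H _; rewrite ler_pdivrMr// mulrC -ler_pdivrMr//.
by rewrite -natr1 ler_wpDr//; near: n; exact: nbhs_infty_ger.
Unshelve. all: by end_near. Qed.

End second_moments.

(** A node (u, m) of the tree is encoded by the list of the pairs formed by a
    letter of [u] and the bit of [m] at the same place; then the subtrees at
    the children of the root are obtained by adding a pair in front. *)
Section mtree.
Context (R : realType) d (S : measurableType d) (q : probability S R)
  (A : S -> nat -> R) (alpha beta : R).
Hypotheses (alpha1 : 1 <= alpha) (ab : alpha <= beta)
  (gA : good_weights q A ((alpha * beta + 1) / (alpha + beta)) (alpha + beta)^-1).

Notation mwordT := (seq (nat * bool)%type).
Notation X := (famT S mwordT).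
Notation Pi := (fam_prod (fun _ : mwordT => q)).

Definition mchild (b : bool) (j : nat) (u : mwordT) : mwordT := (j, b) :: u.

Let tau := mchild false.
Let sigma := mchild true.

Definition mbb : (X -> R[i]) -> (X -> R[i]) -> X -> R[i] :=
  bb ([::] : mwordT) A tau sigma.

Let K0 : 0 < alpha + beta. Proof. by move: alpha1 ab => h1 h2; lra. Qed.

Let tau_inj j : injective (tau j). Proof. by move=> u v []. Qed.
Let sigma_inj j : injective (sigma j). Proof. by move=> u v []. Qed.
Let root_out j (u : mwordT) : tau j u <> [::] /\ sigma j u <> [::].
Proof. by []. Qed.
Let FG_disj j (u v : mwordT) : [set: mwordT] u -> [set: mwordT] v -> tau j u <> sigma j v.
Proof. by []. Qed.
Let jk_disj j k (u v : mwordT) : j <> k -> [/\ tau j u <> tau k v,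
  tau j u <> sigma k v & sigma j u <> sigma k v].
Proof. by move=> jk; split=> -[]. Qed.

Let depT (F : X -> R[i]) : depends_on [set: mwordT] F.
Proof. by move=> x y xy; congr F; apply/funext => u; exact: xy. Qed.

Lemma mbb_summable F G : cL2 Pi F -> cL2 Pi G ->
  {ae Pi, forall x : X, (\sum_(0 <= j <oo) (cabs ((A (x [::]) j)%:C *
    (F (x \o mchild false j) * G (x \o mchild true j))))%:E < +oo)%E}.
Proof.
move=> lF lG; exact: (bb_summable gA tau_inj sigma_inj (fun _ _ => erefl)
  (fun _ _ => erefl) root_out FG_disj lF lG (depT F) (depT G)).
Qed.

Lemma cL2_mbb F G : cL2 Pi F -> cL2 Pi G -> cL2 Pi (mbb F G).
Proof.
move=> lF lG; exact: (cL2_bb gA tau_inj sigma_inj (fun _ _ => erefl)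
  (fun _ _ => erefl) root_out FG_disj lF lG (depT F) (depT G)).
Qed.

Lemma Ec_mbb F G : cL2 Pi F -> cL2 Pi G -> Ec Pi (mbb F G) = Ec Pi F * Ec Pi G.
Proof.
move=> lF lG; exact: (Ec_bb gA tau_inj sigma_inj (fun _ _ => erefl)
  (fun _ _ => erefl) root_out FG_disj lF lG (depT F) (depT G)).
Qed.

Lemma ip_mbb F G F' G' : cL2 Pi F -> cL2 Pi G -> cL2 Pi F' -> cL2 Pi G' ->
  Ec Pi F = 1 -> Ec Pi G = 1 -> Ec Pi F' = 1 -> Ec Pi G' = 1 ->
  ip Pi (mbb F G) (mbb F' G') =
  ((alpha + beta)^-1)%:C * ((alpha * beta)%:C + ip Pi F F' * ip Pi G G').
Proof.
move=> lF lG lF' lG' mF mG mF' mG'.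
have := ip_bb gA tau_inj sigma_inj (fun _ _ => erefl)
  (fun _ _ => erefl) root_out FG_disj jk_disj lF lG (depT F) (depT G)
  lF' lG' (depT F') (depT G').
rewrite -/tau -/sigma -/(mbb F G) -/(mbb F' G') => ->.
have e1 : (1 * 1) * (1 * 1)^* = 1 :> R[i] by rewrite !mul1r; exact: conjc1.
rewrite mF mG mF' mG' e1 mulr1 mulrDr; congr (_ + _).
rewrite -rmorphM; congr (_%:C); by field; rewrite gt_eqF.
Qed.

Fixpoint zt (n : nat) : X -> R[i] :=
  if n is n'.+1 then mbb (zt n') (zt n') else fun=> 1.

Lemma cL2_zt n : cL2 Pi (zt n).
Proof. by elim: n => [|n IH]; [exact: cL2_cst|exact: cL2_mbb]. Qed.

Lemma Ec_zt n : Ec Pi (zt n) = 1.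
Proof.
elim: n => [|n IH]; first exact: Ec_cst.
by rewrite /= Ec_mbb ?IH ?mulr1//; exact: cL2_zt.
Qed.

(** The martingale property, in the form in which it is preserved by [ip_mbb]. *)
Lemma ip_zt_ge m n : ip Pi (zt (m + n)) (zt n) = (zeta alpha beta n)%:C.
Proof.
elim: n => [|n IH]; first by rewrite addn0 ip1 Ec_zt.
rewrite addnS /= ip_mbb ?Ec_zt//; try exact: cL2_zt.
by rewrite IH -rmorphM -rmorphD -rmorphM; congr (_%:C); rewrite mulrC expr2.
Qed.

Lemma ip_zt m n : (n <= m)%N -> ip Pi (zt m) (zt n) = (zeta alpha beta n)%:C.
Proof. by move=> /subnK <-; exact: ip_zt_ge. Qed.

Lemma sqm_ztB m n : (n <= m)%N ->
  sqm Pi (fun x => zt m x - zt n x) = (zeta alpha beta m - zeta alpha beta n)%:E.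
Proof.
move=> nm; rewrite sqmB; [|exact: cL2_zt..].
by rewrite !ip_zt//=; congr (_%:E); ring.
Qed.

Definition zlim : X -> R[i] := fun x => Clim (fun n => zt n x).

(** The blocks of [ae_cvg_cubes] fit, because the gap is of order 1/n. *)
Lemma zt_cvg : {ae Pi, forall x,
  (zt ^~ x : nat -> R[i]^o) @ \oo --> (zlim x : R[i]^o)}.
Proof.
pose E k := alpha - zeta alpha beta (k ^ 3)%N.
apply: (@ae_cvg_cubes _ _ _ _ zt (fun k => E k - E k.+1) (16 * (alpha + beta))).
- by move=> n; exact: (cL2_zt n).1.
- move=> k; rewrite sqm_ztB; last by rewrite leq_exp2r.
  by rewrite lee_fin /E; lra.
- move=> k; rewrite (eq_bigr (fun n => (zeta alpha beta n.+1 - zeta alpha beta n)%:E)).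
    by rewrite sumEFin telescope_sumr ?leq_exp2r// lee_fin /E; lra.
  by move=> n _; rewrite sqm_ztB.
- apply: abel_cubes => k; last exact: zeta_gap.
  by have /andP[_ h] := zeta_bounds alpha1 ab (k ^ 3)%N; rewrite subr_ge0.
Qed.

Lemma cmeas_zlim : cmeas zlim.
Proof. by apply: cmeas_Clim => n; exact: (cL2_zt n).1. Qed.

Lemma sqm_zlimB n :
  (sqm Pi (fun x => zlim x - zt n x)%R <= (alpha - zeta alpha beta n)%:E)%E.
Proof.
apply: (L2_fatou (f_ := zt)).
- by move=> k; exact: (cL2_zt k).1.
- exact: cmeas_zlim.
- exact: (cL2_zt n).1.
- exact: zt_cvg.
- exists n => // m /= nm; rewrite sqm_ztB// lee_fin lerD2r.
  by have /andP[] := zeta_bounds alpha1 ab m.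
Qed.

Lemma cL2_zlim : cL2 Pi zlim.
Proof.
have l0 : cL2 Pi (fun x => zlim x - zt 0 x).
  split; first by apply: cmeasB; [exact: cmeas_zlim|exact: cmeas_cst].
  by apply: le_lt_trans (sqm_zlimB 0) _; exact: ltry.
have := cL2D l0 (cL2_zt 0).
by rewrite (_ : (fun w => _) = zlim)//; apply/funext => x; rewrite subrK.
Qed.

Lemma zt_to_zlim : L2_to Pi zt zlim.
Proof.
have H : (fun n => (alpha - zeta alpha beta n)%:E) @ \oo --> (0 : R)%:E.
  apply/fine_cvgP; split; first exact: nearW.
  rewrite -[X in _ --> X](subrr alpha).
  by apply: cvgB; [exact: cvg_cst|exact: cvg_zeta].
rewrite /L2_to; under eq_fun do rewrite sqmBC.
apply: (squeeze_cvge _ (cvg_cst _) H).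
by apply: nearW => n; rewrite sqm_ge0 sqm_zlimB.
Qed.

Lemma Ec_zlim : Ec Pi zlim = 1.
Proof. exact: (L2_to_Ec cL2_zt cL2_zlim zt_to_zlim Ec_zt). Qed.

Lemma ip_zlim_zt n : ip Pi zlim (zt n) = (zeta alpha beta n)%:C.
Proof.
have H := L2_to_ip (fun k => cL2_zt (k + n)) (fun=> cL2_zt n) cL2_zlim (cL2_zt n) _ (L2_to_cst Pi (zt n)).
have cst_cvg (z : R[i]) : (fun _ : nat => z : R[i]^o) @ \oo --> (z : R[i]^o) by exact: cvg_cst.
apply: (cvg_complex_unique _ (H _) (cst_cvg _)) => [k|]; first exact: ip_zt_ge.
have := zt_to_zlim; rewrite /L2_to.
by rewrite -(cvg_shiftn n (fun k => sqm Pi (fun w => zt k w - zlim w))).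
Qed.

Lemma ip_zlim : ip Pi zlim zlim = alpha%:C.
Proof.
have H := L2_to_ip cL2_zt cL2_zt cL2_zlim cL2_zlim zt_to_zlim zt_to_zlim.
have H2 : (fun n => (zeta alpha beta n)%:C : R[i]^o) @ \oo --> (alpha%:C : R[i]^o).
  by apply/cvg_complexP; split; [exact: cvg_zeta|exact: cvg_cst].
by apply: (cvg_complex_unique _ H H2) => n; rewrite ip_zt.
Qed.

Lemma sqm_zlim : sqm Pi zlim = alpha%:E.
Proof. by rewrite sqm_ip ?ip_zlim//; exact: cL2_zlim. Qed.

(** Both sides are L2 limits of [zt n.+1]. *)
Lemma zlim_fixed : {ae Pi, forall x, zlim x = mbb zlim zlim x}.
Proof.
have lz := cL2_zlim; have lzz := cL2_mbb lz lz.
suff : sqm Pi (fun x => zlim x - mbb zlim zlim x) = 0%E.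
  move=> /(sqm0_ae (cmeasB lz.1 lzz.1)); apply: filterS => x /eqP.
  by rewrite subr_eq0 => /eqP.
have bound n : (sqm Pi (fun x => zlim x - mbb zlim zlim x)%R <=
    (2 * (alpha - zeta alpha beta n.+1) +
     2 * ((alpha + beta)^-1 * (alpha ^+ 2 - zeta alpha beta n ^+ 2)))%:E)%E.
  apply: le_trans (sqm_triangle Pi lz.1 (cL2_zt n.+1).1 lzz.1) _.
  have h2 : sqm Pi (fun x => zt n.+1 x - mbb zlim zlim x) =
      ((alpha + beta)^-1 * (alpha ^+ 2 - zeta alpha beta n ^+ 2))%:E.
    rewrite (sqmB (cL2_zt n.+1) lzz) (ip_zt (leqnn n.+1)).
    have ln := cL2_zt n; have en := Ec_zt n; have el := Ec_zlim.
    have e1 := ip_mbb lz lz lz lz el el el el.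
    have e2 := ip_mbb ln ln lz lz en en el el.
    have e3 : ip Pi (zt n) zlim = (zeta alpha beta n)%:C.
      by rewrite (ipC lz ln) ip_zlim_zt conjc_real.
    rewrite e1 -[zt n.+1]/(mbb (zt n) (zt n)) e2 e3 ip_zlim.
    by rewrite -!rmorphM -!rmorphD -!rmorphM/=; congr (_%:E); ring.
  rewrite h2 [X in (_ <= X)%E]EFinD; apply: leeD; last by rewrite -EFinM.
  by rewrite [X in (_ <= X)%E]EFinM; apply: lee_wpmul2l; [rewrite lee_fin|exact: sqm_zlimB].
apply/eqP; rewrite eq_le sqm_ge0 andbT.
have lim0 : (fun n => (2 * (alpha - zeta alpha beta n.+1) +
     2 * ((alpha + beta)^-1 * (alpha ^+ 2 - zeta alpha beta n ^+ 2)))) @ \oo --> (0 : R).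
  rewrite [X in _ --> X](_ : 0 = 2 * (alpha - alpha) + 2 * ((alpha + beta)^-1 * (alpha ^+ 2 - alpha ^+ 2))); last by ring.
  have cz := @cvg_zeta R alpha beta alpha1 ab.
  apply: cvgD; apply: cvgMr.
    by apply: cvgB; [exact: cvg_cst|move: cz; rewrite -(cvg_shiftS (zeta alpha beta))].
  apply: cvgMr; apply: cvgB; first exact: cvg_cst.
  by rewrite expr2; under eq_fun do rewrite expr2; exact: cvgM.
apply/lee_addgt0Pr => e e0; rewrite add0e.
move/cvgrPdist_lt : lim0 => /(_ _ e0) [n _ /(_ n (leqnn n))].
rewrite sub0r normrN => /(le_lt_trans (ler_norm _)) h.
by apply: le_trans (bound n) _; rewrite lee_fin ltW.
Qed.

Let Cim_Clim_real (u : nat -> R[i]) : (forall n, Cim (u n) = 0) -> Cim (Clim u) = 0.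
Proof.
move=> u0; rewrite /Clim/=.
rewrite (_ : (fun n => _) = (fun=> 0%E)); last by apply/funext => n; rewrite u0.
have H : (fun _ : nat => 0%E : \bar R) @ \oo --> 0%E by exact: cvg_cst.
by rewrite (cvg_limn_einf_sup H).2.
Qed.

Lemma Cim_zt n x : Cim (zt n x) = 0.
Proof.
elim: n x => [//|n IH] x; apply: Cim_Clim_real => m.
rewrite Cim_sum big1// => j _.
by rewrite !(CimM, CreM) !IH/=; ring.
Qed.

Lemma Cim_zlim x : Cim (zlim x) = 0.
Proof. by apply: Cim_Clim_real => n; exact: Cim_zt. Qed.

End mtree.

#[local] Existing Instance totally_filter.

(** * Unconditional sums *)

Section unconditional_sums.
Context (R : realType).

Lemma partial_sum_fset (I : choiceType) (V : zmodType) (x : I -> V) (B : {fset I}) :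
  partial_sum x B = \sum_(i <- B) x i.
Proof. by rewrite /partial_sum -(big_seq_fsetE _ B xpredT x). Qed.

Definition asum (I : choiceType) (r : I -> R) : R := fine (\esum_(i in setT) (r i)%:E).

Lemma cvg_asum (I : choiceType) (r : I -> R) : (forall i, 0 <= r i) ->
  (\esum_(i in setT) (r i)%:E < +oo)%E ->
  partial_sum r @ totally --> asum r.
Proof.
move=> r0 roo.
have fin : \esum_(i in setT) (r i)%:E \is a fin_num.
  by rewrite ge0_fin_numE// esum_ge0// => i _; rewrite lee_fin.
have ub (B : {fset I}) : partial_sum r B <= asum r.
  rewrite partial_sum_fset -lee_fin fineK// -sumEFin.
  apply: ereal_sup_ubound; exists [set` B]; first by split => //; exact: finite_fset.
  by rewrite fsbig_finite//= set_fsetK.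
apply/cvgrPdist_lt => e e0.
have : (\esum_(i in setT) (r i)%:E - e%:E < \esum_(i in setT) (r i)%:E)%E.
  by rewrite -(fineK fin) -EFinB lte_fin ltrBlDr ltrDl.
move=> /ereal_sup_gt[_ [F [finF _] <-]] H.
exists (fset_set F) => // B /= /fsubsetP FB.
rewrite ger0_norm ?subr_ge0// ltrBlDr addrC -ltrBlDr -lte_fin EFinB fineK//.
apply: (lt_le_trans H); rewrite fsbig_finite//= sumEFin lee_fin partial_sum_fset.
rewrite (big_fsetID _ (mem (fset_set F)) B)/=.
rewrite (_ : [fset x in B | x \in fset_set F]%fset = fset_set F); last first.
  apply/fsetP => i; rewrite !inE/= andb_idl//; exact: FB.
by rewrite lerDl sumr_ge0.
Qed.

(** Each of the four sums has nonnegative terms. *)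
Definition asumC (I : choiceType) (x : I -> R[i]) : R[i] :=
  (asum (fun i => Num.max (Cre (x i)) 0) - asum (fun i => Num.max (- Cre (x i)) 0)) +i*
  (asum (fun i => Num.max (Cim (x i)) 0) - asum (fun i => Num.max (- Cim (x i)) 0)).

Let maxB (y : R) : Num.max y 0 - Num.max (- y) 0 = y.
Proof.
by rewrite /Num.max; case: (ltP y 0) => h; case: (ltP (- y) 0) => h2; lra.
Qed.

Let max_le (y m : R) : `|y| <= m -> Num.max y 0 <= m /\ Num.max (- y) 0 <= m.
Proof. rewrite ler_norml => /andP[h1 h2].
by rewrite /Num.max; case: (ltP y 0) => h3; case: (ltP (- y) 0) => h4; split; lra. Qed.

Lemma cvg_asumC (I : choiceType) (x : I -> R[i]) :
  (\esum_(i in setT) (cabs (x i))%:E < +oo)%E ->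
  partial_sum (x : I -> R[i]^o) @ totally --> (asumC x : R[i]^o).
Proof.
move=> xoo.
have part (f : I -> R) : (forall i, `|f i| <= cabs (x i)) ->
    partial_sum f @ totally -->
    (asum (fun i => Num.max (f i) 0) - asum (fun i => Num.max (- f i) 0)).
  move=> fx.
  have H (g : I -> R) : (forall i, 0 <= g i) -> (forall i, g i <= cabs (x i)) ->
      partial_sum g @ totally --> asum g.
    move=> g0 gx; apply: cvg_asum => //; apply: le_lt_trans xoo.
    by apply: le_esum => i _; rewrite lee_fin.
  rewrite (_ : partial_sum f = fun B => partial_sum (fun i => Num.max (f i) 0) B -
      partial_sum (fun i => Num.max (- f i) 0) B); last first.
    apply/funext => B; rewrite !partial_sum_fset -sumrB.
    by apply: eq_bigr => i _; rewrite maxB.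
  apply: cvgB; apply: H => i; rewrite ?le_max ?lexx ?orbT//.
    by have [] := max_le (fx i).
  by have [] := max_le (fx i).
apply/cvg_complexP; split.
  rewrite (_ : _ \o _ = partial_sum (fun i => Cre (x i))).
    by apply: part => i; exact: normCre_le.
  by apply/funext => B /=; rewrite !partial_sum_fset Cre_sum.
rewrite (_ : _ \o _ = partial_sum (fun i => Cim (x i))).
  by apply: part => i; exact: normCim_le.
by apply/funext => B /=; rewrite !partial_sum_fset Cim_sum.
Qed.

Lemma sumC_asumC (I : choiceType) (x : I -> R[i]) :
  (\esum_(i in setT) (cabs (x i))%:E < +oo)%E -> sumC x = asumC x.
Proof.
by move=> /cvg_asumC H; apply: (@cvg_lim _ (@norm_hausdorff _ R[i]^o) _ _ _ _ _ H).
Qed.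

(** The initial segments are cofinal among the finite sets. *)
Lemma totally_cvg_seq (x : nat -> R[i]) (s : R[i]) :
  partial_sum (x : nat -> R[i]^o) @ totally --> (s : R[i]^o) ->
  (fun n => \sum_(0 <= j < n) x j : R[i]^o) @ \oo --> (s : R[i]^o).
Proof.
move=> xs; apply: cvg_trans xs => B [A _ AB].
pose N := (\max_(i <- A) i.+1)%N; exists N => // n /= Nn.
have -> : \sum_(0 <= j < n) x j = partial_sum (x : nat -> R[i]^o) [fset i in iota 0 n]%fset.
  rewrite partial_sum_fset; apply: perm_big; rewrite /index_iota subn0.
  apply: uniq_perm; [exact: iota_uniq|exact: fset_uniq|].
  by move=> i; rewrite /= !inE.
apply: AB; apply/fsubsetP => i iA; rewrite !inE/= mem_iota add0n.
by apply: leq_trans Nn; rewrite /N; exact: (@leq_bigmax_seq _ _ xpredT (fun i => i.+1) i iA).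
Qed.

Lemma cvg_totally_abs (x : nat -> R[i]) (s : R[i]) :
  (\sum_(0 <= j <oo) (cabs (x j))%:E < +oo)%E ->
  (fun n => \sum_(0 <= j < n) x j : R[i]^o) @ \oo --> (s : R[i]^o) ->
  partial_sum (x : nat -> R[i]^o) @ totally --> (s : R[i]^o).
Proof.
rewrite nneseries_esumT => [xoo xs|j]; last by rewrite lee_fin cabs_ge0.
have H := cvg_asumC xoo.
by rewrite (cvg_complex_unique (fun=> erefl) xs (totally_cvg_seq H)).
Qed.

Section tuples.
Context (n : nat).

Let cons_pair (jt : nat * n.-tuple nat) : n.+1.-tuple nat := [tuple of jt.1 :: jt.2].

Let cons_bij : set_bij [set: nat * n.-tuple nat] [set: n.+1.-tuple nat] cons_pair.
Proof.
split=> [//|[i t] [j u] _ _ /= /(congr1 val)/= [-> /val_inj -> //]|].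
move=> t _; exists (thead t, [tuple of behead t]) => //.
by rewrite /cons_pair/= -tuple_eta.
Qed.

Lemma esum_tupleS (f : n.+1.-tuple nat -> \bar R) : (forall t, (0 <= f t)%E) ->
  (\esum_(t in setT) f t =
   \sum_(0 <= j <oo) \esum_(t in [set: n.-tuple nat]) f [tuple of j :: t])%E.
Proof.
move=> f0; rewrite (@reindex_esum _ _ _ _ _ _ f cons_bij) nneseries_esumT; last first.
  by move=> j; apply: esum_ge0.
rewrite (esum_esum (J := fun=> setT) (a := fun (j : nat) (t : n.-tuple nat) => f [tuple of j :: t]))//.
by congr esum; apply/seteqP; split.
Qed.

Lemma asum_tupleS (f : n.+1.-tuple nat -> R) : (forall t, 0 <= f t) ->
  (\esum_(t in setT) (f t)%:E < +oo)%E ->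
  (fun N => \sum_(0 <= j < N) asum (fun t : n.-tuple nat => f [tuple of j :: t])) @ \oo
  --> asum f.
Proof.
move=> f0 foo; rewrite /asum esum_tupleS; last by move=> t; rewrite lee_fin.
have fin j : \esum_(t in [set: n.-tuple nat]) (f [tuple of j :: t])%:E \is a fin_num.
  rewrite ge0_fin_numE; last by apply: esum_ge0 => t _; rewrite lee_fin.
  apply: le_lt_trans foo; rewrite esum_tupleS; last by move=> t; rewrite lee_fin.
  rewrite (@nneseriesD1 _ _ j)//; last by move=> k _; apply: esum_ge0 => t _; rewrite lee_fin.
  rewrite leeDl//; apply: nneseries_ge0 => k _ _; apply: esum_ge0 => t _; by rewrite lee_fin.
have H : (fun N => \sum_(0 <= j < N) \esum_(t in [set: n.-tuple nat]) (f [tuple of j :: t])%:E)%E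
    @ \oo --> (\sum_(0 <= j <oo) \esum_(t in [set: n.-tuple nat]) (f [tuple of j :: t])%:E)%E.
  by apply: is_cvg_nneseries => k _ _; apply: esum_ge0 => t _; rewrite lee_fin.
have fins : (\sum_(0 <= j <oo) \esum_(t in [set: n.-tuple nat]) (f [tuple of j :: t])%:E)%E
    \is a fin_num.
  rewrite -(@esum_tupleS (fun t => (f t)%:E)); last by move=> t; rewrite lee_fin.
  by rewrite ge0_fin_numE// esum_ge0// => t _; rewrite lee_fin.
rewrite -(fineK fins) in H; move/fine_cvgP : H => [_].
by apply: cvg_trans; apply: near_eq_cvg; apply: nearW => N /=; rewrite -sum_fine.
Qed.

Lemma asumC_tupleS (x : n.+1.-tuple nat -> R[i]) :
  (\esum_(t in setT) (cabs (x t))%:E < +oo)%E ->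
  (fun N => \sum_(0 <= j < N) asumC (fun t : n.-tuple nat => x [tuple of j :: t]) : R[i]^o)
  @ \oo --> (asumC x : R[i]^o).
Proof.
move=> xoo.
have part (f : n.+1.-tuple nat -> R) : (forall t, `|f t| <= cabs (x t)) ->
   (fun N => \sum_(0 <= j < N)
     (asum (fun t : n.-tuple nat => Num.max (f [tuple of j :: t]) 0) -
      asum (fun t : n.-tuple nat => Num.max (- f [tuple of j :: t]) 0))) @ \oo -->
    (asum (fun i => Num.max (f i) 0) - asum (fun i => Num.max (- f i) 0)).
  move=> fx; under eq_fun do rewrite sumrB.
  have H (g : n.+1.-tuple nat -> R) : (forall i, g i <= cabs (x i)) ->
     (\esum_(t in setT) (g t)%:E < +oo)%E.
    by move=> gx; apply: le_lt_trans xoo; apply: le_esum => i _; rewrite lee_fin.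
  apply: cvgB.
    apply: (asum_tupleS (f := fun t => Num.max (f t) 0)) => [t|].
      by rewrite le_max lexx orbT.
    by apply: H => t; have [] := max_le (fx t).
  apply: (asum_tupleS (f := fun t => Num.max (- f t) 0)) => [t|].
    by rewrite le_max lexx orbT.
  by apply: H => t; have [] := max_le (fx t).
apply/cvg_complexP; split.
  have := part _ (fun t => normCre_le (x t)).
  by apply: cvg_trans; apply: near_eq_cvg; apply: nearW => N /=; rewrite Cre_sum.
have := part _ (fun t => normCim_le (x t)).
by apply: cvg_trans; apply: near_eq_cvg; apply: nearW => N /=; rewrite Cim_sum.
Qed.

End tuples.
End unconditional_sums.

(** * Smoothing sums on the canonical tree *)

Section ttree.
Context (R : realType) d (S : measurableType d) (q1 q2 : probability S R)
  (A : S -> nat -> R) (alpha beta : R).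
Hypotheses (alpha1 : 1 <= alpha) (ab : alpha <= beta)
  (gA : good_weights q1 A ((alpha * beta + 1) / (alpha + beta)) (alpha + beta)^-1).

Notation tI := (seq nat + seq nat)%type.
Notation X := (famT S tI).

(** The weights of the node [u] sit at [inl u], its mark W(u) at [inr u]. *)
Definition tlaw (i : tI) : probability S R := if i is inl _ then q1 else q2.

Notation Pi := (fam_prod tlaw).

Definition tchild (j : nat) (i : tI) : tI :=
  match i with inl u => inl (j :: u) | inr u => inr (j :: u) end.

Let K0 : 0 < alpha + beta. Proof. by move: alpha1 ab => h1 h2; lra. Qed.

Definition at_root (w : S -> R[i]) (x : X) : R[i] := w (x (inr [::])).

Definition tbb (w : S -> R[i]) (G : X -> R[i]) : X -> R[i] :=
  bb (inl [::]) A tchild tchild (at_root w) G.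

Let JF : set tI := [set inr [::]].
Let JG : set tI := ~` JF.

Let tchild_inj j : injective (tchild j). Proof. by move=> [u|u] [v|v] //= [->]. Qed.
Let tlaw_tchild j i : tlaw (tchild j i) = tlaw i. Proof. by case: i. Qed.
Let root_out j (i : tI) : tchild j i <> inl [::] /\ tchild j i <> inl [::].
Proof. by case: i. Qed.
Let FG_disj j i i' : JF i -> JG i' -> tchild j i <> tchild j i'.
Proof. by move=> h h' /tchild_inj e; apply: h'; rewrite -e. Qed.
Let jk_disj j k (i i' : tI) : j <> k -> [/\ tchild j i <> tchild k i',
  tchild j i <> tchild k i' & tchild j i <> tchild k i'].
Proof. by move=> jk; case: i => u; case: i' => v //=; split=> -[]. Qed.

Let mroot := @measurable_coord _ S tI (inr [::]).
Let lroot := fam_prod_coord tlaw (inr [::]).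

Lemma cL2_at_root w : cL2 q2 w -> cL2 Pi (at_root w).
Proof. exact: (cL2_law mroot lroot). Qed.

Lemma Ec_at_root w : cmeas w -> Ec Pi (at_root w) = Ec q2 w.
Proof. exact: (Ec_law mroot lroot). Qed.

Lemma ip_at_root w w' : cmeas w -> cmeas w' -> ip Pi (at_root w) (at_root w') = ip q2 w w'.
Proof. exact: (ip_law mroot lroot). Qed.

Let dep_root w : depends_on JF (at_root w).
Proof. by move=> x y xy; rewrite /at_root xy. Qed.

(** The mark of the root is the only one that does not contribute. *)
Definition markless (G : X -> R[i]) := depends_on JG G.

Lemma markless_cst z : markless (fun=> z). Proof. by []. Qed.

Lemma markless_tbb w G : markless (tbb w G).
Proof.
move=> x y xy; rewrite /tbb /bb /bsum; congr Csum; apply/funext => j.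
have -> : x (inl [::]) = y (inl [::]) by apply: xy.
rewrite (_ : x \o tchild j = y \o tchild j)//.
by apply/funext => -[u|u] /=; apply: xy.
Qed.

Section one.
Context (w : S -> R[i]) (G : X -> R[i]).
Hypotheses (lw : cL2 q2 w) (lG : cL2 Pi G) (dG : markless G).

Lemma tbb_summable :
  {ae Pi, forall x : X, (\sum_(0 <= j <oo) (cabs ((A (x (inl [::])) j)%:C *
    (w (x (inr [:: j])) * G (x \o tchild j))))%:E < +oo)%E}.
Proof.
exact: (bb_summable (p := tlaw) (k0 := inl [::]) gA tchild_inj tchild_inj tlaw_tchild tlaw_tchild
  root_out FG_disj (cL2_at_root lw) lG (dep_root w) dG).
Qed.

Lemma cL2_tbb : cL2 Pi (tbb w G).
Proof.
exact: (cL2_bb (p := tlaw) (k0 := inl [::]) gA tchild_inj tchild_inj tlaw_tchild tlaw_tchild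
  root_out FG_disj (cL2_at_root lw) lG (dep_root w) dG).
Qed.

Lemma Ec_tbb : Ec Pi (tbb w G) = Ec q2 w * Ec Pi G.
Proof.
rewrite -(Ec_at_root lw.1).
exact: (Ec_bb (p := tlaw) (k0 := inl [::]) gA tchild_inj tchild_inj tlaw_tchild tlaw_tchild
  root_out FG_disj (cL2_at_root lw) lG (dep_root w) dG).
Qed.

End one.

Lemma ip_tbb w w' G G' : cL2 q2 w -> cL2 q2 w' -> Ec q2 w = 1 -> Ec q2 w' = 1 ->
  cL2 Pi G -> cL2 Pi G' -> Ec Pi G = 1 -> Ec Pi G' = 1 -> markless G -> markless G' ->
  ip Pi (tbb w G) (tbb w' G') =
  ((alpha + beta)^-1)%:C * ((alpha * beta)%:C + ip q2 w w' * ip Pi G G').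
Proof.
move=> lw lw' mw mw' lG lG' mG mG' dG dG'.
have := ip_bb (p := tlaw) (k0 := inl [::]) gA tchild_inj tchild_inj tlaw_tchild tlaw_tchild
  root_out FG_disj jk_disj (cL2_at_root lw) lG (dep_root w) dG
  (cL2_at_root lw') lG' (dep_root w') dG'.
rewrite -/(tbb w G) -/(tbb w' G') => ->.
have e1 : (1 * 1) * (1 * 1)^* = 1 :> R[i] by rewrite !mul1r; exact: conjc1.
rewrite (Ec_at_root lw.1) (Ec_at_root lw'.1) (ip_at_root lw.1 lw'.1).
rewrite mw mG mw' mG' e1 mulr1 mulrDr; congr (_ + _).
rewrite -rmorphM; congr (_%:C); by field; rewrite gt_eqF.
Qed.

(** The sum over the words of length [n], with an additional factor [v] read
    on the subtree at the end of the word. *)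
Fixpoint yl (w : S -> R[i]) (v : X -> R[i]) (n : nat) : X -> R[i] :=
  if n is n'.+1 then tbb w (yl w v n') else v.

Lemma ylD w v m n : yl w v (m + n) = yl w (yl w v n) m.
Proof. by elim: m => //= m ->. Qed.

Section levels.
Context (w : S -> R[i]) (s : R).
Hypotheses (lw : cL2 q2 w) (mw : Ec q2 w = 1) (sw : ip q2 w w = s%:C)
  (s0 : 0 <= s) (sK : s < alpha + beta).

Lemma markless_yl v n : markless v -> markless (yl w v n).
Proof. by case: n => //= n _; exact: markless_tbb. Qed.

Lemma cL2_yl v n : cL2 Pi v -> markless v -> cL2 Pi (yl w v n).
Proof. by move=> lv dv; elim: n => //= n IH; apply: cL2_tbb => //; exact: markless_yl. Qed.

Lemma Ec_yl v n : cL2 Pi v -> markless v -> Ec Pi v = 1 -> Ec Pi (yl w v n) = 1.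
Proof.
move=> lv dv mv; elim: n => //= n IH.
by rewrite Ec_tbb ?mw ?IH ?mulr1//; [exact: cL2_yl|exact: markless_yl].
Qed.

Let r := (alpha + beta)^-1 * s.

Let r0 : 0 <= r. Proof. by rewrite mulr_ge0// invr_ge0 ltW. Qed.
Let r1 : r < 1. Proof. by rewrite /r mulrC ltr_pdivrMr// mul1r. Qed.

(** Each generation multiplies the squared distance by [r]: the difference of
    the two families of leaves has mean 0, so that only the diagonal terms of
    [ip_tbb] remain. *)
Lemma sqm_ylB v v' n : cL2 Pi v -> markless v -> Ec Pi v = 1 ->
  cL2 Pi v' -> markless v' -> Ec Pi v' = 1 ->
  sqm Pi (fun x => yl w v n x - yl w v' n x) =
  ((r ^+ n)%:E * sqm Pi (fun x => v x - v' x)%R)%E.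
Proof.
move=> lv dv mv lv' dv' mv'; elim: n => [|n IH]; first by rewrite expr0 mul1e.
have l1 := cL2_yl n lv dv; have l2 := cL2_yl n lv' dv'.
have e1 := Ec_yl n lv dv mv; have e2 := Ec_yl n lv' dv' mv'.
have d1 := markless_yl n dv; have d2 := markless_yl n dv'.
rewrite exprS EFinM -muleA -IH (sqmB l1 l2).
rewrite -[yl w v n.+1]/(tbb w (yl w v n)) -[yl w v' n.+1]/(tbb w (yl w v' n)).
rewrite (sqmB (cL2_tbb lw l1 d1) (cL2_tbb lw l2 d2)) !ip_tbb// sw.
move: (ip _ _ _) (ip _ _ _) (ip _ _ _) => [z1 z1'] [z2 z2'] [z3 z3'].
by rewrite -EFinM !(CreM, CreD, CimM, CimD)/=; congr (_%:E); rewrite /r; ring.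
Qed.

Definition yt := yl w (fun=> 1).

Lemma cL2_yt n : cL2 Pi (yt n).
Proof. by apply: cL2_yl => //; exact: cL2_cst. Qed.

Lemma Ec_yt n : Ec Pi (yt n) = 1.
Proof. by apply: Ec_yl => //; [exact: cL2_cst|exact: Ec_cst]. Qed.

Lemma sqm_ytB m n : sqm Pi (fun x => yt (n + m) x - yt n x) =
  ((r ^+ n)%:E * sqm Pi (fun x => yt m x - 1)%R)%E.
Proof.
rewrite /yt ylD sqm_ylB//; [exact: cL2_yt|exact: markless_yl|exact: Ec_yt|exact: cL2_cst|].
exact: Ec_cst.
Qed.

Definition ylim : X -> R[i] := fun x => Clim (fun n => yt n x).

Let B := fine (sqm Pi (fun x => yt 1 x - 1)).
Let B0 : 0 <= B. Proof. by apply: fine_ge0; exact: sqm_ge0. Qed.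

Let geo_sum (x : R) N : 0 <= x -> x < 1 -> \sum_(0 <= n < N) x ^+ n <= (1 - x)^-1.
Proof.
move=> x0 x1; rewrite -[leRHS]mul1r ler_pdivlMr ?subr_gt0// mulrC big_mkord.
by rewrite -opprB mulNr -subrX1 opprB lerBlDr lerDl exprn_ge0.
Qed.

(* E|x| <= t^n + E|x|^2 / t^n, so a ratio between r and 1 makes the expected
   increments summable. *)
Let t := (1 + r) / 2.
Let t0 : 0 < t. Proof. by rewrite /t; move: r0 => h; lra. Qed.
Let t1 : t < 1. Proof. by rewrite /t; move: r1 => h; lra. Qed.
Let rt : r < t. Proof. by rewrite /t; move: r1 => h; lra. Qed.

Lemma yt_cvg : {ae Pi, forall x,
  (yt ^~ x : nat -> R[i]^o) @ \oo --> (ylim x : R[i]^o)}.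
Proof.
pose D n x := yt n.+1 x - yt n x.
have lD n : cL2 Pi (D n) by apply: cL2B; exact: cL2_yt.
have sD n : sqm Pi (D n) = (r ^+ n * B)%:E.
  rewrite /D -addn1 sqm_ytB EFinM fineK// sqm_fin//.
  by apply: cL2B; [exact: cL2_yt|exact: cL2_cst].
have step n : (\int[Pi]_x (cabs (D n x))%:E <= (t ^+ n + (r / t) ^+ n * B)%:E)%E.
  have tn0 : 0 < t ^+ n by rewrite exprn_gt0.
  have -> : (t ^+ n + (r / t) ^+ n * B)%:E =
      (\int[Pi]_x ((t ^+ n)%:E + (t ^+ n)^-1%:E * (cabs (D n x) ^+ 2)%:E))%E.
    have mD := measurable_sqr_cabs (lD n).1.
    rewrite ge0_integralD//; last 3 first.
    - by move=> x _; rewrite lee_fin ltW.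
    - by move=> x _; rewrite -EFinM lee_fin mulr_ge0 ?sqr_ge0// invr_ge0 ltW.
    - by apply: emeasurable_funM.
    rewrite integral_cst//= probability_setT mule1 ge0_integralZl_EFin//; last 2 first.
    - by move=> x _; rewrite lee_fin sqr_ge0.
    - by rewrite invr_ge0 ltW.
    rewrite -/(sqm Pi (D n)) sD -EFinM -EFinD; congr (_%:E).
    by congr (_ + _); rewrite expr_div_n -mulrA mulrCA.
  apply: ge0_le_integral => //=.
  - by move=> x _; rewrite lee_fin cabs_ge0.
  - by apply/measurable_EFinP; apply: measurable_cabs; exact: (lD n).1.
  - by apply: emeasurable_funD => //; apply: emeasurable_funM => //; exact: measurable_sqr_cabs (lD n).1.
  - move=> x _; rewrite -EFinM -EFinD lee_fin.
    set y := cabs _; have y0 : 0 <= y by exact: cabs_ge0.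
    have [yt|ty] := leP y (t ^+ n).
      by rewrite (le_trans yt)// lerDl mulr_ge0 ?sqr_ge0// invr_ge0 ltW.
    apply: (@le_trans _ _ ((t ^+ n)^-1 * y ^+ 2)); last by rewrite lerDr ltW.
    by rewrite mulrC ler_pdivlMr// expr2 ler_wpM2l// ltW.
have : {ae Pi, forall x, (\sum_(0 <= n <oo) (cabs (D n x))%:E < +oo)%E}.
  apply: ae_lty_nneseries.
  - by move=> n; apply/measurable_EFinP; apply: measurable_cabs; exact: (lD n).1.
  - by move=> n x; rewrite lee_fin cabs_ge0.
  apply: (@le_lt_trans _ _ ((1 - t)^-1 + (1 - r / t)^-1 * B)%:E); last exact: ltry.
  apply: lime_le.
    by apply: is_cvg_nneseries => n _ _; apply: integral_ge0 => x _; rewrite lee_fin cabs_ge0.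
  apply: nearW => N; apply: (@le_trans _ _ (\sum_(0 <= n < N) (t ^+ n + (r / t) ^+ n * B)%:E)%E).
    by apply: lee_sum => n _; exact: step.
  rewrite sumEFin lee_fin big_split/= -mulr_suml lerD//.
    by apply: geo_sum => //; exact: ltW.
  apply: ler_wpM2r => //; apply: geo_sum; first by rewrite divr_ge0// ltW.
  by rewrite ltr_pdivrMr// mul1r.
by apply: filterS => x; exact: cvg_Clim_increments.
Qed.

Lemma cmeas_ylim : cmeas ylim.
Proof. by apply: cmeas_Clim => n; exact: (cL2_yt n).1. Qed.

Let L := alpha * beta / (alpha + beta - s).

Let sqm_yt_le n : (sqm Pi (yt n) <= (1 + L)%:E)%E.
Proof.
have lc := cL2_cst Pi 1.
suff H : exists2 v : R, ip Pi (yt n) (yt n) = v%:C & v <= 1 + L.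
  by have [v e v1] := H; rewrite (sqm_ip (cL2_yt n)) e lee_fin.
elim: n => [|n [v e v1]].
  exists 1; first by rewrite ip1 /yt/= Ec_cst.
  have ? : 0 <= L by rewrite divr_ge0 ?subr_ge0 ?(ltW sK)//; move: alpha1 ab => h1 h2; nra.
  lra.
exists ((alpha + beta)^-1 * (alpha * beta + s * v)).
  have le := cL2_yt n; have ee := Ec_yt n; have de := markless_yl n (markless_cst 1).
  rewrite -[yt n.+1]/(tbb w (yt n)) ip_tbb// sw e.
  by rewrite -!rmorphM -!rmorphD -!rmorphM.
have Ks : 0 < alpha + beta - s by rewrite subr_gt0.
have eL : alpha * beta = L * (alpha + beta - s) by rewrite /L divfK// gt_eqF.
rewrite mulrC ler_pdivrMr// eL.
have : s * v <= s * (1 + L) by rewrite ler_wpM2l.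
nra.
Qed.

Let C : R := 2 * (1 + L) + 2.

Let sqm_ylimB n : (sqm Pi (fun x => ylim x - yt n x)%R <= (r ^+ n * C)%:E)%E.
Proof.
apply: (L2_fatou (f_ := yt)).
- by move=> k; exact: (cL2_yt k).1.
- exact: cmeas_ylim.
- exact: (cL2_yt n).1.
- exact: yt_cvg.
- exists n => // m /= nm; rewrite -(subnKC nm) sqm_ytB EFinM.
  apply: lee_wpmul2l; first by rewrite lee_fin exprn_ge0.
  have H := sqmD Pi (cL2_yt (m - n)).1 (cmeas_cst X (-1)).
  apply: le_trans H _.
  rewrite /C [X in (_ <= X)%E]EFinD [X in (_ <= X + _)%E]EFinM; apply: leeD.
    by apply: lee_wpmul2l; [rewrite lee_fin|exact: sqm_yt_le].
  rewrite (sqmN Pi (fun=> 1)) (sqm_ip (cL2_cst Pi 1)) ip1 Ec_cst -EFinM lee_fin/=.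
  by rewrite mulr1.
Qed.

Lemma cL2_ylim : cL2 Pi ylim.
Proof.
have l0 : cL2 Pi (fun x => ylim x - yt 0 x).
  split; first by apply: cmeasB; [exact: cmeas_ylim|exact: cmeas_cst].
  by apply: le_lt_trans (sqm_ylimB 0) _; exact: ltry.
have := cL2D l0 (cL2_yt 0).
by rewrite (_ : (fun w => _) = ylim)//; apply/funext => x; rewrite subrK.
Qed.

Lemma cvg_geo_r : (fun n => r ^+ n) @ \oo --> (0 : R).
Proof. by apply: cvg_expr; rewrite ger0_norm. Qed.

Lemma yt_to_ylim : L2_to Pi yt ylim.
Proof.
have H : (fun n => (r ^+ n * C)%:E) @ \oo --> (0 : R)%:E.
  apply/fine_cvgP; split; first exact: nearW.
  by rewrite -[X in _ --> X](mul0r C); apply: cvgMl; exact: cvg_geo_r.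
rewrite /L2_to; under eq_fun do rewrite sqmBC.
apply: (squeeze_cvge _ (cvg_cst _) H).
by apply: nearW => n; rewrite sqm_ge0 sqm_ylimB.
Qed.

End levels.
End ttree.

Section ttree_limit.
Context (R : realType) d (S : measurableType d) (q1 q2 : probability S R)
  (A : S -> nat -> R) (alpha beta : R).
Hypotheses (alpha1 : 1 <= alpha) (ab : alpha <= beta)
  (gA : good_weights q1 A ((alpha * beta + 1) / (alpha + beta)) (alpha + beta)^-1).

Notation tI := (seq nat + seq nat)%type.
Notation X := (famT S tI).
Notation Pi := (fam_prod (tlaw q1 q2)).

Let K0 : 0 < alpha + beta. Proof. by move: alpha1 ab => h1 h2; lra. Qed.

Section one.
Context (w : S -> R[i]) (s : R).
Hypotheses (lw : cL2 q2 w) (mw : Ec q2 w = 1) (sw : ip q2 w w = s%:C)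
  (s0 : 0 <= s) (sK : s < alpha + beta).

Let ly n := cL2_yt gA lw n.
Let ll := cL2_ylim alpha1 ab gA lw mw sw s0 sK.
Let toy := yt_to_ylim alpha1 ab gA lw mw sw s0 sK.

Lemma Ec_ylim : Ec Pi (ylim A w) = 1.
Proof. exact: (L2_to_Ec ly ll toy (Ec_yt gA lw mw)). Qed.

(** By [sqm_ylB], the leaves are forgotten at a geometric rate. *)
Lemma yl_to_ylim (v : X -> R[i]) : cL2 Pi v -> markless v -> Ec Pi v = 1 ->
  L2_to Pi (yl A w v) (ylim A w).
Proof.
move=> lv dv mv; pose r := (alpha + beta)^-1 * s.
have r0 : 0 <= r by rewrite mulr_ge0// invr_ge0 ltW.
have r1 : r < 1 by rewrite /r mulrC ltr_pdivrMr// mul1r.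
pose C := fine (sqm Pi (fun x => v x - 1)).
have eC : sqm Pi (fun x => v x - 1) = C%:E.
  by rewrite fineK// sqm_fin//; apply: cL2B => //; exact: cL2_cst.
have H1 : (fun n => (2%:E * (r ^+ n * C)%:E)%E) @ \oo --> (2%:E * (0 : R)%:E)%E.
  apply: cvgeZl => //; apply/fine_cvgP; split; first exact: nearW.
  rewrite -[X in _ --> X](mul0r C); apply: cvgMl.
  by apply: cvg_expr; rewrite ger0_norm.
have H2 : (fun n => (2%:E * sqm Pi (fun x => yt A w n x - ylim A w x)%R)%E) @ \oo -->
    (2%:E * (0 : R)%:E)%E.
  by apply: cvgeZl => //; exact: toy.
have H : (fun n => 2%:E * (r ^+ n * C)%:E +
    2%:E * sqm Pi (fun x => yt A w n x - ylim A w x)%R)%E @ \oo --> 0%E.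
  have -> : (0 = 2%:E * (0 : R)%:E + 2%:E * (0 : R)%:E :> \bar R)%E by rewrite !mule0 adde0.
  by apply: cvgeD.
apply: (squeeze_cvge _ (cvg_cst _) H).
apply: nearW => n; rewrite sqm_ge0/=.
have lyl := cL2_yl gA lw n lv dv.
apply: le_trans (sqm_triangle Pi lyl.1 (ly n).1 ll.1) _.
rewrite leeD2r// lee_wpmul2l// EFinM -eC.
by rewrite (sqm_ylB alpha1 ab gA lw mw sw n lv dv mv (cL2_cst Pi 1) (@markless_cst _ _ S 1) (Ec_cst Pi 1)).
Qed.

End one.

Let recur (u : R) n : R := iter n (fun v => (alpha + beta)^-1 * (alpha * beta + u * v)) 1.

(** The covariances of the partial sums follow an affine recursion of ratio
    u / (alpha + beta) < 1; its fixed point is the limit. *)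
Lemma ip_ylim (w w' : S -> R[i]) (s s' u : R) :
  cL2 q2 w -> Ec q2 w = 1 -> ip q2 w w = s%:C -> 0 <= s -> s < alpha + beta ->
  cL2 q2 w' -> Ec q2 w' = 1 -> ip q2 w' w' = s'%:C -> 0 <= s' -> s' < alpha + beta ->
  ip q2 w w' = u%:C -> 0 <= u -> u < alpha + beta ->
  ip Pi (ylim A w) (ylim A w') = (alpha * beta / (alpha + beta - u))%:C.
Proof.
move=> lw mw sw s0 sK lw' mw' sw' s0' sK' uw u0 uK.
have ly n := cL2_yt gA lw n.
have ll := cL2_ylim alpha1 ab gA lw mw sw s0 sK.
have toy := yt_to_ylim alpha1 ab gA lw mw sw s0 sK.
have ly' n := cL2_yt gA lw' n.
have ll' := cL2_ylim alpha1 ab gA lw' mw' sw' s0' sK'.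
have toy' := yt_to_ylim alpha1 ab gA lw' mw' sw' s0' sK'.
have H := L2_to_ip ly ly' ll ll' toy toy'.
have e n : ip Pi (yt A w n) (yt A w' n) = (recur u n)%:C.
  elim: n => [|n IH]; first by rewrite /yt/= ip1 Ec_cst.
  rewrite -[yt A w n.+1]/(tbb A w (yt A w n)) -[yt A w' n.+1]/(tbb A w' (yt A w' n)).
  rewrite (ip_tbb alpha1 ab gA lw lw' mw mw' (ly n) (ly' n)) //.
  - by rewrite uw IH -!rmorphM -!rmorphD -!rmorphM.
  - exact: (Ec_yt gA).
  - exact: (Ec_yt gA).
  - by apply: markless_yl.
  - by apply: markless_yl.
pose L := alpha * beta / (alpha + beta - u); pose r := (alpha + beta)^-1 * u.
have r0 : 0 <= r by rewrite mulr_ge0// invr_ge0 ltW.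
have r1 : r < 1 by rewrite /r mulrC ltr_pdivrMr// mul1r.
have d0 : alpha + beta - u != 0 by rewrite gt_eqF// subr_gt0.
have er n : recur u n = L + r ^+ n * (1 - L).
  elim: n => [|n IH]; first by rewrite /recur/= expr0; ring.
  rewrite /recur iterS -/(recur u n) IH exprS.
  have -> : alpha * beta = L * (alpha + beta - u) by rewrite /L divfK.
  by rewrite /r; field; rewrite gt_eqF.
have H2 : (fun n => (recur u n)%:C : R[i]^o) @ \oo --> (L%:C : R[i]^o).
  apply/cvg_complexP; split; last exact: cvg_cst.
  rewrite (_ : _ \o _ = fun n => L + r ^+ n * (1 - L)); last by apply/funext => n /=; rewrite er.
  rewrite -[X in _ --> X]addr0 -[X in _ --> L + X](mul0r (1 - L)).
  apply: cvgD; first exact: cvg_cst.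
  by apply: cvgMl; apply: cvg_expr; rewrite ger0_norm.
exact: (cvg_complex_unique e H H2).
Qed.

(** The summand of [Y_] indexed by the word [t], read on the canonical
    space. *)
Definition word_term (w : S -> R[i]) n (x : X) (t : n.-tuple nat) : R[i] :=
  \prod_(k < n) ((A (x (inl (take k t))) (tnth t k))%:C * w (x (inr (take k.+1 t)))).

Lemma word_term_cons w n x j (t : n.-tuple nat) :
  word_term w x [tuple of j :: t] =
  (A (x (inl [::])) j)%:C * w (x (inr [:: j])) * word_term w (x \o tchild j) t.
Proof.
rewrite /word_term big_ord_recl/= take0; congr (_ * _).
by apply: eq_bigr => k _; rewrite tnthS.
Qed.

Let asumCZ (I : choiceType) (c : R[i]) (x : I -> R[i]) :
  (\esum_(i in setT) (cabs (x i))%:E < +oo)%E ->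
  (\esum_(i in setT) (cabs (c * x i))%:E < +oo)%E ->
  asumC (fun i => c * x i) = c * asumC x.
Proof.
move=> /cvg_asumC H1 /cvg_asumC H2.
have H3 : partial_sum (fun i => c * x i : R[i]^o) @ totally --> (c *: (asumC x : R[i]^o)).
  rewrite (_ : partial_sum _ = fun B => c *: (partial_sum (x : I -> R[i]^o) B : R[i]^o)).
    by apply: cvgZr; exact: H1.
  by apply/funext => B; rewrite !partial_sum_fset scaler_sumr.
exact: (@cvg_unique _ (@norm_hausdorff _ R[i]^o) _ (@fmap_proper_filter _ _ _ _ totally_filter) _ _ H2 H3).
Qed.

Let esumZ_le (I : choiceType) (c : R) (f : I -> \bar R) : 0 <= c ->
  (forall i, 0 <= f i)%E ->
  (\esum_(i in setT) (c%:E * f i) <= c%:E * \esum_(i in setT) f i)%E.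
Proof.
move=> c0 f0; apply: ge_ereal_sup => _ [F [finF _] <-].
rewrite -ge0_mule_fsumr//; apply: lee_wpmul2l; first by rewrite lee_fin.
by apply: ereal_sup_ubound; exists F.
Qed.

Let esumZ (I : choiceType) (c : R) (f : I -> \bar R) : 0 <= c ->
  (forall i, 0 <= f i)%E ->
  (\esum_(i in setT) (c%:E * f i) = c%:E * \esum_(i in setT) f i)%E.
Proof.
move=> c0 f0; apply/eqP; rewrite eq_le esumZ_le//=.
have [->|c_neq0] := eqVneq c 0.
  by rewrite mul0e; apply: esum_ge0 => i _; rewrite mul0e.
have cV : (c%:E * (c^-1)%:E = 1)%E by rewrite -EFinM divff.
have vc : ((c^-1)%:E * c%:E = 1)%E by rewrite muleC.
rewrite -[leRHS]mul1e -cV -muleA; apply: lee_wpmul2l; first by rewrite lee_fin.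
apply: le_trans (esumZ_le _ _); [|by rewrite invr_ge0|].
  by apply: le_esum => i _; rewrite muleA vc mul1e.
by move=> i; rewrite mule_ge0.
Qed.

(** By induction on [n], splitting off the first letter. Absolute convergence
    is obtained from the same recursion for the marks [cabs (w s)], whose sums
    are finite almost surely. *)
Lemma sum_word_term w : cL2 q2 w -> {ae Pi, forall x, forall n,
  (\esum_(t in setT) (cabs (word_term w (n := n) x t))%:E < +oo)%E /\
  asumC (word_term w (n := n) x) = yt A w n x}.
Proof.
move=> lw; pose aw s : R[i] := (cabs (w s))%:C.
have law : cL2 q2 aw.
  apply: (le_cL2 _ lw); first by apply: cmeas_real; apply: measurable_cabs; exact: lw.1.
  by move=> s; rewrite /aw cabs_real ger0_norm// cabs_ge0.
have [_ A0 _ _ _] := gA.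
suff H n : {ae Pi, forall x,
    (\esum_(t in setT) (cabs (word_term w (n := n) x t))%:E = (Cre (yt A aw n x))%:E)%E /\
    (Cim (yt A aw n x) = 0 /\ asumC (word_term w (n := n) x) = yt A w n x)}.
  apply/ae_foralln => n; apply: filterS (H n) => x [-> [_ ->]]; split=> //.
  exact: ltry.
elim: n => [|n IH].
  have e (f : 0.-tuple nat -> R) : 0 <= f [tuple] -> \esum_(t in setT) (f t)%:E = (f [tuple])%:E.
    move=> f0; rewrite (_ : setT = [set [tuple]]) ?esum_set1 ?lee_fin//.
    by apply/seteqP; split=> t //= _; exact: tuple0.
  have t0 x (t : 0.-tuple nat) : word_term w x t = 1 by rewrite /word_term big_ord0.
  apply: nearW => x; rewrite /yt/= /asumC /asum !e ?cabs_ge0 ?le_max ?lexx ?orbT// !t0.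
  rewrite cabs_real normr1; split=> //; split=> //.
  apply: complex_ext => /=; rewrite ?oppr0 ?subrr//.
  by rewrite (max_l ler01) max_r ?oppr_le0// subr0.
have re : {ae Pi, forall x, forall j,
    (\esum_(t in setT) (cabs (word_term w (n := n) (x \o tchild j) t))%:E =
      (Cre (yt A aw n (x \o tchild j)))%:E)%E /\
    (Cim (yt A aw n (x \o tchild j)) = 0 /\
     asumC (word_term w (n := n) (x \o tchild j)) = yt A w n (x \o tchild j))}.
  apply/ae_foralln => j.
  have m_re : measurable_fun setT (fun x : X => (x \o tchild j : X)).
    by apply: measurable_fam => i; exact: measurable_coord.
  have l_re : has_law Pi (fun x : X => (x \o tchild j : X)) Pi.
    by apply: fam_prod_reindex => [[u|u] [v|v]//= [->]|[]].
  exact: (has_law_ae m_re l_re IH).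
have ml := markless_yl A aw n (@markless_cst _ _ S 1).
have sumA := tbb_summable gA law (cL2_yt gA law n) ml.
have F : Filter (nbhs (almost_everywhere Pi)) by exact: ae_filter_ringOfSetsType.
apply: filterS2 re sumA => x rex sux.
pose c j := A (x (inl [::])) j * cabs (w (x (inr [:: j]))).
have c0 j : 0 <= c j by rewrite mulr_ge0// cabs_ge0.
pose E j := Cre (yt A aw n (x \o tchild j)).
have E0 j : 0 <= E j.
  have [e _] := rex j; rewrite -lee_fin -e; apply: esum_ge0 => t _.
  by rewrite lee_fin cabs_ge0.
have aE j : (A (x (inl [::])) j)%:C * (aw (x (inr [:: j])) * yt A aw n (x \o tchild j)) =
    (c j * E j)%:C.
  by have [_ [im0 _]] := rex j; apply: complex_ext; rewrite !(CreM, CimM)/= im0 /c /E; ring.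
have sux' : (\sum_(0 <= j <oo) (c j * E j)%:E < +oo)%E.
  apply: le_lt_trans sux; apply: lee_nneseries => [j _ _|j _].
    by rewrite lee_fin mulr_ge0.
  by rewrite aE cabs_real lee_fin ler_norm.
have absx j (t : n.-tuple nat) : (cabs (word_term w x [tuple of j :: t]) =
    c j * cabs (word_term w (n := n) (x \o tchild j) t))%R.
  by rewrite word_term_cons !cabsM cabs_real ger0_norm.
have sume : (\esum_(t in setT) (cabs (word_term w (n := n.+1) x t))%:E =
    \sum_(0 <= j <oo) (c j * E j)%:E)%E.
  rewrite esum_tupleS; last by move=> t; rewrite lee_fin cabs_ge0.
  apply: eq_eseriesr => j _; under eq_esum do rewrite absx EFinM.
  rewrite esumZ//; last by move=> t; rewrite lee_fin cabs_ge0.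
  by rewrite (rex j).1.
have fine_sum : (fun N => \sum_(0 <= j < N) (c j * E j)) @ \oo -->
    fine (\sum_(0 <= j <oo) (c j * E j)%:E)%E.
  have fins : (\sum_(0 <= j <oo) (c j * E j)%:E)%E \is a fin_num.
    rewrite ge0_fin_numE//; apply: nneseries_ge0 => j _ _; by rewrite lee_fin mulr_ge0.
  have H : (fun N => \sum_(0 <= j < N) (c j * E j)%:E)%E @ \oo --> (\sum_(0 <= j <oo) (c j * E j)%:E)%E.
    by apply: is_cvg_nneseries => j _ _; rewrite lee_fin mulr_ge0.
  rewrite -(fineK fins) in H; move/fine_cvgP : H => [_].
  by apply: cvg_trans; apply: near_eq_cvg; apply: nearW => N /=; rewrite sumEFin.
have awE : yt A aw n.+1 x = (fine (\sum_(0 <= j <oo) (c j * E j)%:E)%E)%:C.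
  rewrite -[LHS]/(Csum (fun j => (A (x (inl [::])) j)%:C *
    (aw (x (inr [:: j])) * yt A aw n (x \o tchild j)))).
  apply: Clim_cvg; apply/cvg_complexP; split.
    apply: cvg_trans fine_sum; apply: near_eq_cvg; apply: nearW => N /=.
    by rewrite Cre_sum; apply: eq_bigr => j _; rewrite aE.
  rewrite (_ : _ \o _ = fun=> 0); first exact: cvg_cst.
  by apply/funext => N /=; rewrite Cim_sum big1// => j _; rewrite aE.
have fine_oo : (\esum_(t in setT) (cabs (word_term w (n := n.+1) x t))%:E < +oo)%E.
  by rewrite sume.
split; [|split].
- rewrite sume awE/= fineK// ge0_fin_numE//.
  by apply: nneseries_ge0 => j _ _; rewrite lee_fin mulr_ge0.
- by rewrite awE.
apply: esym; apply: Clim_cvg; apply: cvg_trans (asumC_tupleS fine_oo).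
apply: near_eq_cvg; apply: nearW => N; apply: eq_bigr => j _ /=.
have [ej [_ aj]] := rex j.
rewrite (_ : (fun t : n.-tuple nat => word_term w x [tuple of j :: t]) = fun t : n.-tuple nat =>
  ((A (x (inl [::])) j)%:C * w (x (inr [:: j]))) * word_term w (n := n) (x \o tchild j) t); last first.
  by apply/funext => t; rewrite word_term_cons.
have foo : (\esum_(t in setT) (cabs (word_term w (n := n) (x \o tchild j) t))%:E < +oo)%E.
  by rewrite ej ltry.
rewrite asumCZ//; first by rewrite aj mulrA.
under eq_esum do rewrite cabsM cabsM cabs_real ger0_norm// EFinM.
rewrite (esumZ (c0 j)); last by move=> t; rewrite lee_fin cabs_ge0.
by rewrite ej -EFinM ltry.
Qed.

End ttree_limit.

(** * Laws on the complex plane and their moments *)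

Section complex_laws.
Context (R : realType).

Lemma ip_self d (T : measurableType d) (P : probability T R) (f : T -> R[i]) (s : R) :
  cL2 P f -> sqm P f = s%:E -> ip P f f = s%:C.
Proof.
move=> lf; rewrite sqm_ip// => -[e]; apply: complex_ext => //=.
have : Cim (ip P f f) = - Cim (ip P f f) by rewrite -CimJ -ipC.
by rewrite /ip/=; move: (Rintegral _ _ _) => y h; lra.
Qed.

Definition idC (z : borelC R) : R[i] := z.

Lemma cmeas_idC : cmeas idC.
Proof. by apply/cmeasP; exact: measurable_id. Qed.

Definition moments (mu : probability (borelC R) R) (s : R) :=
  [/\ cL2 mu idC, Ec mu idC = 1 & sqm mu idC = s%:E].

Section law_of.
Context d (T : measurableType d) (P : probability T R) (f : T -> R[i])
  (mu : probability (borelC R) R).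
Hypotheses (mf : cmeas f) (fmu : has_law P (f : T -> borelC R) mu).

Let mf' : measurable_fun setT (f : T -> borelC R). Proof. exact/cmeasP. Qed.

Lemma moments_law s : moments mu s <-> [/\ cL2 P f, Ec P f = 1 & sqm P f = s%:E].
Proof.
have m := cmeas_idC.
have e1 := sqm_law mf' fmu m; have e2 := Ec_law mf' fmu m.
rewrite -[idC \o f]/f in e1 e2.
by rewrite /moments /cL2 e1 e2; split=> -[[_ ?] ? ?]; split.
Qed.

End law_of.

Lemma calP_moments gamma mu : calP gamma mu ->
  exists s, [/\ 1 <= s, s <= gamma & moments mu s].
Proof.
move=> [re im lo up]; have m := cmeas_idC.
have fin : sqm mu idC \is a fin_num.
  by rewrite ge0_fin_numE ?sqm_ge0//; apply: le_lt_trans up _; exact: ltry.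
exists (fine (sqm mu idC)); rewrite -!lee_fin fineK//; split=> //; split=> //.
- by split=> //; rewrite -ge0_fin_numE ?sqm_ge0.
- by apply: complex_ext => /=; rewrite /Rintegral; [rewrite re|rewrite im].
- by rewrite fineK.
Qed.

Lemma moments_calP gamma mu s : 1 <= s -> s <= gamma -> moments mu s -> calP gamma mu.
Proof.
move=> s1 sg [l1 e2 e3]; have [ir ii] := cL2_cint l1.
have fin (g : borelC R -> R) : mu.-integrable setT (EFin \o g) ->
    (\int[mu]_z (g z)%:E)%E = ((\int[mu]_z g z)%R)%:E.
  by move=> ig; rewrite /Rintegral fineK//; exact: (integrable_fin_num measurableT ig).
split.
- by rewrite (fin _ ir); move: (congr1 Cre e2) => /= ->.
- by rewrite (fin _ ii); move: (congr1 Cim e2) => /= ->.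
- by rewrite -[X in (_ <= X)%E]/(sqm mu idC) e3 lee_fin.
- by rewrite -[X in (X <= _)%E]/(sqm mu idC) e3 lee_fin.
Qed.

End complex_laws.

(** * The transformation [T] *)

Section smoothing.
Context (R : realType) d0 (Omega0 : measurableType d0) (P0 : probability Omega0 R)
  (a : nat -> {RV P0 >-> R}) (alpha beta : R).

Lemma measurable_path_of d (Omega : measurableType d) (P : probability Omega R)
  (A : nat -> {RV P >-> R}) : measurable_fun setT (path_of A).
Proof. by apply: (@measurable_fam _ _ nat) => j; exact: measurable_funPT. Qed.

Definition path_law : probability (seqR R) R := law P0 (measurable_path_of a).

(** Absolute values make the weights nonnegative on the whole canonical
    space. *)
Definition abs_path (t : seqR R) (j : nat) : R := `|t j|.

Hypotheses (a_ge0 : forall j w, 0 <= a j w) (alpha1 : 1 <= alpha) (ab : alpha <= beta)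
  (ga : good_weights path_law abs_path ((alpha * beta + 1) / (alpha + beta)) (alpha + beta)^-1).

Notation S := (seqR R * (borelC R * borelC R))%type.
Notation tI := (seq nat + seq nat)%type.
Notation X := (famT S tI).

Definition AS (s : S) (j : nat) : R := abs_path s.1 j.

Lemma good_AS (q : probability S R) : has_law q fst path_law ->
  good_weights q AS ((alpha * beta + 1) / (alpha + beta)) (alpha + beta)^-1.
Proof.
move=> qf; exact: ((good_weights_law abs_path _ _ measurable_fst qf).1 ga).2.
Qed.

Lemma path_law_ge0 : {ae path_law, forall t, forall j, 0 <= t j}.
Proof.
apply/ae_foralln => j; exists [set t : seqR R | t j < 0]; split.
- have mj := @measurable_coord _ R nat j.
  rewrite -[X in measurable X]setTI; apply: (mj measurableT [set r | r < 0]).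
  by rewrite -set_itvNyo; exact: measurable_itv.
- rewrite -[LHS]/(P0 (path_of a @^-1` [set t : seqR R | t j < 0])).
  rewrite (_ : _ @^-1` _ = set0) ?measure0// -subset0 => w /=.
  by rewrite /path_of ltNge a_ge0.
- by move=> t /negP; rewrite -ltNge.
Qed.

Section canonical.
Context (q1 q2 : probability S R) (w : S -> R[i]) (mu : probability (borelC R) R) (s : R).
Hypotheses (q1a : has_law q1 fst path_law) (mw : cmeas w) (q2w : has_law q2 (w : S -> borelC R) mu)
  (mmu : moments mu s) (sK : s < alpha + beta).

Notation Pi := (fam_prod (tlaw q1 q2)).

Let gA := good_AS q1a.
Let lw : cL2 q2 w. Proof. by have [] := (moments_law mw q2w s).1 mmu. Qed.
Let ew : Ec q2 w = 1. Proof. by have [] := (moments_law mw q2w s).1 mmu. Qed.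
Let sw : ip q2 w w = s%:C.
Proof. by apply: ip_self => //; have [] := (moments_law mw q2w s).1 mmu. Qed.
Let s0 : 0 <= s.
Proof.
by have [_ _ e] := (moments_law mw q2w s).1 mmu; rewrite -lee_fin -e sqm_ge0.
Qed.

Let mw' : measurable_fun setT (w : S -> borelC R). Proof. exact/cmeasP. Qed.

Lemma measurable_ylim : measurable_fun setT (ylim AS w : X -> borelC R).
Proof. by apply/cmeasP; exact: (cmeas_ylim gA lw). Qed.

Definition ylim_law : probability (borelC R) R := law Pi measurable_ylim.

Let mcoord (i : tI) : measurable_fun setT (fun x : X => x i).
Proof. exact: measurable_coord. Qed.

Let mAu u j : measurable_fun setT (fun x : X => (x (inl u)).1 j).
Proof.
exact: (measurableT_comp (@measurable_coord _ R nat j)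
  (measurableT_comp measurable_fst (mcoord (inl u)))).
Qed.

Let mWu u : measurable_fun setT (fun x : X => w (x (inr u)) : borelC R).
Proof. exact: (measurableT_comp mw' (mcoord (inr u))). Qed.

(** The weights are almost surely nonnegative at all nodes, so that [AS] does
    not change the terms. *)
Lemma ae_word_sums : {ae Pi, forall x : X, forall n,
  sumC (fun u : n.-tuple nat => \prod_(k < n)
    (((x (inl (take k u))).1 (tnth u k))%:C * w (x (inr (take k.+1 u))))) =
  yt AS w n x}.
Proof.
have F : Filter (nbhs (almost_everywhere Pi)) by exact: ae_filter_ringOfSetsType.
have pos : {ae Pi, forall x : X, forall u j, 0 <= (x (inl u)).1 j}.
  have H (u : seq nat) : {ae Pi, forall x : X, forall j, 0 <= (x (inl u)).1 j}.
    have H1 : {ae q1, forall s : S, forall j, 0 <= s.1 j}.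
      exact: (has_law_ae measurable_fst q1a path_law_ge0).
    exact: (has_law_ae (mcoord (inl u)) (fam_prod_coord (tlaw q1 q2) (inl u)) H1).
  have H2 : {ae Pi, forall x : X, forall n, forall j, 0 <= (x (inl (odflt [::] (unpickle n)))).1 j}.
    by apply/ae_foralln => n; exact: H.
  apply: filterS H2 => x Hx u; have := Hx (pickle u); by rewrite pickleK.
have H := sum_word_term gA lw; apply: filterS2 pos H => x px sx n.
have [foo <-] := sx n; rewrite -sumC_asumC//; congr (sumC _); apply/funext => u.
apply: eq_bigr => k _; congr (_%:C * _).
by rewrite /AS /abs_path ger0_norm.
Qed.

Lemma T_exists : is_T a mu ylim_law.
Proof.
exists _, X, Pi, (fun u j => mkmfun (mAu u j)), (fun u => mkmfun (mWu u)), (mkmfun measurable_ylim).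
split.
- split=> u; last first.
    exact: (has_law_comp mw' (fam_prod_coord (tlaw q1 q2) (inr u)) q2w).
  exact: (has_law_comp measurable_fst (fam_prod_coord (tlaw q1 q2) (inl u)) q1a).
- apply: (@fam_prod_mutually_independent _ _ _ _ (tlaw q1 q2) _ setT (fun i => [set i])).
  + move=> [u|u] E; apply: generated_sigma_depends.
    * exact: (measurableT_comp measurable_fst (mcoord (inl u))).
    * by move=> x y xy; rewrite /path_of/= (xy (inl u)).
    * exact: mWu.
    * by move=> x y xy /=; rewrite (xy (inr u)).
  + by move=> k l kl; rewrite -subset0 => i [/= -> e]; rewrite e eqxx in kl.
- have F : Filter (nbhs (almost_everywhere Pi)) by exact: ae_filter_ringOfSetsType.
  have H := yt_cvg alpha1 ab gA lw ew sw s0 sK.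
  apply: filterS2 ae_word_sums H => x sx.
  by apply: cvg_trans; apply: near_eq_cvg; apply: nearW => n; rewrite -sx.
- exact: has_law_law.
Qed.

Lemma moments_ylim_law : moments ylim_law (alpha * beta / (alpha + beta - s)).
Proof.
apply/(moments_law (cmeas_ylim gA lw) (has_law_law Pi measurable_ylim)).
have ll := cL2_ylim alpha1 ab gA lw ew sw s0 sK.
split=> //; first exact: (Ec_ylim alpha1 ab gA lw ew sw s0 sK).
rewrite sqm_ip// (ip_ylim alpha1 ab gA lw ew sw s0 sK lw ew sw s0 sK sw s0 sK)//.
Qed.

End canonical.
End smoothing.

Lemma ae_eq_law (R : realType) d d' (T : measurableType d) (T' : measurableType d')
    (P : probability T R) (f g : T -> T') (mu : set T' -> \bar R) :
  measurable_fun setT f -> measurable_fun setT g ->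
  {ae P, forall x, f x = g x} -> has_law P f mu -> has_law P g mu.
Proof.
move=> mf mg fg fmu B mB; rewrite -fmu//.
have m h : measurable_fun setT (h : T -> T') -> measurable (h @^-1` B).
  by move=> mh; rewrite -[X in measurable X]setTI; exact: mh.
have e A : measurable A -> P A = (\int[P]_x (\1_A x)%:E)%E.
  by move=> mA; rewrite integral_indic// setIT.
rewrite (e _ (m _ mf)) (e _ (m _ mg)).
apply: ae_eq_integral => //.
- by apply/measurable_EFinP; apply: measurable_indic; exact: m.
- by apply/measurable_EFinP; apply: measurable_indic; exact: m.
by apply: filterS fg => x xfg _; rewrite !indicE; congr (_%:R%:E); congr nat_of_bool; apply/idP/idP; rewrite !inE /preimage/= xfg.
Qed.

(** Compares an arbitrary realization of independent families with the
    canonical one: [Xi] gathers the families and [g] is the functional of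
    interest. *)
Lemma law_of_function (R : realType) d d1 d2 (Omega : measurableType d)
    (T : measurableType d1) (T' : measurableType d2) (P : probability Omega R)
    (Q : probability T R) (Xi : Omega -> T) (g : T -> T') (Y : Omega -> T')
    (nu : set T' -> \bar R) :
  measurable_fun setT Xi -> has_law P Xi Q -> measurable_fun setT g ->
  measurable_fun setT Y -> {ae P, forall o, Y o = g (Xi o)} ->
  has_law P Y nu -> has_law Q g nu.
Proof.
move=> mX lX mg mY YX lY B mB.
rewrite -(ae_eq_law mY (measurableT_comp mg mX) YX lY mB) -lX//.
by rewrite -[X in measurable X]setTI; exact: mg.
Qed.

Lemma generated_sigma_preimage d d1 d2 (Omega : measurableType d)
    (T1 : measurableType d1) (T2 : measurableType d2)
    (f : Omega -> T1) (g : T1 -> T2) (B : set T2) :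
  measurable_fun setT g -> measurable B ->
  generated_sigma f ((fun o => g (f o)) @^-1` B).
Proof.
move=> mg mB; exists (g @^-1` B); last by rewrite setTI.
by rewrite -[X in measurable X]setTI; exact: mg.
Qed.

Section product_marginals.
Context (R : realType) d d' (T : measurableType d) (T' : measurableType d')
  (P : probability T R) (Q : probability T' R).

Lemma has_law_fst : has_law (P \x Q)%E fst P.
Proof.
move=> B mB; rewrite [LHS](_ : _ = (P \x Q)%E (B `*` setT)).
  by rewrite product_measure1E//= probability_setT mule1.
by congr (_ _); apply/seteqP; split=> x //= [].
Qed.

Lemma has_law_snd : has_law (P \x Q)%E snd Q.
Proof.
move=> B mB; rewrite [LHS](_ : _ = (P \x Q)%E (setT `*` B)).
  by rewrite product_measure1E//= probability_setT mul1e.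
by congr (_ _); apply/seteqP; split=> x //= [].
Qed.

End product_marginals.

Section uniqueness.
Context (R : realType) d0 (Omega0 : measurableType d0) (P0 : probability Omega0 R)
  (a : nat -> {RV P0 >-> R}) (alpha beta : R).
Hypotheses (a_ge0 : forall j w, 0 <= a j w) (alpha1 : 1 <= alpha) (ab : alpha <= beta)
  (ga : good_weights (path_law a) (@abs_path R)
     ((alpha * beta + 1) / (alpha + beta)) (alpha + beta)^-1).

Notation S := (seqR R * (borelC R * borelC R))%type.
Notation tI := (seq nat + seq nat)%type.
Notation X := (famT S tI).

(** A slot carries a sequence of weights and two marks, one for each law to be
    coupled. *)
Definition first_mark (s : S) : R[i] := s.2.1.
Definition second_mark (s : S) : R[i] := s.2.2.

Definition weight_slot (t : seqR R) : S := (t, ((0 : R[i]), (0 : R[i]))).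
Definition mark_slot (z : borelC R) : S := ((fun=> 0) : nat -> R, (z, (0 : R[i]))).

Lemma measurable_weight_slot : measurable_fun setT weight_slot.
Proof. by apply: measurable_fun_pair => //; exact: measurable_cst. Qed.

Lemma measurable_mark_slot : measurable_fun setT mark_slot.
Proof.
apply: measurable_fun_pair; first exact: measurable_cst.
by apply: measurable_fun_pair => //; exact: measurable_cst.
Qed.

Lemma cmeas_first_mark : cmeas first_mark.
Proof.
by apply/cmeasP; exact: (measurableT_comp measurable_fst measurable_snd).
Qed.

Lemma cmeas_second_mark : cmeas second_mark.
Proof.
by apply/cmeasP; exact: (measurableT_comp measurable_snd measurable_snd).
Qed.

Section one_law.
Context (mu : probability (borelC R) R) (s : R).
Hypotheses (mmu : moments mu s) (sK : s < alpha + beta).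

Let q1 := law (path_law a) measurable_weight_slot.
Let q2 := law mu measurable_mark_slot.

Let q1a : has_law q1 fst (path_law a). Proof. by []. Qed.
Let q2w : has_law q2 (first_mark : S -> borelC R) mu. Proof. by []. Qed.

Notation Pi := (fam_prod (tlaw q1 q2)).

Let m_ylim : measurable_fun setT (ylim (@AS R) first_mark : X -> borelC R).
Proof. exact: (measurable_ylim ga q1a cmeas_first_mark q2w mmu). Qed.

(** All realizations of the two families have the same joint law, and the
    limit is almost surely the same function of them. *)
Lemma is_T_law nu : is_T a mu nu -> has_law Pi (ylim (@AS R) first_mark : X -> borelC R) nu.
Proof.
case=> d; case=> Omega; case=> P; case=> A; case=> W; case=> Y [[cA lW] ind YY lY].
pose Xi (o : Omega) : X := fun i => match i with
  | inl u => weight_slot (path_of (A u) o)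
  | inr u => mark_slot (W u o) end.
have mA u : measurable_fun setT (path_of (A u)) by exact: measurable_path_of.
have mXi i : measurable_fun setT (fun o => Xi o i).
  case: i => u.
    exact: (measurableT_comp measurable_weight_slot (mA u)).
  exact: (measurableT_comp measurable_mark_slot (@measurable_funPT _ _ _ _ (W u))).
have mXi' : measurable_fun setT Xi by exact: measurable_fam.
have lXi : has_law P Xi Pi.
  apply: has_law_fam_prod ind => //.
  - case=> u.
      have cAu : has_law P (path_of (A u)) (path_law a) := cA u.
      exact: (has_law_comp measurable_weight_slot cAu (has_law_law _ _)).
    exact: (has_law_comp measurable_mark_slot (lW u) (has_law_law _ _)).
  - move=> [u|u] B mB.
      exact: (generated_sigma_preimage (path_of (A u)) measurable_weight_slot mB).
    exact: (generated_sigma_preimage (W u) measurable_mark_slot mB).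
have [_ ew ssq] := (moments_law cmeas_first_mark q2w s).1 mmu.
have lw : cL2 q2 first_mark by have [] := (moments_law cmeas_first_mark q2w s).1 mmu.
have s0 : 0 <= s by rewrite -lee_fin -ssq sqm_ge0.
have c1 : {ae P, forall o, forall n, Y_ A W n o = yt (@AS R) first_mark n (Xi o)}.
  exact: (has_law_ae mXi' lXi (ae_word_sums a_ge0 ga q1a cmeas_first_mark q2w mmu)).
have c2 : {ae P, forall o, (fun n => yt (@AS R) first_mark n (Xi o) : R[i]^o) @ \oo -->
    (ylim (@AS R) first_mark (Xi o) : R[i]^o)}.
  exact: (has_law_ae mXi' lXi
    (yt_cvg alpha1 ab (good_AS ga q1a) lw ew (ip_self lw ssq) s0 sK)).
have YX : {ae P, forall o, Y o = ylim (@AS R) first_mark (Xi o) :> R[i]}.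
  have F := ae_filter_ringOfSetsType P.
  apply: (@filterS3 _ _ F _ _ _ _ _ c1 c2 YY) => o e h1 h2.
  exact: (cvg_complex_unique e h2 h1).
exact: (law_of_function (T' := borelC R) mXi' lXi m_ylim (@measurable_funPT _ _ _ _ Y) YX lY).
Qed.

Lemma is_T_unique nu nu' : is_T a mu nu -> is_T a mu nu' -> nu ≡μ nu'.
Proof.
by move=> /is_T_law h /is_T_law h' B mB; exact: etrans (esym (h B mB)) (h' B mB).
Qed.

Lemma is_T_T : is_T a mu (T a mu).
Proof.
suff H : exists nu, is_T a mu nu by exact: (@xgetPex _ (Defs.dirac0 R) [set nu | is_T a mu nu] H).
exists (ylim_law ga q1a cmeas_first_mark q2w mmu).
exact: (T_exists a_ge0 alpha1 ab).
Qed.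

(** The slots of the canonical tree may carry further independent data; this
    freedom is used to couple two images and to plant leaves. *)
Lemma T_law (r1 r2 : probability S R) (w : S -> R[i]) :
  has_law r1 fst (path_law a) -> cmeas w -> has_law r2 (w : S -> borelC R) mu ->
  has_law (fam_prod (tlaw r1 r2)) (ylim (@AS R) w : X -> borelC R) (T a mu).
Proof.
move=> r1a mw r2w B mB.
have /(is_T_unique is_T_T) -> // := T_exists a_ge0 alpha1 ab ga r1a mw r2w mmu sK.
Qed.

Lemma moments_T : moments (T a mu) (alpha * beta / (alpha + beta - s)).
Proof.
have [l1 e2 e3] := moments_ylim_law alpha1 ab ga q1a cmeas_first_mark q2w mmu sK.
have e := is_T_unique is_T_T (T_exists a_ge0 alpha1 ab ga q1a cmeas_first_mark q2w mmu sK).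
apply/(moments_law (f := @idC R) (cmeas_idC R) (P := ylim_law ga q1a cmeas_first_mark q2w mmu)) => //.
by move=> B mB; rewrite e.
Qed.

End one_law.

Definition cov (rho : probability (borelC R * borelC R)%type R) : R[i] :=
  ip rho (fun z => z.1 : R[i]) (fun z => z.2 : R[i]).

(** Smooth both coordinates of a coupling along the same weights: the pair of
    limits couples the images, and its covariance is given by [ip_ylim]. *)
Lemma T_coupling (mu nu : probability (borelC R) R) (s s' u : R) rho :
  moments mu s -> s < alpha + beta -> moments nu s' -> s' < alpha + beta ->
  coupling mu nu rho -> cov rho = u%:C -> 0 <= u -> u < alpha + beta ->
  exists2 rho', coupling (T a mu) (T a nu) rho' &
    cov rho' = (alpha * beta / (alpha + beta - u))%:C.
Proof.
move=> mmu sK mnu sK' [rho1 rho2] rhou u0 uK.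
pose q : probability S R := (path_law a \x rho)%E.
have qa : has_law q fst (path_law a) := has_law_fst _ _.
have qr : has_law q snd rho := has_law_snd _ _.
have q1 : has_law q (first_mark : S -> borelC R) mu.
  exact: (has_law_comp measurable_fst qr rho1).
have q2 : has_law q (second_mark : S -> borelC R) nu.
  exact: (has_law_comp measurable_snd qr rho2).
have m1 := cmeas_first_mark; have m2 := cmeas_second_mark.
have l1 := measurable_ylim ga qa m1 q1 mmu.
have l2 := measurable_ylim ga qa m2 q2 mnu.
pose Pi := fam_prod (tlaw q q).
have mp : measurable_fun setT (fun x : X =>
    (ylim (@AS R) first_mark x : borelC R, ylim (@AS R) second_mark x : borelC R)).
  exact: measurable_fun_pair.
exists (law Pi mp).
  by split; [exact: (T_law mmu sK qa m1 q1)|exact: (T_law mnu sK' qa m2 q2)].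
have [lw1 ew1 sw1] := (moments_law m1 q1 s).1 mmu.
have [lw2 ew2 sw2] := (moments_law m2 q2 s').1 mnu.
have s0 : 0 <= s by rewrite -lee_fin -sw1 sqm_ge0.
have s0' : 0 <= s' by rewrite -lee_fin -sw2 sqm_ge0.
have c1 : cmeas (fun z : borelC R * borelC R => z.1 : R[i]) by apply/cmeasP; exact: measurable_fst.
have c2 : cmeas (fun z : borelC R * borelC R => z.2 : R[i]) by apply/cmeasP; exact: measurable_snd.
have uw : ip q first_mark second_mark = u%:C.
  by rewrite -rhou /cov -(ip_law measurable_snd qr c1 c2).
rewrite /cov -(ip_law mp (has_law_law _ _) c1 c2).
exact: (ip_ylim alpha1 ab (good_AS ga qa) lw1 ew1 (ip_self lw1 sw1) s0 sK
  lw2 ew2 (ip_self lw2 sw2) s0' sK' uw u0 uK).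
Qed.

End uniqueness.

(** * The law [M] and the quadratic equation *)

Section quadratic_images.
Context (R : realType) d0 (Omega0 : measurableType d0) (P0 : probability Omega0 R)
  (a : nat -> {RV P0 >-> R}).

Notation S := (seqR R * (borelC R * borelC R))%type.
Notation qI := (option (nat + nat)).
Notation X := (famT S qI).

Definition quadratic_sum (x : X) : R[i] := Csum (fun j =>
  ((x None).1 j)%:C * first_mark (x (Some (inl j))) * first_mark (x (Some (inr j)))).

Lemma cmeas_quadratic_sum : cmeas quadratic_sum.
Proof.
apply: cmeas_Csum => j; have m := cmeas_first_mark R.
apply: cmeasM; last exact: (cmeas_comp (@measurable_coord _ S qI _) m).
apply: cmeasM; last exact: (cmeas_comp (@measurable_coord _ S qI _) m).
apply: cmeas_real; exact: (measurableT_comp (@measurable_coord _ R nat j)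
  (measurableT_comp measurable_fst (@measurable_coord _ S qI None))).
Qed.

Section one_law.
Context (mu : probability (borelC R) R).

Definition quadratic_slots (i : qI) : probability S R :=
  if i is None then law (path_law a) (@measurable_weight_slot R)
  else law mu (@measurable_mark_slot R).

Lemma is_quadratic_image_law nu : is_quadratic_image a mu nu ->
  has_law (fam_prod quadratic_slots) (quadratic_sum : X -> borelC R) nu.
Proof.
case=> d; case=> Omega; case=> P; case=> A; case=> W; case=> W'; case=> Y.
move=> [[cA lW lW'] ind YY lY].
have cA' : has_law P (path_of A) (path_law a) := cA.
pose Xi (o : Omega) : X := fun i => match i with
  | None => weight_slot (path_of A o)
  | Some (inl j) => mark_slot (W j o)
  | Some (inr j) => mark_slot (W' j o) end.
have mA : measurable_fun setT (path_of A) by exact: measurable_path_of.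
have mw := @measurable_weight_slot R; have mm := @measurable_mark_slot R.
have mXi i : measurable_fun setT (fun o => Xi o i).
  case: i => [[j|j]|].
  - exact: (measurableT_comp mm (@measurable_funPT _ _ _ _ (W j))).
  - exact: (measurableT_comp mm (@measurable_funPT _ _ _ _ (W' j))).
  - exact: (measurableT_comp mw mA).
have mXi' : measurable_fun setT Xi by exact: measurable_fam.
have lXi : has_law P Xi (fam_prod quadratic_slots).
  apply: has_law_fam_prod ind => //.
  - case=> [[j|j]|].
    + exact: (has_law_comp mm (lW j) (has_law_law _ _)).
    + exact: (has_law_comp mm (lW' j) (has_law_law _ _)).
    + exact: (has_law_comp mw cA' (has_law_law _ _)).
  - move=> [[j|j]|] B mB.
    + exact: (generated_sigma_preimage (W j) mm mB).
    + exact: (generated_sigma_preimage (W' j) mm mB).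
    + exact: (generated_sigma_preimage (path_of A) mw mB).
have YX : {ae P, forall o, Y o = quadratic_sum (Xi o) :> R[i]}.
  by apply: filterS YY => o /totally_cvg_seq /Clim_cvg.
have mq : measurable_fun setT (quadratic_sum : X -> borelC R).
  by apply/cmeasP; exact: cmeas_quadratic_sum.
exact: (law_of_function (T' := borelC R) mXi' lXi mq (@measurable_funPT _ _ _ _ Y) YX lY).
Qed.

(** Both are the law of [quadratic_sum] on the canonical space. *)
Lemma is_quadratic_image_unique nu nu' :
  is_quadratic_image a mu nu -> is_quadratic_image a mu nu' -> nu ≡μ nu'.
Proof.
move=> /is_quadratic_image_law h /is_quadratic_image_law h' B mB.
exact: etrans (esym (h B mB)) (h' B mB).
Qed.

End one_law.
End quadratic_images.

Lemma mutually_independent_reindex (R : realType) d (Omega : measurableType d)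
    (P : probability Omega R) (K I : choiceType) (D : set I)
    (F : I -> set_system Omega) (e : K -> I) (g : I -> K) :
  cancel e g -> (forall k, D (e k)) -> mutually_independent P D F ->
  mutually_independent P setT (F \o e).
Proof.
move=> eK De ind J E _ FE.
have eI : injective e by exact: can_inj eK.
have H := ind [fset e k | k in J]%fset (E \o g).
have -> : \bigcap_(k in [set` J]) E k =
    \bigcap_(i in [set` [fset e k | k in J]%fset]) (E \o g) i.
  apply/seteqP; split=> x h.
    by move=> _ /imfsetP[k /= kJ ->]; rewrite eK; exact: h.
  by move=> k kJ; have /= := h (e k); rewrite eK; apply; apply/imfsetP; exists k.
rewrite H; first last.
- by move=> _ /imfsetP[k /= kJ ->] /=; rewrite eK; exact: FE.
- by move=> _ /imfsetP[k /= kJ ->]; exact: De.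
rewrite big_imfset/=; last by move=> k k' _ _; exact: eI.
by apply: eq_bigr => k _; rewrite eK.
Qed.

Section limit_law.
Context (R : realType) d0 (Omega0 : measurableType d0) (P0 : probability Omega0 R)
  (a : nat -> {RV P0 >-> R}) (alpha beta : R).
Hypotheses (a_ge0 : forall j w, 0 <= a j w) (alpha1 : 1 <= alpha) (ab : alpha <= beta)
  (ga : good_weights (path_law a) (@abs_path R)
     ((alpha * beta + 1) / (alpha + beta)) (alpha + beta)^-1).

Notation mwordT := (seq (nat * bool)%type).
Notation X := (famT (seqR R) mwordT).
Notation Pi := (fam_prod (fun _ : mwordT => path_law a)).
Notation zt := (zt (@abs_path R)).
Notation zlim := (zlim (@abs_path R)).

(** [Z_] read on the canonical space. *)
Fixpoint path_Z (x : X) (n : nat) (l : mwordT) : \bar R :=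
  if n is n'.+1 then
    (\sum_(0 <= j <oo) (x l j)%:E * path_Z x n' (rcons l (j, false)) *
       path_Z x n' (rcons l (j, true)))%E
  else 1%E.

Let m_re (t : mwordT -> mwordT) : measurable_fun setT (fun x : X => (x \o t : X)).
Proof. by apply: measurable_fam => i; exact: measurable_coord. Qed.

Let l_re (t : mwordT -> mwordT) : injective t ->
  has_law Pi (fun x : X => (x \o t : X)) Pi.
Proof. by move=> ti; exact: fam_prod_reindex. Qed.

Lemma ae_path_ge0 : {ae Pi, forall x : X, forall l j, 0 <= x l j}.
Proof.
have H (l : mwordT) : {ae Pi, forall x : X, forall j, 0 <= x l j}.
  exact: (has_law_ae (@measurable_coord _ (seqR R) mwordT l)
    (fam_prod_coord (fun=> path_law a) l) (path_law_ge0 a_ge0)).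
have H2 : {ae Pi, forall x : X, forall n, forall j, 0 <= x (odflt [::] (unpickle n)) j}.
  by apply/ae_foralln => n; exact: H.
by apply: filterS H2 => x Hx l; have := Hx (pickle l); rewrite pickleK.
Qed.

Let FP := ae_filter_ringOfSetsType Pi.

(** By induction on [n], at all nodes at once: the series over the children
    converge almost surely at each of the countably many nodes. *)
Lemma ae_path_Z n : {ae Pi, forall x : X, path_Z x n [::] = (Cre (zt n x))%:E}.
Proof.
suff H l : {ae Pi, forall x : X, path_Z x n l = (Cre (zt n (x \o cat l)))%:E}.
  apply: filterS (H [::]) => x ->; congr (Cre (zt n _))%:E.
elim: n l => [|n IH] l; first by apply: nearW.
have catI : injective (cat l) by move=> u v /eqP; rewrite eqseq_cat// eqxx => /eqP.
have H1 : {ae Pi, forall x : X, forall j,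
    path_Z x n (rcons l (j, false)) = (Cre (zt n ((x \o cat l) \o mchild false j)))%:E /\
    path_Z x n (rcons l (j, true)) = (Cre (zt n ((x \o cat l) \o mchild true j)))%:E}.
  apply/ae_foralln => j.
  have e b (x : X) : x \o cat (rcons l (j, b)) = (x \o cat l) \o mchild b j.
    by apply/funext => u /=; rewrite cat_rcons.
  apply: (@filterS2 _ _ FP _ _ _ _ (IH (rcons l (j, false))) (IH (rcons l (j, true)))).
  by move=> x; rewrite !e.
have H2 := has_law_ae (m_re (cat l)) (l_re catI) (mbb_summable ga (cL2_zt ga n) (cL2_zt ga n)).
have H3 : {ae Pi, forall x : X, (forall k j, 0 <= x k j) /\ forall k, (0 <= path_Z x n k)%E}.
  apply: filterS ae_path_ge0 => x x0; split=> //.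
  elim: {IH H1 H2} n => [|n IH] k //=.
  by apply: nneseries_ge0 => j _ _; rewrite !mule_ge0// lee_fin.
apply: (@filterS3 _ _ FP _ _ _ _ _ H1 H2 H3) => x {}H1 {}H2 [x0 Z0].
pose f j := x l j * Cre (zt n ((x \o cat l) \o mchild false j)) *
  Cre (zt n ((x \o cat l) \o mchild true j)).
have f0 j : 0 <= f j.
  have [e1 e2] := H1 j; rewrite /f !mulr_ge0// -lee_fin; [rewrite -e1|rewrite -e2]; exact: Z0.
rewrite -[LHS]/(\sum_(0 <= j <oo) (x l j)%:E * path_Z x n (rcons l (j, false)) *
       path_Z x n (rcons l (j, true)))%E.
have -> : (\sum_(0 <= j <oo) (x l j)%:E * path_Z x n (rcons l (j, false)) *
       path_Z x n (rcons l (j, true)))%E = (\sum_(0 <= j <oo) (f j)%:E)%E.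
  by apply: eq_eseriesr => j _; have [-> ->] := H1 j; rewrite -!EFinM.
have c := cvg_Csum H2.
have fE j : Cre ((abs_path ((x \o cat l) [::]) j)%:C *
    (zt n ((x \o cat l) \o mchild false j) * zt n ((x \o cat l) \o mchild true j))) = f j.
  rewrite !(CreM, CimM) !Cim_zt/= cats0 /abs_path ger0_norm// /f; ring.
have c2 : (fun N => \sum_(0 <= j < N) f j) @ \oo --> Cre (zt n.+1 (x \o cat l)).
  move/cvg_complexP : c => [c _]; apply: cvg_trans c; apply: near_eq_cvg; apply: nearW => N /=.
  by rewrite Cre_sum; apply: eq_bigr => j _; rewrite fE.
apply: cvg_lim => //.
rewrite (_ : (fun N => _) = EFin \o (fun N => \sum_(0 <= j < N) f j)).
  by apply: cvg_EFin => //; exact: nearW.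
by apply/funext => N /=; rewrite sumEFin.
Qed.

Lemma measurable_zlim : measurable_fun setT (zlim : X -> borelC R).
Proof. by apply/cmeasP; exact: (cL2_zlim alpha1 ab ga).1. Qed.

Lemma is_M_law nu : is_M a nu -> has_law Pi (zlim : X -> borelC R) nu.
Proof.
case=> d; case=> Omega; case=> P; case=> A; case=> Z [cA ind ZZ lZ].
pose Xi (o : Omega) : X := fun l => path_of (A (unzip1 l) (unzip2 l)) o.
have mXi i : measurable_fun setT (fun o => Xi o i) by exact: measurable_path_of.
have mXi' : measurable_fun setT Xi by exact: measurable_fam.
have lXi : has_law P Xi Pi.
  pose e (l : mwordT) := (unzip1 l, unzip2 l).
  have eK : cancel e (fun i => zip i.1 i.2) by move=> l; exact: zip_unzip.
  have De l : [set i : seq nat * seq bool | size i.1 = size i.2] (e l).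
    by rewrite /= !size_map.
  apply: has_law_fam_prod (mutually_independent_reindex eK De ind) => // [l|l B mB].
    by apply: cA; exact: De.
  by exists B => //; rewrite setTI.
have ZE (o : Omega) n l : Z_ A n (unzip1 l) (unzip2 l) o = path_Z (Xi o) n l.
  elim: n l => //= n IH l; apply: eq_eseriesr => j _.
  by rewrite -!IH /unzip1 /unzip2 !map_rcons.
have c1 : {ae P, forall o, forall n, path_Z (Xi o) n [::] = (Cre (zt n (Xi o)))%:E}.
  by apply/ae_foralln => n; exact: (has_law_ae mXi' lXi (ae_path_Z n)).
have c2 := has_law_ae mXi' lXi (zt_cvg alpha1 ab ga).
have FO := ae_filter_ringOfSetsType P.
have YX : {ae P, forall o, (Z o)%:C = zlim (Xi o) :> R[i]}.
  apply: (@filterS3 _ _ FO _ _ _ _ _ c1 c2 ZZ) => o e /cvg_complexP[h1 _] h2.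
  apply: complex_ext; last by rewrite Cim_zlim.
  have h3 : (fun n => (Cre (zt n (Xi o)))%:E) @ \oo --> (Z o)%:E.
    by apply: cvg_trans h2; apply: near_eq_cvg; apply: nearW => n; rewrite -e -ZE.
  by move/fine_cvgP : h3 => [_ h3]; exact: (cvg_unique _ h3 h1).
have mZ : measurable_fun setT (fun o => (Z o)%:C : borelC R).
  by apply/cmeasP; apply: cmeas_real; exact: measurable_funPT.
exact: (law_of_function (T' := borelC R) mXi' lXi measurable_zlim mZ YX lZ).
Qed.

End limit_law.

Section limit_measure.
Context (R : realType) d0 (Omega0 : measurableType d0) (P0 : probability Omega0 R)
  (a : nat -> {RV P0 >-> R}) (alpha beta : R).
Hypotheses (a_ge0 : forall j w, 0 <= a j w) (alpha1 : 1 <= alpha) (ab : alpha <= beta)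
  (ga : good_weights (path_law a) (@abs_path R)
     ((alpha * beta + 1) / (alpha + beta)) (alpha + beta)^-1).

Notation mwordT := (seq (nat * bool)%type).
Notation X := (famT (seqR R) mwordT).
Notation Pi := (fam_prod (fun _ : mwordT => path_law a)).
Notation zt := (zt (@abs_path R)).
Notation zlim := (zlim (@abs_path R)).

Let FP := ae_filter_ringOfSetsType Pi.

(* The families of [is_M] are also indexed by pairs of words of different
   lengths, where the weights are set to 0. *)
Let node (u : seq nat) (m : seq bool) (j : nat) (x : X) : R :=
  if size u == size m then x (zip u m) j else 0.

Let m_node u m j : measurable_fun setT (node u m j).
Proof.
rewrite /node; case: eqP => _; last exact: measurable_cst.
exact: (measurableT_comp (@measurable_coord _ R nat j) (@measurable_coord _ (seqR R) mwordT _)).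
Qed.

Let m_limit : measurable_fun setT (fun x : X => Cre (zlim x)).
Proof. exact: (cL2_zlim alpha1 ab ga).1.1. Qed.

Lemma is_M_zlim : is_M a (law Pi (measurable_zlim alpha1 ab ga)).
Proof.
exists _, X, Pi, (fun u m j => mkmfun (m_node u m j)), (mkmfun m_limit).
split.
- move=> u m um; rewrite /copy_of (_ : path_of _ = (fun x : X => x (zip u m))).
    exact: (fam_prod_coord (fun _ : mwordT => path_law a) (zip u m)).
  by apply/funext => x; apply/funext => j; rewrite /path_of/= /node um eqxx.
- apply: (@fam_prod_mutually_independent _ _ _ _ (fun _ : mwordT => path_law a) _ _
    (fun i => [set l | size i.1 = size i.2 /\ l = zip i.1 i.2])).
  + move=> [u m] E /=; apply: generated_sigma_depends.
      exact: measurable_path_of.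
    move=> x y xy; apply/funext => j; rewrite /path_of/= /node.
    by case: eqP => // um; rewrite xy.
  + move=> [u m] [u' m'] /eqP ne; rewrite -subset0 => l [/= [e1 ->] [e2 e3]].
    apply: ne; have := congr1 unzip1 e3; have := congr1 unzip2 e3.
    by rewrite !unzip2_zip ?e1 ?e2// !unzip1_zip ?e1 ?e2// => -> ->.
- have ZE (x : X) n l : Z_ (P := Pi) (fun u m j => mkmfun (m_node u m j)) n (unzip1 l) (unzip2 l) x =
      path_Z x n l.
    elim: n l => //= n IH l; apply: eq_eseriesr => j _.
    rewrite -!IH /unzip1 /unzip2 !map_rcons; congr (_%:E * _ * _)%E.
    by rewrite /= /node !size_map eqxx -/(unzip1 l) -/(unzip2 l) zip_unzip.
  have c1 : {ae Pi, forall x : X, forall n, path_Z x n [::] = (Cre (zt n x))%:E}.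
    by apply/ae_foralln => n; exact: (ae_path_Z a_ge0 ga).
  apply: (@filterS2 _ _ FP _ _ _ _ c1 (zt_cvg alpha1 ab ga)) => x e /cvg_complexP[h1 _].
  rewrite (_ : (fun n => _) = EFin \o (fun n => Cre (zt n x))).
    by apply: cvg_EFin => //; exact: nearW.
  by apply/funext => n /=; rewrite -e -ZE.
- rewrite (_ : (fun w => _) = (zlim : X -> borelC R)); first exact: has_law_law.
  by apply/funext => x; apply: complex_ext; [|rewrite Cim_zlim].
Qed.

Lemma M_law : has_law Pi (zlim : X -> borelC R) (M a).
Proof.
apply: (is_M_law a_ge0 alpha1 ab ga).
suff H : exists nu, is_M a nu by exact: (@xgetPex _ (Defs.dirac0 R) [set nu | is_M a nu] H).
by exists (law Pi (measurable_zlim alpha1 ab ga)); exact: is_M_zlim.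
Qed.

Lemma moments_M : moments (M a) alpha.
Proof.
apply/(moments_law (cL2_zlim alpha1 ab ga).1 M_law); split.
- exact: (cL2_zlim alpha1 ab ga).
- exact: (Ec_zlim alpha1 ab ga).
- exact: (sqm_zlim alpha1 ab ga).
Qed.

Let mz : measurable_fun setT (zlim : X -> borelC R) := measurable_zlim alpha1 ab ga.

Let m_re (t : mwordT -> mwordT) : measurable_fun setT (fun x : X => (x \o t : X)).
Proof. by apply: measurable_fam => i; exact: measurable_coord. Qed.

Let mzre b j : measurable_fun setT (fun x : X => zlim (x \o mchild b j) : borelC R).
Proof. exact: (measurableT_comp mz (m_re (mchild b j))). Qed.

Let mroot j : measurable_fun setT (fun x : X => x [::] j).
Proof.
exact: (measurableT_comp (@measurable_coord _ R nat j) (@measurable_coord _ (seqR R) mwordT _)).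
Qed.

(** The two subtrees at each child of the root carry independent copies of
    the limit. *)
Lemma quadratic_image_M : is_quadratic_image a (M a) (M a).
Proof.
exists _, X, Pi, (fun j => mkmfun (mroot j)), (fun j => mkmfun (mzre false j)),
  (fun j => mkmfun (mzre true j)), (mkmfun mz).
have lre b j : has_law Pi (fun x : X => zlim (x \o mchild b j) : borelC R) (M a).
  apply: (has_law_comp mz _ M_law).
  by apply: fam_prod_reindex => // u v [].
split.
- split; [|by move=> j; exact: lre..].
  exact: (fam_prod_coord (fun _ : mwordT => path_law a) [::]).
- pose J (i : option (nat + nat)) : set mwordT := match i with
    | None => [set [::]]
    | Some (inl j) => [set l | head (0, true) l = (j, false)]%N
    | Some (inr j) => [set l | ohead l = Some (j, true)] end.
  apply: (@fam_prod_mutually_independent _ _ _ _ (fun _ : mwordT => path_law a) _ _ J).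
  + move=> [[j|j]|] E; apply: generated_sigma_depends.
    * exact: mzre.
    * move=> x y xy /=; rewrite (_ : x \o _ = y \o mchild false j)//.
      by apply/funext => u; exact: xy.
    * exact: mzre.
    * move=> x y xy /=; rewrite (_ : x \o _ = y \o mchild true j)//.
      by apply/funext => u; exact: xy.
    * exact: measurable_path_of.
    * by move=> x y xy; rewrite /path_of/= (xy [::]).
  + move=> [[j|j]|] [[k|k]|] ne; rewrite -subset0 => -[|[i b] l] //= [] //.
    * by move=> [-> _] [e _]; rewrite e eqxx in ne.
    * by move=> [_ ->] [].
    * by move=> [_ ->] [].
    * by move=> [-> _] [e]; rewrite e eqxx in ne.
- have lz := cL2_zlim alpha1 ab ga.
  apply: (@filterS3 _ _ FP _ _ _ _ _ (ae_path_ge0 a_ge0) (mbb_summable ga lz lz)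
    (zlim_fixed alpha1 ab ga)) => x x0 sx fx /=.
  have e j : (abs_path (x [::]) j)%:C * (zlim (x \o mchild false j) * zlim (x \o mchild true j)) =
     (x [::] j)%:C * zlim (x \o mchild false j) * zlim (x \o mchild true j).
    by rewrite mulrA /abs_path ger0_norm.
  apply: cvg_totally_abs; first by under eq_eseriesr do rewrite -e.
  rewrite fx; have := cvg_Csum sx; apply: cvg_trans; apply: near_eq_cvg; apply: nearW => n.
  by apply: eq_bigr => j _; rewrite e.
- exact: M_law.
Qed.

End limit_measure.

(** * Couplings of small cost *)

Section close_couplings.
Context (R : realType).

Definition cost (rho : probability (borelC R * borelC R)%type R) : \bar R :=
  sqm rho (fun z => (z.1 : R[i]) - (z.2 : R[i])).

Let ball_compl (O : set (borelC R)) (k : nat) : set (borelC R) :=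
  \bigcup_(y in ~` O) (ball (y : R[i]^o) (k.+1%:R^-1)%:C).

Let measurable_open (O : set R[i]^o) : open O -> measurable (O : set (borelC R)).
Proof. by move=> oO; exact: sub_sigma_algebra. Qed.

Let measurable_ball_compl O k : measurable (ball_compl O k).
Proof. by apply: measurable_open; apply: bigcup_open => y _; exact: ball_open. Qed.

Let ball_cabs (y z : R[i]) (r : R) : ball (y : R[i]^o) r%:C z <-> cabs (y - z) < r.
Proof. by rewrite /ball/= norm_cabs ltcR. Qed.

Let le_open (mu nu : probability (borelC R) R) (O : set R[i]^o) :
  (forall e, 0 < e -> exists2 rho, coupling mu nu rho & (cost rho <= e%:E)%E) ->
  open O -> (mu (O : set (borelC R)) <= nu (O : set (borelC R)))%E.
Proof.
move=> H oO; have mO := measurable_open oO.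
pose F k := ~` ball_compl O k.
have mF k : measurable (F k) by apply: measurableC; exact: measurable_ball_compl.
have leF k : (mu (F k) <= nu (O : set (borelC R)))%E.
  apply/lee_addgt0Pr => e e0.
  have k0 : 0 < k.+1%:R ^+ 2 :> R by rewrite exprn_gt0.
  have [rho [rho1 rho2] crho] := H (e / k.+1%:R ^+ 2) (divr_gt0 e0 k0).
  pose A : set (borelC R * borelC R) := fst @^-1` F k `&` snd @^-1` (~` O).
  have mA : measurable A.
    apply: measurableI; rewrite -[X in measurable X]setTI.
      by apply: measurable_fst.
    by apply: measurable_snd => //; exact: measurableC.
  have mdiff : cmeas (fun z : borelC R * borelC R => (z.1 : R[i]) - (z.2 : R[i])).
    by apply: cmeasB; apply/cmeasP; [exact: measurable_fst|exact: measurable_snd].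
  have rA : (rho A <= e%:E)%E.
    rewrite -(setIT A) -integral_indic//.
    apply: (@le_trans _ _ ((k.+1%:R ^+ 2)%:E * cost rho)%E); last first.
      apply: (@le_trans _ _ ((k.+1%:R ^+ 2)%:E * (e / k.+1%:R ^+ 2)%:E)%E).
        by apply: lee_wpmul2l => //; rewrite lee_fin ltW.
      by rewrite -EFinM mulrCA divff ?mulr1// gt_eqF.
    rewrite /cost /sqm -ge0_integralZl_EFin//; last 2 first.
    - by move=> z _; rewrite lee_fin sqr_ge0.
    - exact: measurable_sqr_cabs.
    apply: ge0_le_integral => //=.
    - by apply/measurable_EFinP; exact: measurable_indic.
    - by apply: emeasurable_funM => //; exact: measurable_sqr_cabs.
    move=> z _; rewrite indicE; case: (boolP (z \in A)) => [|_]; last first.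
      by rewrite -EFinM lee_fin mulr_ge0 ?sqr_ge0// ltW.
    rewrite inE => -[/= Fz Oz]; rewrite -EFinM lee_fin -exprMn.
    have : k.+1%:R^-1 <= cabs ((z.1 : R[i]) - z.2).
      rewrite leNgt; apply/negP => h; apply: Fz; exists z.2 => //.
      by apply/ball_cabs; rewrite -cabsN opprB.
    move=> h; rewrite -(ler_pM2l (ltr0Sn R k)) divff// in h.
    by rewrite /= exprn_ege1.
  rewrite -(rho1 _ (mF k)) -(rho2 _ mO).
  have m1 : measurable (fst @^-1` F k : set (borelC R * borelC R)).
    by rewrite -[X in measurable X]setTI; apply: measurable_fst.
  have m2 : measurable (snd @^-1` O : set (borelC R * borelC R)).
    by rewrite -[X in measurable X]setTI; apply: measurable_snd.
  apply: (@le_trans _ _ (rho (snd @^-1` O `|` A))).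
    apply: le_measure; rewrite ?inE//; first exact: measurableU.
    by move=> z Fz; have [Oz|nOz] := pselect (O z.2); [left|right].
  apply: le_trans (measureU2 _ m2 mA) _; exact: leeD2l.
have OF : \bigcup_k F k = O.
  apply/seteqP; split=> z.
    move=> [k _ Fz]; apply: contrapT => nOz; apply: Fz; exists z => //.
    by apply/ball_cabs; rewrite subrr ComplexField.Normc.normc0 invr_gt0.
  move=> Oz; move: oO; rewrite openE => /(_ _ Oz) /nbhs_ballP[[e i]].
  rewrite /= ltcE/= => /andP[/eqP -> e0] eU.
  have [k] := ltr_add_invr e0; rewrite add0r => ke.
  exists k => // -[y nOy /ball_cabs yz]; apply: nOy; apply: eU.
  by apply/ball_cabs; rewrite -cabsN opprB; exact: lt_trans ke.
have ndF : nondecreasing_seq F.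
  move=> j k jk; apply/subsetPset => z Fz [y nOy /ball_cabs yz]; apply: Fz.
  exists y => //; apply/ball_cabs; apply: lt_le_trans yz _.
  by rewrite lef_pV2 ?posrE// ler_nat ltnS.
have mbF : measurable (\bigcup_k F k) by rewrite OF.
have c := nondecreasing_cvg_mu (mu := mu) mF mbF ndF; rewrite OF in c.
rewrite -(cvg_lim _ c)//; apply: lime_le; last exact: nearW.
by apply/cvg_ex; eexists; exact: c.
Qed.

(** The points of an open set at distance at least 1/k from its complement can
    only be moved out of it at cost 1/k^2; so a cheap coupling shows that their
    mass under [mu] exceeds that of the whole set under [nu] by a small error
    at most. Letting k tend to infinity, the laws agree on open sets. *)
Lemma close_couplings_eq (mu nu : probability (borelC R) R) :
  (forall e, 0 < e -> exists2 rho, coupling mu nu rho & (cost rho <= e%:E)%E) ->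
  mu ≡μ nu.
Proof.
move=> H.
have H' e : 0 < e -> exists2 rho, coupling nu mu rho & (cost rho <= e%:E)%E.
  move=> e0; have [rho [rho1 rho2] crho] := H e e0.
  pose swp (z : borelC R * borelC R) := (z.2, z.1).
  have ms : measurable_fun setT swp.
    by apply: measurable_fun_pair; [exact: measurable_snd|exact: measurable_fst].
  exists (law rho ms); first by split=> B mB; [exact: rho2|exact: rho1].
  rewrite /cost -(sqm_law ms (has_law_law _ _)); last first.
    by apply: cmeasB; apply/cmeasP; [exact: measurable_fst|exact: measurable_snd].
  by rewrite -[X in sqm _ X]/(fun z : borelC R * borelC R => (z.2 : R[i]) - z.1) sqmBC.
move=> B mB; apply: (@measure_unique _ _ (borelC R) (@open R[i]^o : set (set (borelC R))) (fun=> setT) _ _ _ _ mu nu) => //.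
- by move=> C D oC oD; exact: openI.
- by move=> _; exact: openT.
- by rewrite bigcup_const//; exists 0%N.
- by move=> O oO; apply/eqP; rewrite eq_le !le_open.
- by move=> _; rewrite [X in (X < _)%E]probability_setT ltry.
Qed.

End close_couplings.

(** * [M] is a fixed point of [T] *)

Section fixed_point.
Context (R : realType) d0 (Omega0 : measurableType d0) (P0 : probability Omega0 R)
  (a : nat -> {RV P0 >-> R}) (alpha beta : R).
Hypotheses (a_ge0 : forall j w, 0 <= a j w) (alpha1 : 1 <= alpha) (ab : alpha <= beta)
  (ga : good_weights (path_law a) (@abs_path R)
     ((alpha * beta + 1) / (alpha + beta)) (alpha + beta)^-1).

Notation S := (seqR R * (borelC R * borelC R))%type.
Notation tI := (seq nat + seq nat)%type.
Notation X := (famT S tI).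

Let aK : alpha < alpha + beta.
Proof. by move: alpha1 ab => h1 h2; lra. Qed.

(* The first marks multiply the weights, the second ones serve as leaves. *)
Let q : probability S R := (path_law a \x (M a \x M a))%E.

Let qa : has_law q fst (path_law a). Proof. exact: has_law_fst. Qed.
Let qs : has_law q snd (M a \x M a)%E. Proof. exact: has_law_snd. Qed.
Let qM1 : has_law q (@first_mark R : S -> borelC R) (M a).
Proof. exact: (has_law_comp measurable_fst qs (has_law_fst _ _)). Qed.
Let qM2 : has_law q (@second_mark R : S -> borelC R) (M a).
Proof. exact: (has_law_comp measurable_snd qs (has_law_snd _ _)). Qed.

Notation Pi := (fam_prod (tlaw q q)).
Let FP := ae_filter_ringOfSetsType Pi.

Let gA := good_AS ga qa.
Let m1 := cmeas_first_mark R.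
Let m2 := cmeas_second_mark R.
Let mM := moments_M a_ge0 alpha1 ab ga.
Let l1 : cL2 q (@first_mark R). Proof. by have [] := (moments_law m1 qM1 alpha).1 mM. Qed.
Let e1 : Ec q (@first_mark R) = 1. Proof. by have [] := (moments_law m1 qM1 alpha).1 mM. Qed.
Let s1 : ip q (@first_mark R) (@first_mark R) = alpha%:C.
Proof. by apply: ip_self => //; have [] := (moments_law m1 qM1 alpha).1 mM. Qed.

Definition leaf (x : X) : R[i] := second_mark (x (inl [::])).

Let lawleaf : has_law Pi (leaf : X -> borelC R) (M a).
Proof.
apply: (has_law_comp _ (fam_prod_coord (tlaw q q) (inl [::])) qM2).
by apply/cmeasP.
Qed.

Let dleaf : markless leaf.
Proof. by move=> x y xy; rewrite /leaf (xy (inl [::])). Qed.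

Let mleaf : cmeas leaf.
Proof. exact: (cmeas_comp (@measurable_coord _ S tI (inl [::])) m2). Qed.

Let lleaf : cL2 Pi leaf. Proof. by have [] := (moments_law mleaf lawleaf alpha).1 mM. Qed.
Let eleaf : Ec Pi leaf = 1. Proof. by have [] := (moments_law mleaf lawleaf alpha).1 mM. Qed.

Notation V := (yl (@AS R) (@first_mark R) leaf).

Let lV n : cL2 Pi (V n). Proof. exact: (cL2_yl gA l1 n lleaf dleaf). Qed.

Let mV n : measurable_fun setT (V n : X -> borelC R).
Proof. by apply/cmeasP; exact: (lV n).1. Qed.

Let m_re j : measurable_fun setT (fun x : X => (x \o tchild j : X)).
Proof. by apply: measurable_fam => i; exact: measurable_coord. Qed.

Let mweight j : measurable_fun setT (fun x : X => (x (inl [::])).1 j).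
Proof.
exact: (measurableT_comp (@measurable_coord _ R nat j)
  (measurableT_comp measurable_fst (@measurable_coord _ S tI _))).
Qed.

Let mmark j : measurable_fun setT (fun x : X => first_mark (x (inr [:: j])) : borelC R).
Proof. by apply/cmeasP; exact: (cmeas_comp (@measurable_coord _ S tI _) m1). Qed.

Let mVre n j : measurable_fun setT (fun x : X => V n (x \o tchild j) : borelC R).
Proof. exact: (measurableT_comp (mV n) (m_re j)). Qed.

Let root_ge0 : {ae Pi, forall x : X, forall j, 0 <= (x (inl [::])).1 j}.
Proof.
have H : {ae q, forall s : S, forall j, 0 <= s.1 j}.
  exact: (has_law_ae measurable_fst qa (path_law_ge0 a_ge0)).
exact: (has_law_ae (@measurable_coord _ S tI _) (fam_prod_coord (tlaw q q) (inl [::])) H).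
Qed.

Let lawV n : has_law Pi (V n : X -> borelC R) (M a).
Proof.
elim: n => [|n IH]; first exact: lawleaf.
suff H : is_quadratic_image a (M a) (law Pi (mV n.+1)).
  move=> B mB.
  exact: (is_quadratic_image_unique H (quadratic_image_M a_ge0 alpha1 ab ga) mB).
exists _, X, Pi, (fun j => mkmfun (mweight j)), (fun j => mkmfun (mmark j)),
  (fun j => mkmfun (mVre n j)), (mkmfun (mV n.+1)).
split.
- split.
  + exact: (has_law_comp measurable_fst (fam_prod_coord (tlaw q q) (inl [::])) qa).
  + move=> j; apply: (has_law_comp _ (fam_prod_coord (tlaw q q) (inr [:: j])) qM1).
    by apply/cmeasP.
  + move=> j; apply: (has_law_comp (mV n) _ IH).
    by apply: fam_prod_reindex => [[u|u] [v|v]//= [->]|[]].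
- pose J (i : option (nat + nat)) : set tI := match i with
    | None => [set inl [::]]
    | Some (inl j) => [set inr [:: j]]
    | Some (inr j) => tchild j @` (~` [set inr [::]]) end.
  apply: (@fam_prod_mutually_independent _ _ _ _ (tlaw q q) _ _ J).
  + move=> [[j|j]|] E; apply: generated_sigma_depends.
    * exact: mmark.
    * by move=> x y xy /=; rewrite (xy (inr [:: j])).
    * exact: mVre.
    * move=> x y xy; apply: (markless_yl (@AS R) (@first_mark R) n dleaf) => i ni.
      by apply: xy; exists i.
    * exact: measurable_path_of.
    * by move=> x y xy; rewrite /path_of/= (xy (inl [::])).
  + move=> [[j|j]|] [[k|k]|] ne; rewrite -subset0 => i //= [].
    * by move=> -> [e]; rewrite e eqxx in ne.
    * by move=> -> [[u|u] nu] //= [e1' e2']; apply: nu; rewrite /= e2'.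
    * by move=> ->.
    * by move=> [[u|u] nu <-] //= [e1' e2']; apply: nu; rewrite /= e2'.
    * by move=> [[u|u] nu <-] [[v|v] nv] //= [e1' e2']; rewrite e1' eqxx in ne.
    * by move=> [[u|u] nu <-].
    * by move=> ->.
    * by move=> -> [[u|u] nu].
- have sx := tbb_summable gA l1 (lV n) (markless_yl (@AS R) (@first_mark R) n dleaf).
  apply: (@filterS2 _ _ FP _ _ _ _ root_ge0 sx) => x x0 {}sx /=.
  have e j : (AS (x (inl [::])) j)%:C * (first_mark (x (inr [:: j])) * V n (x \o tchild j)) =
     ((x (inl [::])).1 j)%:C * first_mark (x (inr [:: j])) * V n (x \o tchild j).
    by rewrite mulrA /AS /abs_path ger0_norm.
  apply: cvg_totally_abs; first by under eq_eseriesr do rewrite -e.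
  have := cvg_Csum sx; apply: cvg_trans; apply: near_eq_cvg; apply: nearW => N.
  by apply: eq_bigr => j _; rewrite e.
- exact: has_law_law.
Qed.

(** Started from leaves with law [M a], the smoothing sums all have law
    [M a], because this law solves the quadratic equation. As leaves are
    irrelevant in the limit, they converge in L2 to a variable with law
    [T a (M a)]. *)
Lemma T_fixed_M : T a (M a) ≡μ M a.
Proof.
have alpha0 : 0 <= alpha by exact: le_trans alpha1.
have my := measurable_ylim ga qa m1 qM1 mM.
have conv := yl_to_ylim alpha1 ab gA l1 e1 s1 alpha0 aK lleaf dleaf eleaf.
apply: close_couplings_eq => e e0.
have [n _ /(_ n (leqnn n)) /= small] : \forall n \near \oo,
    (sqm Pi (fun x => V n x - ylim (@AS R) (@first_mark R) x)%R < e%:E)%E.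
  apply: (conv [set y | (y < e%:E)%E]); apply: (open_ereal_lt' (x := 0%E)).
  by rewrite lte_fin.
have mp : measurable_fun setT (fun x : X =>
    (ylim (@AS R) (@first_mark R) x : borelC R, V n x : borelC R)).
  by apply: measurable_fun_pair.
exists (law Pi mp).
  by split; [exact: (T_law a_ge0 alpha1 ab ga mM aK qa m1 qM1)|exact: lawV].
rewrite /cost -(sqm_law mp (has_law_law _ _)); last first.
  by apply: cmeasB; apply/cmeasP; [exact: measurable_fst|exact: measurable_snd].
rewrite -[X in sqm _ X]/(fun x : X => ylim (@AS R) (@first_mark R) x - V n x) sqmBC.
exact: ltW.
Qed.

End fixed_point.

(** * Rates of convergence *)

Section rates.
Context (R : realType) (alpha beta : R).
Hypotheses (alpha1 : 1 <= alpha) (ab : alpha <= beta).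

Definition phi (x : R) : R := alpha * beta / (alpha + beta - x).

Let K0 : 0 < alpha + beta. Proof. by move: alpha1 ab => h1 h2; lra. Qed.

Lemma phi_bounds m x : alpha <= m -> m <= beta -> 0 <= x <= m -> 0 <= phi x <= m.
Proof.
move=> am mb /andP[x0 xm]; have a1 := alpha1; have ab' := ab.
have d0 : 0 < alpha + beta - x by lra.
rewrite /phi divr_ge0 ?(ltW d0)//=; last by nra.
rewrite ler_pdivrMr//; nra.
Qed.

Lemma iter_phi_bounds m x n : alpha <= m -> m <= beta -> 0 <= x <= m ->
  0 <= iter n phi x <= m.
Proof. by move=> am mb x0; elim: n => //= n IH; exact: phi_bounds. Qed.

Let gap n := alpha - iter n phi 1.

Let gap_bounds n : 0 <= gap n <= alpha.
Proof.
have := @iter_phi_bounds alpha 1 n (lexx _) ab; rewrite ler01 alpha1 => /(_ isT).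
by rewrite /gap => /andP[h1 h2]; lra.
Qed.

Let gapS n : gap n.+1 = alpha * gap n / (beta + gap n).
Proof.
have /andP[g0 _] := gap_bounds n; have a1 := alpha1; have ab' := ab.
have -> : gap n.+1 = alpha - phi (iter n phi 1) by [].
have -> : iter n phi 1 = alpha - gap n by rewrite /gap; ring.
have n0 : beta + gap n != 0 by rewrite gt_eqF//; lra.
rewrite /phi (_ : alpha + beta - _ = beta + gap n); last by ring.
by field.
Qed.

(** The gap e satisfies 1 / e' >= 1 / e + 1 / alpha. *)
Lemma gap_harmonic n : n%:R * (alpha - iter n phi 1) <= alpha.
Proof.
rewrite -/(gap n); elim: n => [|n IH]; first by rewrite mul0r (le_trans _ alpha1).
have /andP[g0 _] := gap_bounds n; have a1 := alpha1; have ab' := ab.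
rewrite gapS mulrA ler_pdivrMr; last by lra.
rewrite -natr1; move: IH g0; move: (gap n) (n%:R : R) => g k h g0; nra.
Qed.

Lemma gap_geometric n : alpha - iter n phi 1 <= alpha * (alpha / beta) ^+ n.
Proof.
have a1 := alpha1; have ab' := ab; have b0 : 0 < beta by lra.
rewrite -/(gap n); elim: n => [|n IH].
  by rewrite expr0 mulr1; have /andP[] := gap_bounds 0.
have /andP[g0 _] := gap_bounds n.
rewrite gapS exprS mulrCA.
apply: (@le_trans _ _ (alpha / beta * gap n)); last first.
  by rewrite ler_wpM2l// divr_ge0//; lra.
rewrite ler_pdivrMr; last by lra.
have -> : alpha / beta * gap n * (beta + gap n) = alpha * gap n + alpha / beta * gap n ^+ 2.
  by field; rewrite gt_eqF.
by rewrite lerDl mulr_ge0 ?sqr_ge0// divr_ge0//; lra.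
Qed.

(** In the coordinate [(x - alpha) / (beta - x)] the map [phi] is the
    multiplication by [alpha / beta]. *)
Lemma excess_geometric s n : 0 <= s -> s < beta -> alpha < beta ->
  iter n phi s - alpha <= `|s - alpha| / (beta - s) * beta * (alpha / beta) ^+ n.
Proof.
move=> s0 sb lt; have a1 := alpha1; have b0 : 0 < beta by lra.
pose r := `|s - alpha| / (beta - s).
have r0 : 0 <= r by rewrite divr_ge0// subr_ge0 ltW.
pose m := Num.max alpha s.
have [am mb] : alpha <= m /\ m <= beta.
  by rewrite /m le_max lexx ge_max ab (ltW sb).
have sm : 0 <= s <= m by rewrite s0 /m le_max lexx orbT.
have mlt : m < beta by rewrite /m gt_max lt sb.
have bnd k := @iter_phi_bounds m s k am mb sm.
have lam0 k : 0 <= (alpha / beta) ^+ k by rewrite exprn_ge0// divr_ge0//; lra.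
suff H k : iter k phi s - alpha <= r * (alpha / beta) ^+ k * (beta - iter k phi s).
  apply: le_trans (H n) _; rewrite -mulrA [leRHS]mulrAC -[leRHS]mulrA.
  apply: ler_wpM2l => //; apply: ler_wpM2l => //.
  by have /andP[h _] := bnd n; lra.
elim: k => [|k IH].
  by rewrite expr0 mulr1 /r divfK ?ler_norm// gt_eqF// subr_gt0.
have /andP[x0 xm] := bnd k; move: IH x0 xm; rewrite iterS exprS.
move: (iter k phi s) ((alpha / beta) ^+ k) (lam0 k) => x l l0 IH x0 xm.
have d0 : 0 < alpha + beta - x by lra.
have dn : alpha + beta - x != 0 by rewrite gt_eqF.
have bn : beta != 0 by rewrite gt_eqF.
have -> : phi x - alpha = alpha / (alpha + beta - x) * (x - alpha) by rewrite /phi; field.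
have -> : r * (alpha / beta * l) * (beta - phi x) =
    alpha / (alpha + beta - x) * (r * l * (beta - x)).
  by rewrite /phi; field; rewrite dn bn.
by apply: ler_wpM2l => //; rewrite divr_ge0 ?ltW//; lra.
Qed.

End rates.

Section contraction.
Context (R : realType) d0 (Omega0 : measurableType d0) (P0 : probability Omega0 R)
  (a : nat -> {RV P0 >-> R}) (alpha beta : R).
Hypotheses (a_ge0 : forall j w, 0 <= a j w) (alpha1 : 1 <= alpha) (ab : alpha <= beta)
  (ga : good_weights (path_law a) (@abs_path R)
     ((alpha * beta + 1) / (alpha + beta)) (alpha + beta)^-1).

Notation phi := (phi alpha beta).

Lemma cost_coupling (mu nu : probability (borelC R) R) (s s' u : R) rho :
  moments mu s -> moments nu s' -> coupling mu nu rho -> cov rho = u%:C ->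
  cost rho = (s + s' - 2 * u)%:E.
Proof.
move=> [l1 e1 q1] [l2 e2 q2] [r1 r2] cu.
have m1 : measurable_fun setT (fst : borelC R * borelC R -> borelC R) by exact: measurable_fst.
have m2 : measurable_fun setT (snd : borelC R * borelC R -> borelC R) by exact: measurable_snd.
have L1 : cL2 rho (fun z => z.1 : R[i]) := cL2_law m1 r1 l1.
have L2 : cL2 rho (fun z => z.2 : R[i]) := cL2_law m2 r2 l2.
have Q1 : ip rho (fun z => z.1 : R[i]) (fun z => z.1 : R[i]) = s%:C.
  by apply: ip_self => //; rewrite -q1 -(sqm_law m1 r1 (cmeas_idC R)).
have Q2 : ip rho (fun z => z.2 : R[i]) (fun z => z.2 : R[i]) = s'%:C.
  by apply: ip_self => //; rewrite -q2 -(sqm_law m2 r2 (cmeas_idC R)).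
by rewrite /cost (sqmB L1 L2) Q1 Q2 -/(cov rho) cu.
Qed.

Lemma dW2_le_cost (mu nu : probability (borelC R) R) rho : coupling mu nu rho ->
  (dW2 mu nu ^+ 2 <= cost rho)%E.
Proof.
move=> c; rewrite /dW2 sqr_sqrte; last first.
  by apply: le_ereal_inf_tmp => _ [r _ <-]; exact: sqm_ge0.
by apply: ereal_inf_lbound; exists rho.
Qed.

Lemma coupling_congr (mu mu' nu nu' : probability (borelC R) R) rho :
  mu ≡μ mu' -> nu ≡μ nu' -> coupling mu nu rho -> coupling mu' nu' rho.
Proof.
by move=> e e' [r1 r2]; split=> B mB; [rewrite r1// e|rewrite r2// e'].
Qed.

Lemma product_coupling (mu nu : probability (borelC R) R) s s' :
  moments mu s -> moments nu s' ->
  exists2 rho, coupling mu nu rho & cov rho = 1%:C.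
Proof.
move=> [l1 e1 _] [l2 e2 _]; exists (mu \x nu)%E.
  by split; [exact: has_law_fst|exact: has_law_snd].
have m1 : measurable_fun setT (fst : borelC R * borelC R -> borelC R) by exact: measurable_fst.
have m2 : measurable_fun setT (snd : borelC R * borelC R -> borelC R) by exact: measurable_snd.
have r1 := has_law_fst mu nu; have r2 := has_law_snd mu nu.
have mJ : cmeas (fun z : borelC R => (z : R[i])^*) by apply: cmeasJ; exact: cmeas_idC.
have mJ' : measurable_fun setT (fun z : borelC R => (z : R[i])^* : borelC R) by exact/cmeasP.
have ind0 : indep (mu \x nu)%E (fst : borelC R * borelC R -> borelC R)
    (snd : borelC R * borelC R -> borelC R).
  move=> A B mA mB; rewrite r1// r2// (_ : _ `&` _ = A `*` B); last by apply/seteqP; split=> x [].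
  exact: product_measure1E.
have ind := indep_comp (@measurable_id _ (borelC R) setT) mJ' ind0.
have c1 : cint (mu \x nu)%E (fun z => z.1 : R[i]) := cL2_cint (cL2_law m1 r1 l1).
have lJ : cL2 nu (fun z => (z : R[i])^*).
  by apply: (le_cL2 mJ l2) => z; rewrite cabsJ.
have c2 : cint (mu \x nu)%E (fun z => (z.2 : R[i])^*) := cL2_cint (cL2_law m2 r2 lJ).
have E1 : Ec (mu \x nu)%E (fun z => z.1 : R[i]) = 1.
  by rewrite -e1 -(Ec_law m1 r1 (cmeas_idC R)).
have E2 : Ec (mu \x nu)%E (fun z => (z.2 : R[i])^*) = 1.
  rewrite -[LHS]/(Ec _ ((fun z : borelC R => (z : R[i])^*) \o snd)) (Ec_law m2 r2 mJ).
  by rewrite (EcJ (cL2_cint l2)) e2; exact: conjc1.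
by rewrite /cov /ip (Ec_indep ind c1 c2).2 E1 E2 mulr1.
Qed.

Section orbit.
Context (mu : probability (borelC R) R) (s m : R).
Hypotheses (mmu : moments mu s) (am : alpha <= m) (mb : m <= beta) (sm : s <= m).

Let s0 : 0 <= s.
Proof. by have [_ _ e] := mmu; rewrite -lee_fin -e sqm_ge0. Qed.

Let ltK x : x <= m -> x < alpha + beta.
Proof. by move: alpha1 mb => h1 h2 h3; lra. Qed.

Lemma moments_iter_T n : moments (iter n (T a) mu) (iter n phi s).
Proof.
elim: n => // n IH; rewrite !iterS; apply: (moments_T a_ge0 alpha1 ab ga IH).
apply: ltK; have := @iter_phi_bounds R alpha beta alpha1 ab m s n am mb.
by rewrite s0 sm => /(_ isT)/andP[].
Qed.

(** The covariance starts at 1, for independent coordinates; like the second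
    moments, it evolves under [phi], whose orbit of 1 increases to [alpha]. *)
Lemma coupling_iter_T n : exists2 rho, coupling (iter n (T a) mu) (M a) rho &
  cov rho = (iter n phi 1)%:C.
Proof.
have mM := moments_M a_ge0 alpha1 ab ga.
elim: n => [|n [rho crho covrho]]; first exact: product_coupling mmu mM.
have := @iter_phi_bounds R alpha beta alpha1 ab m s n am mb.
rewrite s0 sm => /(_ isT)/andP[_ sn].
have := @iter_phi_bounds R alpha beta alpha1 ab alpha 1 n (lexx _) ab.
rewrite ler01 alpha1 => /(_ isT)/andP[u0 u1].
have [rho' c' cov'] := T_coupling a_ge0 alpha1 ab ga (moments_iter_T n) (ltK sn)
  mM (ltK am) crho covrho u0 (ltK (le_trans u1 am)).
exists rho' => //; apply: coupling_congr c' => //.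
exact: (T_fixed_M a_ge0 alpha1 ab ga).
Qed.

Lemma cost_iter_T n : exists2 rho, coupling (iter n (T a) mu) (M a) rho &
  cost rho = (iter n phi s - alpha + 2 * (alpha - iter n phi 1))%:E.
Proof.
have [rho crho covrho] := coupling_iter_T n; exists rho => //.
rewrite (cost_coupling (moments_iter_T n) (moments_M a_ge0 alpha1 ab ga) crho covrho).
by congr (_%:E); ring.
Qed.

Lemma T_congr (nu : probability (borelC R) R) : mu ≡μ nu -> T a mu ≡μ T a nu.
Proof.
move=> e; have sK := ltK sm.
have mnu : moments nu s.
  apply/(moments_law (f := @idC R) (cmeas_idC R) (P := mu)) => //.
have := is_T_T a_ge0 alpha1 ab ga mnu sK.
apply: (is_T_unique a_ge0 alpha1 ab ga mnu sK).
have := is_T_T a_ge0 alpha1 ab ga mmu sK.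
case=> d; case=> Om; case=> P; case=> A; case=> W; case=> Y [[cA lW] ind YY lY].
exists d, Om, P, A, W, Y; split=> //; split=> // u B mB.
by rewrite (lW u B mB) e.
Qed.

End orbit.

Lemma calP_M : calP alpha (M a).
Proof. exact: (moments_calP alpha1 (lexx _) (moments_M a_ge0 alpha1 ab ga)). Qed.

Lemma cost_harmonic mu n : calP alpha mu -> exists2 rho,
  coupling (iter n.+1 (T a) mu) (M a) rho & (cost rho <= (2 * alpha / n.+1%:R)%:E)%E.
Proof.
move=> /calP_moments[s [s1 sa mmu]].
have [rho crho e] := cost_iter_T mmu (lexx _) ab sa n.+1; exists rho => //; rewrite e.
have := @iter_phi_bounds R alpha beta alpha1 ab alpha s n.+1 (lexx _) ab.
rewrite sa (le_trans ler01 s1) => /(_ isT)/andP[_ h].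
have := gap_harmonic alpha1 ab n.+1; rewrite mulrC -ler_pdivlMr ?ltr0Sn// => h2.
rewrite lee_fin -mulrA -[leRHS]add0r; apply: lerD; first by rewrite subr_le0.
by rewrite ler_wpM2l.
Qed.

Lemma dW2_harmonic mu : calP alpha mu ->
  exists K : R, \forall n \near \oo,
    (dW2 (iter n (T a) mu) (M a) ^+ 2 <= (K / n%:R)%:E)%E.
Proof.
move=> cmu; exists (2 * alpha); exists 1%N => // -[//|n] _ /=.
by have [rho /dW2_le_cost h] := cost_harmonic n cmu; exact: le_trans.
Qed.

Lemma dW2_geometric mu gamma : alpha < beta -> alpha <= gamma -> gamma < beta ->
  calP gamma mu ->
  exists K : R, \forall n \near \oo,
    (dW2 (iter n (T a) mu) (M a) ^+ 2 <= (K * (alpha / beta) ^+ n)%:E)%E.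
Proof.
move=> lt ag gb /calP_moments[s [s1 sg mmu]].
have s0 := le_trans ler01 s1; have sb := le_lt_trans sg gb.
exists (`|s - alpha| / (beta - s) * beta + 2 * alpha); apply: nearW => n.
have [rho /dW2_le_cost h e] := cost_iter_T mmu ag (ltW gb) sg n.
apply: le_trans h _; rewrite e lee_fin [leRHS]mulrDl; apply: lerD.
  exact: excess_geometric.
by rewrite -mulrA ler_wpM2l// gap_geometric.
Qed.

Lemma fixed_unique (mu : probability (borelC R) R) : calP alpha mu -> T a mu ≡μ mu -> mu ≡μ M a.
Proof.
move=> cmu fmu; have [s [s1 sa mmu]] := calP_moments cmu.
have it n : iter n (T a) mu ≡μ mu.
  elim: n => // n IH B mB; rewrite iterS.
  have sn : iter n phi s <= alpha.
    have := @iter_phi_bounds R alpha beta alpha1 ab alpha s n (lexx _) ab.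
    by rewrite sa (le_trans ler01 s1) => /(_ isT)/andP[].
  have mn := moments_iter_T mmu (lexx _) ab sa n.
  exact: etrans (T_congr mn ab sn IH mB) (fmu B mB).
apply: close_couplings_eq => e e0.
have [n] := ltr_add_invr (divr_gt0 e0 (mulr_gt0 (ltr0n R 2) (lt_le_trans ltr01 alpha1))).
rewrite add0r => ne; have [rho c h] := cost_harmonic n cmu.
exists rho; first exact: coupling_congr (it n.+1) _ c.
apply: le_trans h _; rewrite lee_fin.
have a0 : 0 < 2 * alpha by rewrite mulr_gt0// (lt_le_trans ltr01).
by rewrite mulrC -ler_pdivlMr// ltW.
Qed.

Lemma M_solves : solves_quadratic_equation a (M a).
Proof.
have h := quadratic_image_M a_ge0 alpha1 ab ga; split=> // nu hnu.
exact: is_quadratic_image_unique hnu h.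
Qed.

End contraction.

(** By Vieta's formulas, alpha + beta = b q = 1 / E (sum of the squares), and
    alpha beta + 1 = b. Since [b] is nonzero, neither of the two moments that
    define it has the value 0, which [fine] would also give to an infinite
    one. *)
Lemma good_path_weights (R : realType) d (Omega : measurableType d)
    (P : probability Omega R) (a : nat -> {RV P >-> R}) (alpha beta : R) :
  (forall j w, 0 <= a j w) ->
  (\int[P]_w total_weight a w = 1)%E ->
  (\int[P]_w (total_weight a w ^+ 2) < +oo)%E ->
  2 < param_b a ->
  'X^2 - (param_b a * param_q a) *: 'X + (param_b a - 1)%:P =
      ('X - alpha%:P) * ('X - beta%:P) :> {poly R} ->
  good_weights (path_law a) (@abs_path R)
     ((alpha * beta + 1) / (alpha + beta)) (alpha + beta)^-1.
Proof.
move=> a_ge0 a_mean a_sqr b_gt2 roots.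
have hE := (hornerD, hornerN, hornerZ, hornerM, hornerX, hornerC, hornerXn).
have e0 : param_b a - 1 = alpha * beta.
  by have := congr1 (horner ^~ 0) roots; rewrite !hE; lra.
have e1 : param_b a * param_q a = alpha + beta.
  by have := congr1 (horner ^~ 1) roots; rewrite !hE; lra.
pose E2 := fine (\int[P]_w (total_weight a w ^+ 2))%E.
pose D := fine (\int[P]_w \sum_(0 <= j <oo) (a j w ^+ 2)%:E)%E.
have b0 : 0 < param_b a by lra.
have bE : param_b a = E2 / D by [].
have D0 : D != 0 by apply/eqP => D0; move: b0; rewrite bE D0 invr0 mulr0 ltxx.
have E20 : E2 != 0 by apply/eqP => E20; move: b0; rewrite bE E20 mul0r ltxx.
have DE : D = (alpha + beta)^-1.
  by rewrite -e1 bE /param_q -/E2 mulrAC divff// mul1r invrK.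
have E2E : E2 = (alpha * beta + 1) / (alpha + beta).
  by rewrite -DE -e0 subrK bE divfK.
have mp := @measurable_path_of R _ Omega P a.
apply/(good_weights_law (@abs_path R) _ _ mp (has_law_law P mp)); split.
  split; last by move=> t j; exact: normr_ge0.
  move=> j; apply: measurableT_comp => //; exact: (@measurable_coord _ R nat j).
have absE w j : abs_path (path_of a w) j = a j w by rewrite /abs_path ger0_norm// a_ge0.
split.
- by move=> j; apply: measurableT_comp => //; exact: measurable_funPT.
- by move=> t j; exact: normr_ge0.
- rewrite -a_mean; apply: eq_integral => w _; apply: eq_eseriesr => j _; by rewrite absE.
- rewrite -E2E /E2 fineK; last first.
    by rewrite ge0_fin_numE//; apply: integral_ge0 => w _; exact: sqre_ge0.
  apply: eq_integral => w _; congr (_ ^+ 2)%E.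
  by apply: eq_eseriesr => j _; rewrite absE.
- rewrite -DE /D fineK.
    by apply: eq_integral => w _; apply: eq_eseriesr => j _; rewrite absE.
  move: D0; rewrite /D; case: (integral _ _ _) => [r||]//=; by rewrite eqxx.
Qed.

Local Close Scope complex_scope.

Theorem theorem3 (R : realType) (d : measure_display)
  (Omega : measurableType d) (P : probability Omega R)
  (a : nat -> {RV P >-> R})
  (a_ge0 : forall j w, 0 <= a j w)
  (a_mean : (\int[P]_w total_weight a w = 1)%E)
  (a_sqr : (\int[P]_w (total_weight a w ^+ 2) < +oo)%E)
  (a_not01 : ~ {ae P, forall w, forall j, a j w = 0 \/ a j w = 1})
  (b_gt2 : 2 < param_b a)
  (alpha beta : R)
  (alpha_beta_roots :
    'X^2 - (param_b a * param_q a) *: 'X + (param_b a - 1)%:P =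
      ('X - alpha%:P) * ('X - beta%:P) :> {poly R})
  (alpha_le_beta : alpha <= beta)
  (alpha_ge1 : 1 <= alpha) :
  [/\ [/\ calP alpha (M a),
          T a (M a) ≡μ M a &
          forall mu, calP alpha mu -> T a mu ≡μ mu -> mu ≡μ M a],
      alpha = beta ->
        forall mu, calP alpha mu ->
          exists K : R, \forall n \near \oo,
            (dW2 (iter n (T a) mu) (M a) ^+ 2 <= (K / n%:R)%:E)%E,
      alpha < beta ->
        forall mu gamma, alpha <= gamma -> gamma < beta -> calP gamma mu ->
          exists K : R, \forall n \near \oo,
            (dW2 (iter n (T a) mu) (M a) ^+ 2
               <= (K * (alpha / beta) ^+ n)%:E)%E &
      solves_quadratic_equation a (M a)].
Proof.
have ga := good_path_weights a_ge0 a_mean a_sqr b_gt2 alpha_beta_roots.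
split; first split.
- exact: (calP_M a_ge0 alpha_ge1 alpha_le_beta ga).
- exact: (T_fixed_M a_ge0 alpha_ge1 alpha_le_beta ga).
- exact: (fixed_unique a_ge0 alpha_ge1 alpha_le_beta ga).
- by move=> _; exact: (dW2_harmonic a_ge0 alpha_ge1 alpha_le_beta ga).
- by move=> lt mu gamma; exact: (dW2_geometric a_ge0 alpha_ge1 alpha_le_beta ga lt).
- exact: (M_solves a_ge0 alpha_ge1 alpha_le_beta ga).
Qed.
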